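(* Let $(x_n)_{n\in\mathbb{N}}$ be a sequence of positive real numbers for which there exists $c>0$ such that $x_{n+1}-x_n\geq c$ for all $n\in\mathbb{N}$. Assume that there exists $\delta>0$ such that $$E^*_N\ll N^{5/2-\delta}.$$ Then $(x_n)_{n\in\mathbb{N}}$ is metric Poissonian.
   Context: $E^*_N$ denotes the number of quadruples of integers $(n_1,n_2,n_3,n_4)$ with $1\le n_1,n_2,n_3,n_4\le N$ and $|x_{n_1}-x_{n_2}+x_{n_3}-x_{n_4}|<1$. A real sequence $(y_n)_{n\in\mathbb{N}}$ has Poissonian pair correlation if for every $s>0$, $$\lim_{N\to\infty}\frac1N\left|\left\{1\le n_1\neq n_2\le N:\ \|y_{n_1}-y_{n_2}\|\le \frac sN\right\}\right|=2s,$$ where $\|\cdot\|$ denotes the distance to the nearest integer. A sequence $(x_n)_{n\in\mathbb{N}}$ is metric Poissonian if $(\alpha x_n)_{n\in\mathbb{N}}$ has Poissonian pair correlation for Lebesgue almost all $\alpha\in\mathbb{R}$. The notation $A(N)\ll B(N)$ means that there is a constant $C$, independent of $N$ (but possibly depending on the sequence and on $\delta$), with $|A(N)|\le C\,B(N)$ for all $N\in\mathbb{N}$. *)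

(* Defs.v *)
From HB Require Import structures.
From mathcomp Require Import all_boot all_order all_algebra.
From mathcomp Require Import all_classical all_reals all_analysis.

Set Implicit Arguments.
Unset Strict Implicit.
Unset Printing Implicit Defensive.

Import Order.TTheory GRing.Theory Num.Theory.
Import numFieldNormedType.Exports.

Local Open Scope classical_set_scope.
Local Open Scope ring_scope.

(* A sequence [(x_n)_(n >= 1)] is encoded as [x : nat -> R] with [x n]
   standing for [x_(n+1)], so that indices in [1, N] become elements of
   ['I_N]. *)

Definition Estar {R : realType} (x : nat -> R) (N : nat) : nat :=
  #|[set n : 'I_N * 'I_N * 'I_N * 'I_N |
      let: (n1, n2, n3, n4) := n in
      `|x n1 - x n2 + x n3 - x n4| < 1]%SET|.

Definition dist_int {R : realType} (t : R) : R :=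
  inf [set `|t - m%:~R| | m in [set: int]].

Definition pair_count {R : realType} (y : nat -> R) (s : R) (N : nat) : nat :=
  #|[set n : 'I_N * 'I_N |
      (n.1 != n.2) && (dist_int (y n.1 - y n.2) <= s / N%:R)]%SET|.

Definition poissonian_pair_correlation {R : realType} (y : nat -> R) : Prop :=
  forall s : R, 0 < s ->
    (fun N : nat => (N%:R)^-1 * (pair_count y s N)%:R) @ \oo --> 2 * s.

Definition metric_poissonian {R : realType} (x : nat -> R) : Prop :=
  {ae @lebesgue_measure R, forall alpha : R,
    poissonian_pair_correlation (fun n => alpha * x n)}.

(* Vinogradov's [A(N) << B(N)], with [N] ranging over positive integers. *)
Definition vinogradov_ll {R : realType} (A B : nat -> R) : Prop :=
  exists C : R, forall N : nat, (0 < N)%N -> `|A N| <= C * B N.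

(* Main.v *)
Require Import Defs.
From HB Require Import structures.
From mathcomp Require Import all_boot all_order all_algebra.
From mathcomp Require Import all_classical all_reals all_analysis.
From mathcomp Require Import measurable_realfun.
From mathcomp Require Import ring lra zify.

Set Implicit Arguments.
Unset Strict Implicit.
Unset Printing Implicit Defensive.

Import Order.TTheory GRing.Theory Num.Theory.
Import numFieldNormedType.Exports.

Local Open Scope ring_scope.

(** Every difference of two terms of the sequence is, up to sign, one of the
    positive reals z = x_m - x_n with n < m < N; let Z be the list of these.
    The pair correlation count of alpha x is twice the number of z in Z for
    which alpha z lies within s / N of an integer.

    Smoothing.  The indicator of that neighbourhood of the integers is
    squeezed, up to an error O(1 / N^2), between two trigonometric polynomials
    with constant coefficient close to 2 s / N and j-th coefficient c_j
    satisfying |c_j| <= A min(1 / N, 1 / j) ([smooth], [smooth_coef_le],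
    [smooth_near], [smooth_far]).  They are averages of Fejer kernels over a
    grid.  Their constant coefficients produce the limit 2 s; what remains is
    the [fluctuation], a finite sum of cosines in alpha whose frequencies are
    the products j z.

    Variance.  Integrating the square of the fluctuation against the window
    1 + cos (alpha / lam), whose Fourier transform decays at least quadratically, gives
    at most a constant times
    N^-2 sum |c_j c_k| / (1 + (j z - k w)^2) ([cos_sum_L2]).  Sorting the
    products j z into unit bins replaces the decaying kernel by the relation
    |j z - k w| < 1, and Cauchy-Schwarz over the bins lets j and k be confined
    to one dyadic block [J, 2 J) ([kernel_le_near_count], [dyadic_blocks]).

    Counting.  The heart of the matter is a bound for the number X of
    (j, z, k, w) with j, k < 2 J and |j z - k w| < 1.  Let E be the number of
    (z, w) with |z - w| < 1, which is at most the additive energy.  On a block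
    the relation says that J j z / k and J w are within 1 of each other, so
    Cauchy-Schwarz bounds the square of the count by 9 E times the number of
    solutions of |(j k') z - (j' k) w| < 4 J; after the divisor bound this is
    the number of lattice points (m, n) with m, n < 4 J^2 in the strip
    |m z - n w| < 4 J ([block_count]).  Such lattice points lie on few
    lines in the direction of a primitive vector (a, b).  Either they
    are accounted for by the area J^3 / max (z, w), or they are at most 16 J
    times the number of multiples of (a, b) that are themselves counted by X
    ([strip_count]).  Since sum 1 / max (z, w) is O (E log N), this gives

      X^2 <= N^o(1) E (J^3 E + J |Z|^2 + J X)

    ([dilated_energy]), a self-improving inequality.  With E = O(N^(5/2 - d))
    it bounds the variance by N^(-d + o(1)) ([weighted_block],
    [variance_count]).  This is an elementary form of Heath-Brown's method for
    mean values of Dirichlet polynomials: the passage from J to J^2 is the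
    Cauchy-Schwarz step, and the lattice point count plays the role of the
    reflection that brings J^2 back to J.

    Conclusion.  Along N = (i + 1)^K the mean squares are summable, so almost
    surely the fluctuation tends to 0 for all smoothing parameters
    simultaneously ([ae_fluctuation_cvg0]).  Consecutive terms of this
    subsequence have ratio tending to 1 and the counts are monotone in N and in
    the radius, so all N follow ([poissonian_upper], [poissonian_lower]). *)

(** * Near pairs and Cauchy-Schwarz over unit bins *)

Lemma cauchy_schwarz_sum (R : realType) (I : finType) (F G : I -> R) :
  (\sum_i F i * G i) ^+ 2 <= (\sum_i F i ^+ 2) * (\sum_i G i ^+ 2).
Proof.
have : 0 <= \sum_i \sum_j (F i * G j - F j * G i) ^+ 2.
  by apply: sumr_ge0 => i _; apply: sumr_ge0 => j _; exact: sqr_ge0.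
have -> : \sum_i \sum_j (F i * G j - F j * G i) ^+ 2 =
  ((\sum_i F i ^+ 2) * (\sum_i G i ^+ 2) - (\sum_i F i * G i) ^+ 2) * 2.
  transitivity (\sum_i \sum_j (F i ^+ 2 * G j ^+ 2 + G i ^+ 2 * F j ^+ 2
                - (F i * G i) * (F j * G j) * 2)).
    by apply: eq_bigr => i _; apply: eq_bigr => j _; ring.
  under eq_bigr => i _ do rewrite sumrB big_split /= -mulr_suml -!mulr_sumr.
  rewrite sumrB big_split /= -!mulr_suml; ring.
by rewrite pmulr_lge0 // subr_ge0.
Qed.

(** A weighted count of the pairs (s, u) falling in the same bin, where the
    bins are labelled by natural numbers. *)
Definition coincidence (R : realType) (S U : eqType) (r : seq S) (a : S -> R)
    (f : S -> nat) (r' : seq U) (b : U -> R) (g : U -> nat) : R :=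
  \sum_(s <- r) \sum_(u <- r') a s * b u * (f s == g u)%:R.

(** Grouping by bins exhibits the coincidence sum as an inner product, which is
    what makes it subject to Cauchy-Schwarz. *)
Lemma coincidence_bins (R : realType) (S U : eqType) (r : seq S) (a : S -> R)
    (f : S -> nat) (r' : seq U) (b : U -> R) (g : U -> nat) (B : nat) :
  (forall s, s \in r -> (f s < B)%N) ->
  coincidence r a f r' b g =
  \sum_(v < B) (\sum_(s <- r) a s * (f s == v)%:R)
             * (\sum_(u <- r') b u * (g u == v)%:R).
Proof.
move=> fB.
under [RHS]eq_bigr => v _ do rewrite mulr_suml.
rewrite exchange_big /=; apply: eq_big_seq => s sr.
under [RHS]eq_bigr => v _ do rewrite mulr_sumr.
rewrite exchange_big /=; apply: eq_bigr => u _.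
rewrite (bigD1 (Ordinal (fB _ sr))) //= big1 ?addr0.
  by rewrite eqxx mulr1 -mulrA (eq_sym (g u)).
move=> v; rewrite -val_eqE /= eq_sym => /negbTE ->.
by rewrite mulr0 mul0r.
Qed.

Lemma seq_bound (S : eqType) (r : seq S) (f : S -> nat) :
  exists B, forall s, s \in r -> (f s < B)%N.
Proof.
elim: r => [|s r [B IH]]; first by exists 0%N.
exists (maxn (f s).+1 B) => t; rewrite inE => /orP[/eqP->|/IH]; lia.
Qed.

Lemma coincidence_cauchy (R : realType) (S U : eqType) (r : seq S) (a : S -> R)
    (f : S -> nat) (r' : seq U) (b : U -> R) (g : U -> nat) :
  coincidence r a f r' b g ^+ 2 <= coincidence r a f r a f * coincidence r' b g r' b g.
Proof.
have [B1 fB1] := seq_bound r f; have [B2 gB2] := seq_bound r' g.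
have fB s : s \in r -> (f s < maxn B1 B2)%N by move/fB1; lia.
have gB s : s \in r' -> (g s < maxn B1 B2)%N by move/gB2; lia.
rewrite !(coincidence_bins _ _ _ _ fB) (coincidence_bins _ _ _ _ gB).
exact: cauchy_schwarz_sum.
Qed.

Definition near_count (R : realType) (P Q : seq R) : R :=
  \sum_(p <- P) \sum_(q <- Q) (`|p - q| < 1)%R%:R.

Lemma near_count_ge0 (R : realType) (P Q : seq R) : 0 <= near_count P Q.
Proof. by apply: sumr_ge0 => p _; apply: sumr_ge0 => q _. Qed.

Lemma truncn_dist (R : realType) (p q : R) : 0 <= p -> 0 <= q ->
  `|p - q| < 1 ->
  [|| Num.truncn p == Num.truncn q, (Num.truncn p).+1 == Num.truncn q
    | Num.truncn p == (Num.truncn q).+1].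
Proof.
move=> p0 q0; rewrite ltr_norml => /andP[h1 h2].
have /andP[p1 p2] := truncn_itv p0; have /andP[q1 q2] := truncn_itv q0.
have : ((Num.truncn p) < (Num.truncn q).+2)%N.
  rewrite -(ltr_nat R) -[X in _ < X%:R]addn1 natrD; lra.
have : ((Num.truncn q) < (Num.truncn p).+2)%N.
  rewrite -(ltr_nat R) -[X in _ < X%:R]addn1 natrD; lra.
lia.
Qed.

Lemma truncn_eq_dist (R : realType) (p q : R) : 0 <= p -> 0 <= q ->
  Num.truncn p = Num.truncn q -> `|p - q| < 1.
Proof.
move=> p0 q0 pq.
have /andP[p1 p2] := truncn_itv p0; have /andP[q1 q2] := truncn_itv q0.
move: p2 q2; rewrite -pq -addn1 natrD in q1 *.
rewrite ltr_norml; lra.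
Qed.

Lemma coincidence_truncn_le (R : realType) (S : eqType) (r : seq S) (a p : S -> R) :
  (forall s, s \in r -> 0 <= p s) -> (forall s, 0 <= a s) ->
  coincidence r a (fun s => Num.truncn (p s)) r a (fun s => Num.truncn (p s)) <=
  \sum_(s <- r) \sum_(u <- r) a s * a u * (`|p s - p u| < 1)%R%:R.
Proof.
move=> p0 a0; rewrite /coincidence big_seq [leRHS]big_seq.
apply: ler_sum => s sr; rewrite big_seq [leRHS]big_seq; apply: ler_sum => u ur.
apply: ler_wpM2l; first exact: mulr_ge0.
rewrite ler_nat; case: eqP => // /truncn_eq_dist -> //; exact: p0.
Qed.

(** Points at distance less than 1 lie in equal or adjacent unit bins, so the
    count is at most the sum of three coincidence sums, each controlled by
    Cauchy-Schwarz; conversely points in the same unit bin are near. *)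
Lemma near_count_cauchy (R : realType) (P Q : seq R) :
  (forall p, p \in P -> 0 <= p) -> (forall q, q \in Q -> 0 <= q) ->
  near_count P Q ^+ 2 <= 9%:R * (near_count P P * near_count Q Q).
Proof.
move=> P0 Q0.
pose one := fun _ : R => 1 : R.
pose tr := @Num.truncn R.
have leA : coincidence P one tr P one tr <= near_count P P.
  apply: le_trans (coincidence_truncn_le P0 _) _ => //.
  by rewrite /near_count; under eq_bigr do under eq_bigr do rewrite !mul1r.
have leB : coincidence Q one tr Q one tr <= near_count Q Q.
  apply: le_trans (coincidence_truncn_le Q0 _) _ => //.
  by rewrite /near_count; under eq_bigr do under eq_bigr do rewrite !mul1r.
have shiftE (X : seq R) : coincidence X one (fun x => (tr x).+1) X one (fun x => (tr x).+1)
    = coincidence X one tr X one tr by [].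
have c0 (X : seq R) : 0 <= coincidence X one tr X one tr.
  by apply: sumr_ge0 => s _; apply: sumr_ge0 => u _; rewrite !mul1r.
have := coincidence_cauchy P one tr Q one tr.
have := coincidence_cauchy P one (fun x => (tr x).+1) Q one tr.
have := coincidence_cauchy P one tr Q one (fun x => (tr x).+1).
rewrite !shiftE.
set A := coincidence P one tr P one tr in leA *; set B := coincidence Q one tr Q one tr in leB *.
set x := coincidence P one tr Q one _; set y := coincidence P one _ Q one _.
set w := coincidence P one _ Q one _.
move=> hx hy hw.
have xyw : near_count P Q <= x + y + w.
  rewrite /x /y /w /coincidence -!big_split /= /near_count big_seq [leRHS]big_seq.
  apply: ler_sum => p pP; rewrite -!big_split /= big_seq [leRHS]big_seq.
  apply: ler_sum => q qQ; rewrite !mul1r -!natrD ler_nat.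
  case: ltP => // /(truncn_dist (P0 _ pP) (Q0 _ qQ)); rewrite -/(tr p) -/(tr q).
  lia.
have AB : A * B <= near_count P P * near_count Q Q.
  by apply: ler_pM => //; exact: c0.
apply: (@le_trans _ _ ((x + y + w) ^+ 2)).
  by rewrite ler_pXn2r // nnegrE ?(le_trans _ xyw) // near_count_ge0.
have h1 := sqr_ge0 (x - y); have h2 := sqr_ge0 (y - w).
have h3 := sqr_ge0 (x - w); lra.
Qed.

(** * From a decaying kernel to near pairs of dyadic dilates *)

(** Telescoping: 1 / (1 + (n + 1)^2) <= 2 / (n + 1) - 2 / (n + 2). *)
Lemma sum_inv_sqr_le (R : realType) (n : nat) :
  \sum_(0 <= d < n) (1 + d%:R ^+ 2)^-1 <= 3 :> R.
Proof.
case: n => [|n]; first by rewrite big_geq.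
suff : \sum_(0 <= d < n.+1) (1 + d%:R ^+ 2)^-1 <= 3 - 2 / n.+1%:R :> R.
  by move=> /le_trans -> //; rewrite gerBl divr_ge0.
elim: n => [|n IH]; first by rewrite big_nat1 expr0n addr0 invr1; lra.
rewrite big_nat_recr //=; apply: le_trans (lerD IH (lexx _)) _.
have -> : n.+2%:R = n.+1%:R + 1 :> R by rewrite -addn1 natrD.
have : 0 < n.+1%:R :> R by rewrite ltr0n.
move: (n.+1%:R : R) => x x0.
suff : (1 + x ^+ 2)^-1 <= 2 / x - 2 / (x + 1) by lra.
have -> : 2 / x - 2 / (x + 1) = 2 / (x * (x + 1)).
  by field; rewrite !lt0r_neq0 //; lra.
have x2 : 0 <= x ^+ 2 by exact: sqr_ge0.
have x3 : 0 <= (x - 1) ^+ 2 by exact: sqr_ge0.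
rewrite ler_pdivlMr; last by rewrite mulr_gt0 //; lra.
rewrite ler_pdivrMl; last by lra.
lra.
Qed.

Lemma sum_kernel_le (R : realType) (v B : nat) :
  \sum_(0 <= w < B) (1 + (v%:R - w%:R) ^+ 2)^-1 <= 6 :> R.
Proof.
have k0 w : 0 <= (1 + (v%:R - w%:R) ^+ 2)^-1 :> R.
  by rewrite invr_ge0 addr_ge0 // sqr_ge0.
apply: (@le_trans _ _ (\sum_(0 <= w < v + B) (1 + (v%:R - w%:R) ^+ 2)^-1)).
  rewrite [leRHS](@big_cat_nat _ _ _ B) //= ?leq_addl // lerDl.
  by apply: sumr_ge0.
rewrite (@big_cat_nat _ _ _ v) //= ?leq_addr //.
rewrite -{3}[v]add0n big_addn addKn (_ : 6 = 3 + 3); last by ring.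
apply: lerD.
  rewrite big_nat_rev /= add0n.
  apply: le_trans (sum_inv_sqr_le R v.+1).
  rewrite [leRHS]big_nat_recl // ler_wpDl // ?invr_ge0 ?addr_ge0 ?sqr_ge0 //.
  rewrite big_nat_cond [leRHS]big_nat_cond; apply: ler_sum => w /andP[/andP[_ wv] _].
  by rewrite -natrB ?leq_subr // subKn.
apply: le_trans (sum_inv_sqr_le R B).
apply: ler_sum => w _; rewrite natrD opprD addrCA subrr addr0 sqrrN //.
Qed.

(** Rounding both points down changes their distance by less than 1, which costs
    a bounded factor in a quadratically decaying kernel. *)
Lemma kernel_truncn (R : realType) (p q : R) : 0 <= p -> 0 <= q ->
  (1 + (p - q) ^+ 2)^-1 <=
  4 * (1 + ((Num.truncn p)%:R - (Num.truncn q)%:R) ^+ 2)^-1.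
Proof.
move=> p0 q0.
have /andP[p1 p2] := truncn_itv p0; have /andP[q1 q2] := truncn_itv q0.
move: p1 p2 q1 q2; rewrite -addn1 -(addn1 (Num.truncn q)) !natrD.
move: (Num.truncn p) (Num.truncn q) => m n p1 p2 q1 q2.
have s0 : 0 <= (p - q) ^+ 2 by exact: sqr_ge0.
have s1 : 0 <= (m%:R - n%:R) ^+ 2 :> R by exact: sqr_ge0.
rewrite ler_pdivlMr; last by lra.
rewrite ler_pdivrMl; last by lra.
suff : (m%:R - n%:R) ^+ 2 <= 3 + 4 * (p - q) ^+ 2 by lra.
have [mn|mn] := leqP m n.
  have : (m%:R : R) <= n%:R by rewrite ler_nat.
  have [e|] := eqVneq m n; first by rewrite e subrr; lra.
  have [e ? _|? ?] := eqVneq n m.+1; first by rewrite e -addn1 natrD; lra.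
  have : (m + 2 <= n)%N by lia.
  rewrite -(ler_nat R) natrD => h _.
  have h1 : 0 <= n%:R - m%:R - 1 :> R by lra.
  have h2 : n%:R - m%:R - 1 <= q - p :> R by lra.
  have : (n%:R - m%:R - 1) ^+ 2 <= (q - p) ^+ 2 by rewrite ler_pXn2r // nnegrE; lra.
  nra.
have [e|?] := eqVneq m n.+1; first by rewrite e -addn1 natrD; lra.
have : (n + 2 <= m)%N by lia.
rewrite -(ler_nat R) natrD => h.
have h1 : 0 <= m%:R - n%:R - 1 :> R by lra.
have h2 : m%:R - n%:R - 1 <= p - q :> R by lra.
have : (m%:R - n%:R - 1) ^+ 2 <= (p - q) ^+ 2 by rewrite ler_pXn2r // nnegrE; lra.
nra.
Qed.

(** Schur's test on the bins: the kernel has bounded row sums, so its quadratic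
    form is at most a constant times the sum of squares of the bin weights. *)
Lemma kernel_le_near_count (R : realType) (S : eqType) (r : seq S) (a p : S -> R) :
  (forall s, s \in r -> 0 <= p s) -> (forall s, 0 <= a s) ->
  \sum_(s <- r) \sum_(u <- r) a s * a u * (1 + (p s - p u) ^+ 2)^-1 <=
  24 * \sum_(s <- r) \sum_(u <- r) a s * a u * (`|p s - p u| < 1)%R%:R.
Proof.
move=> p0 a0.
pose f s := Num.truncn (p s).
apply: (@le_trans _ _ (24 * coincidence r a f r a f)); last first.
  by apply: ler_wpM2l => //; exact: coincidence_truncn_le.
have [B fB] := seq_bound r f.
rewrite (coincidence_bins _ _ _ _ fB).
pose G (v : 'I_B) := \sum_(s <- r) a s * (f s == v)%:R.
pose K (v w : nat) : R := (1 + (v%:R - w%:R) ^+ 2)^-1.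
have K0 v w : 0 <= K v w by rewrite invr_ge0 addr_ge0 // sqr_ge0.
apply: (@le_trans _ _ (4 * \sum_(s <- r) \sum_(u <- r) a s * a u * K (f s) (f u))).
  rewrite mulr_sumr big_seq [leRHS]big_seq; apply: ler_sum => s sr.
  rewrite mulr_sumr big_seq [leRHS]big_seq; apply: ler_sum => u ur.
  rewrite mulrCA; apply: ler_wpM2l; first exact: mulr_ge0.
  by apply: kernel_truncn; exact: p0.
have pick s (F : nat -> R) : s \in r ->
    F (f s) = \sum_(v < B) (f s == v)%:R * F v.
  move=> sr; rewrite (bigD1 (Ordinal (fB _ sr))) //= eqxx mul1r big1 ?addr0 //.
  by move=> v; rewrite -val_eqE /= eq_sym => /negbTE ->; rewrite mul0r.
have -> : \sum_(s <- r) \sum_(u <- r) a s * a u * K (f s) (f u) =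
    \sum_(v < B) \sum_(w < B) G v * G w * K v w.
  transitivity (\sum_(s <- r) \sum_(u <- r) \sum_(v < B) \sum_(w < B)
     (a s * (f s == v)%:R) * (a u * (f u == w)%:R) * K v w).
    apply: eq_big_seq => s sr; apply: eq_big_seq => u ur.
    rewrite (pick _ (fun v => K v (f u)) sr) mulr_sumr; apply: eq_bigr => v _.
    rewrite (pick _ (fun w => K v w) ur) !mulr_sumr; apply: eq_bigr => w _.
    by ring.
  under eq_bigr => s _ do rewrite exchange_big /=.
  rewrite exchange_big /=; apply: eq_bigr => v _.
  under eq_bigr => s _ do rewrite exchange_big /=.
  rewrite exchange_big /=; apply: eq_bigr => w _.
  rewrite /G !mulr_suml; apply: eq_bigr => s _.
  by rewrite mulr_sumr mulr_suml.
have G0 v : 0 <= G v by apply: sumr_ge0 => s _; rewrite mulr_ge0.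
rewrite (_ : 24 = 4 * 6); last by ring.
rewrite -mulrA ler_wpM2l //.
apply: (@le_trans _ _ (\sum_(v < B) \sum_(w < B) (G v ^+ 2 + G w ^+ 2) / 2 * K v w)).
  apply: ler_sum => v _; apply: ler_sum => w _; apply: ler_wpM2r => //.
  by have := sqr_ge0 (G v - G w); lra.
have half : \sum_(v < B) \sum_(w < B) G v ^+ 2 * K v w <= 6 * \sum_(v < B) G v ^+ 2.
  rewrite mulr_sumr; apply: ler_sum => v _.
  rewrite -mulr_sumr mulrC; apply: ler_wpM2r; first exact: sqr_ge0.
  by have := sum_kernel_le R v B; rewrite big_mkord.
have half' : \sum_(v < B) \sum_(w < B) G w ^+ 2 * K v w <= 6 * \sum_(v < B) G v ^+ 2.
  rewrite exchange_big; apply: le_trans half.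
  apply: ler_sum => v _; apply: ler_sum => w _.
  by rewrite /K -(opprB w%:R) sqrrN.
have -> : \sum_(v < B) \sum_(w < B) (G v ^+ 2 + G w ^+ 2) / 2 * K v w =
    (\sum_(v < B) \sum_(w < B) G v ^+ 2 * K v w) / 2 +
    (\sum_(v < B) \sum_(w < B) G w ^+ 2 * K v w) / 2.
  rewrite !mulr_suml -big_split /=; apply: eq_bigr => v _.
  by rewrite !mulr_suml -big_split /=; apply: eq_bigr => w _; field.
have -> : \sum_(v < B) (\sum_(s <- r) a s * (f s == v)%:R) *
    (\sum_(u <- r) a u * (f u == v)%:R) = \sum_(v < B) G v ^+ 2.
  by apply: eq_bigr => v _; rewrite expr2.
lra.
Qed.

Definition dilates (R : realType) (js : seq nat) (zs : seq R) : seq R :=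
  [seq j%:R * z | j <- js, z <- zs].

Definition dyadic (i : nat) : seq nat := index_iota (2 ^ i) (2 ^ i.+1).

Lemma near_count_dilates (R : realType) (js ks : seq nat) (zs ws : seq R) :
  near_count (dilates js zs) (dilates ks ws) =
  \sum_(j <- js) \sum_(z <- zs) \sum_(k <- ks) \sum_(w <- ws)
     (`|j%:R * z - k%:R * w| < 1)%R%:R.
Proof.
rewrite /near_count /dilates big_allpairs_dep /=; apply: eq_bigr => j _.
by apply: eq_bigr => z _; rewrite big_allpairs_dep.
Qed.

Lemma sum_dyadic (R : realType) (L : nat) (phi : nat -> R) :
  \sum_(1 <= j < 2 ^ L) phi j = \sum_(i < L) \sum_(j <- dyadic i) phi j.
Proof.
elim: L => [|L IH]; first by rewrite big_geq // big_ord0.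
rewrite big_ord_recr /= -IH -big_cat_nat //=; first by rewrite expn_gt0.
by rewrite leq_exp2l.
Qed.

Lemma mean_of_sqr (R : realType) (y A B : R) :
  0 <= y -> 0 <= A -> 0 <= B -> y ^+ 2 <= 9 * (A * B) -> y <= 3 / 2 * (A + B).
Proof.
move=> y0 A0 B0 h; rewrite -(@ler_pXn2r _ 2) // ?nnegrE //; last by lra.
by apply: le_trans h _; have := sqr_ge0 (A - B); lra.
Qed.

(** Cauchy-Schwarz between two blocks ([near_count_cauchy]) and the inequality
    between arithmetic and geometric means remove the terms with j and k in
    different dyadic blocks, at the cost of the number L of blocks. *)
Lemma dyadic_blocks (R : realType) (L : nat) (zs : seq R) (c beta : nat -> R) :
  (forall z, z \in zs -> 0 <= z) ->
  (forall i, 0 <= beta i) ->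
  (forall j, 0 <= c j) ->
  (forall i j, (i < L)%N -> j \in dyadic i -> c j <= beta i) ->
  \sum_(1 <= j < 2 ^ L) \sum_(z <- zs) \sum_(1 <= k < 2 ^ L) \sum_(w <- zs)
     c j * c k * (`|j%:R * z - k%:R * w| < 1)%R%:R <=
  3 * L%:R * \sum_(i < L) beta i ^+ 2 *
     near_count (dilates (dyadic i) zs) (dilates (dyadic i) zs).
Proof.
move=> z0 b0 c0 cb.
pose P i := dilates (dyadic i) zs.
have P0 i p : p \in P i -> 0 <= p.
  by move=> /allpairsP[[j z] /= [_ /z0 h ->]]; rewrite mulr_ge0.
under eq_bigr => j _ do under eq_bigr => z _ do rewrite sum_dyadic.
under eq_bigr => j _ do rewrite exchange_big /=.
rewrite sum_dyadic.
under eq_bigr => i _ do rewrite exchange_big /=.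
apply: (@le_trans _ _ (\sum_(i < L) \sum_(k < L) 3 / 2 *
   (beta i ^+ 2 * near_count (P i) (P i) + beta k ^+ 2 * near_count (P k) (P k)))); last first.
  under eq_bigr => i _ do rewrite -mulr_sumr big_split /= sumr_const card_ord.
  rewrite -mulr_sumr big_split /= sumr_const card_ord sumrMnl -/P.
  rewrite -mulr_natr; lra.
apply: ler_sum => i _; apply: ler_sum => k _.
apply: (@le_trans _ _ (beta i * beta k * near_count (P i) (P k))).
  rewrite near_count_dilates mulr_sumr big_seq [leRHS]big_seq; apply: ler_sum => j ji.
  rewrite mulr_sumr; apply: ler_sum => z _.
  rewrite mulr_sumr big_seq [leRHS]big_seq; apply: ler_sum => l lk.
  rewrite mulr_sumr; apply: ler_sum => w _.
  by apply: ler_wpM2r => //; apply: ler_pM => //; apply: cb.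
apply: mean_of_sqr.
- by rewrite !mulr_ge0 // near_count_ge0.
- by rewrite !mulr_ge0 // near_count_ge0.
- by rewrite !mulr_ge0 // near_count_ge0.
rewrite !exprMn.
rewrite [leRHS](_ : _ = beta i ^+ 2 * beta k ^+ 2 *
  (9 * (near_count (P i) (P i) * near_count (P k) (P k)))); last by ring.
apply: ler_wpM2l; first by rewrite mulr_ge0 // sqr_ge0.
by apply: near_count_cauchy; exact: P0.
Qed.

(** * Lattice points in a strip *)

(** The lattice points with positive coordinates below M that make
    m z1 - n z2 small: a neighbourhood of the line of slope z1 / z2. *)
Definition strip (R : realType) (M : nat) (w z1 z2 : R) : {set 'I_M * 'I_M} :=
  [set p : 'I_M * 'I_M | [&& (0 < p.1)%N, (0 < p.2)%N
             & `|(p.1 : nat)%:R * z1 - (p.2 : nat)%:R * z2| < w]].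

(** Two lattice points with the same determinant against a primitive vector
    (a, b) differ by a multiple of it. *)
Lemma lattice_line (a b m n m' n' : nat) : coprime a b -> (0 < b)%N ->
  (a * n + b * m' = a * n' + b * m)%N -> (n <= n')%N ->
  exists k, n' = (n + k * b)%N /\ m' = (m + k * a)%N.
Proof.
move=> ab b0 e nn'.
have : (b %| a * (n' - n))%N.
  apply/dvdnP; exists (m' - m)%N; rewrite mulnBr mulnBl; lia.
rewrite Gauss_dvdr 1?coprime_sym // => /dvdnP[k kE].
exists k; split; first by lia.
have n'E : n' = (n + k * b)%N by lia.
move: e; rewrite n'E mulnDr -addnA => /addnI.
move=> e; apply/eqP; rewrite -(eqn_pmul2l b0); apply/eqP; nia.
Qed.

(** The determinant against (a, b) tells the lines parallel to (a, b) apart, and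
    takes at most 2 K + 1 values.  Within a line, points differ by k (a, b) with
    k at most L, so the quotient of the second coordinate by b, taken modulo
    L + 1, separates them. *)
Lemma strip_lines (R : realType) (M a b K L : nat) (w z1 z2 : R) :
  coprime a b -> (0 < b)%N ->
  (forall k, (k * a < M)%N -> (k * b < M)%N ->
     k%:R * `|a%:R * z1 - b%:R * z2| < 2 * w -> (k <= L)%N) ->
  (forall p, p \in strip M w z1 z2 ->
     (a * p.2 <= b * p.1 + K)%N && (b * p.1 <= a * p.2 + K)%N) ->
  (#|strip M w z1 z2| <= (2 * K).+1 * L.+1)%N.
Proof.
move=> ab b0 LP KP.
pose phi (p : 'I_M * 'I_M) : 'I_(2 * K).+1 * 'I_L.+1 :=
  (inord (a * p.2 + K - b * p.1), inord ((p.2 %/ b) %% L.+1)).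
have bnd x y : (x <= y + K -> y <= x + K -> x + K - y < (2 * K).+1)%N by lia.
have cross x y x' y' : (y <= x + K -> y' <= x' + K ->
    x + K - y = x' + K - y' -> x + y' = x' + y)%N by lia.
have phi_inj : {in strip M w z1 z2 &, injective phi}.
  have half p q : p \in strip M w z1 z2 -> q \in strip M w z1 z2 ->
      (p.2 <= q.2)%N -> phi p = phi q -> p = q.
    move=> pS qS pq [] /(congr1 val) /= e1 /(congr1 val) /= e2.
    have /andP[p1 p2] := KP _ pS; have /andP[q1 q2] := KP _ qS.
    move: e1; rewrite !inordK ?bnd // => e1.
    move: e2; rewrite !inordK ?ltn_pmod // => e2.
    have e : (a * p.2 + b * q.1 = a * q.2 + b * p.1)%N by exact: cross.
    have [k [k2 k1]] := lattice_line ab b0 e pq.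
    have kL : (k <= L)%N.
      move: pS qS; rewrite !inE => /and3P[_ _ hp] /and3P[_ _ hq].
      apply: LP.
      - by apply: leq_ltn_trans (ltn_ord q.1); rewrite k1 leq_addl.
      - by apply: leq_ltn_trans (ltn_ord q.2); rewrite k2 leq_addl.
      rewrite -{1}[k%:R]ger0_norm // -normrM.
      rewrite (_ : k%:R * _ = (q.1%:R * z1 - q.2%:R * z2) - (p.1%:R * z1 - p.2%:R * z2)).
        by apply: le_lt_trans (ler_normB _ _) _; lra.
      by rewrite k1 k2 !natrD !natrM; ring.
    move: e2; rewrite k2 addnC divnMDl // -[in LHS](add0n (p.2 %/ b))%N.
    move=> /eqP; rewrite eqn_modDr mod0n (modn_small (m := k)) // => /eqP k0.
    case: p q {pS qS pq p1 p2 q1 q2 e1 e} k1 k2 => p1 p2 [q1 q2] /=.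
    by rewrite -k0 !mul0n !addn0 => /val_inj -> /val_inj ->.
  move=> p q pS qS pq; have [|/ltnW] := leqP p.2 q.2 => h; first exact: half.
  by apply/esym/half.
rewrite -(card_in_imset phi_inj); apply: leq_trans (max_card _) _.
by rewrite card_prod !card_ord.
Qed.

(** Take (a, b) to be the primitive part of some point of the strip and L the
    largest k for which k (a, b) is still small.  The determinants are bounded by
    H = (M |tau| + 4 J b) / z1 with tau = a z1 - b z2, and both L |tau| and L b
    are controlled, so the number (2 H + 1) (L + 1) is at most L + 1 plus a
    multiple of the area J^3 / z1.  The first L / (16 J) multiples of (a, b) lie
    in the smaller strip, which bounds L. *)
Lemma strip_count (R : realType) (J : nat) (z1 z2 : R) :
  (0 < J)%N -> 0 < z1 ->
  #|strip (4 * J ^ 2) (4 * J%:R) z1 z2|%:R <=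
  16 * J%:R * (#|strip (2 * J) 1 z1 z2|%:R + 1) + 160 * J%:R ^+ 3 / z1 :> R.
Proof.
move=> J0 z0; set M := (4 * J ^ 2)%N; set S := strip M _ _ _.
have JR : 0 < J%:R :> R by rewrite ltr0n.
have [->|[p0]] := set_0Vmem S.
  rewrite cards0 addr_ge0 // ?mulr_ge0 ?addr_ge0 ?invr_ge0 ?exprn_ge0 ?ltW //.
rewrite inE => /and3P[m0 n0 t0].
pose g := gcdn p0.1 p0.2.
have g0 : (0 < g)%N by rewrite gcdn_gt0 m0.
pose a := (p0.1 %/ g)%N; pose b := (p0.2 %/ g)%N.
have aE : (p0.1 = a * g :> nat)%N by rewrite divnK // dvdn_gcdl.
have bE : (p0.2 = b * g :> nat)%N by rewrite divnK // dvdn_gcdr.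
have a0 : (0 < a)%N by rewrite aE in m0; move: m0; rewrite muln_gt0 => /andP[].
have b0 : (0 < b)%N by rewrite bE in n0; move: n0; rewrite muln_gt0 => /andP[].
have ab : coprime a b.
  by rewrite /coprime -(eqn_pmul2r g0) muln_gcdl -aE -bE mul1n.
pose tau := a%:R * z1 - b%:R * z2.
have tau4 : `|tau| < 4 * J%:R.
  apply: le_lt_trans t0; rewrite aE bE !natrM.
  rewrite (_ : _ - _ = g%:R * tau); last by rewrite /tau; ring.
  by rewrite normrM ger0_norm // ler_peMl // ler1n.
have bM : (b <= M)%N.
  by apply: leq_trans (ltnW (ltn_ord p0.2)); rewrite bE leq_pmulr.
pose Q k := [&& (k * a < M)%N, (k * b < M)%N & k%:R * `|tau| < 8 * J%:R].
have M0 : (0 < M)%N by rewrite muln_gt0 expn_gt0 J0.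
have Q0 : exists k, Q k.
  by exists 0%N; rewrite /Q !mul0n M0 mul0r mulr_gt0.
have QM k : Q k -> (k <= M)%N.
  by case/and3P=> h _ _; apply: leq_trans (ltnW h); exact: leq_pmulr.
case: (ex_maxnP Q0 QM) => L /and3P[La Lb Lt] Lmax.
have MR : M%:R = 4 * J%:R ^+ 2 :> R by rewrite natrM natrX.
have bMR : b%:R <= 4 * J%:R ^+ 2 :> R by rewrite -MR ler_nat.
(* a multiple k (a, b) with 16 J k <= L has coordinates below J / 4 and keeps
   k |tau| below 1 / 2, as it inherits them from L (a, b) *)
pose k0 := (L %/ (16 * J))%N.
have k0L : (k0 * (16 * J) <= L)%N by exact: leq_trunc_div.
have k0c : (k0 <= #|strip (2 * J) 1 z1 z2|)%N.
  have small c k : (L * c < M)%N -> (k < k0)%N -> (k.+1 * c < 2 * J)%N.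
    move=> Lc kk0; have : (k.+1 * c * (16 * J) < M)%N.
      apply: leq_ltn_trans Lc; rewrite mulnAC leq_mul2r; apply/orP; right.
      by apply: leq_trans k0L; rewrite leq_mul2r kk0 orbT.
    rewrite /M; nia.
  have psiP (k : 'I_k0) : (k.+1 * a < 2 * J)%N && (k.+1 * b < 2 * J)%N.
    by rewrite !small.
  pose psi (k : 'I_k0) : 'I_(2 * J) * 'I_(2 * J) :=
    (Ordinal (proj1 (andP (psiP k))), Ordinal (proj2 (andP (psiP k)))).
  have psi_inj : injective psi.
    move=> k l /(congr1 (fun p => val p.1)) /= /eqP.
    by rewrite eqn_pmul2r // eqSS => /eqP/val_inj.
  rewrite -[X in (X <= _)%N]card_ord -(card_imset _ psi_inj); apply: subset_leq_card.
  apply/fintype.subsetP => _ /imsetP[k _ ->]; rewrite inE /= !muln_gt0 /= a0 b0 /=.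
  rewrite !natrM -!mulrA -mulrBr -/tau normrM ger0_norm //.
  have : (k.+1 * (16 * J) <= L)%N.
    by apply: leq_trans k0L; rewrite leq_mul2r (ltn_ord k) orbT.
  rewrite -(ler_nat R) !natrM => h.
  rewrite -(@ltr_pM2r _ (16 * J%:R)) ?mulr_gt0 // mul1r mulrAC.
  apply: le_lt_trans (ler_wpM2r (normr_ge0 _) h) _.
  by apply: lt_trans Lt _; rewrite ltr_pM2r //; lra.
have L16 : L%:R + 1 <= 16 * J%:R * (#|strip (2 * J) 1 z1 z2|%:R + 1) :> R.
  have : (L.+1 <= 16 * J * (#|strip (2 * J) 1 z1 z2| + 1))%N.
    have /leq_trans -> // : (L < k0.+1 * (16 * J))%N by rewrite ltn_ceil // muln_gt0.
    by rewrite mulnC leq_mul2l addn1 ltnS k0c orbT.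
  by rewrite -(ler_nat R) -addn1 !natrD !natrM natrD.
pose H := (M%:R * `|tau| + 4 * J%:R * b%:R) / z1.
have H0 : 0 <= H by rewrite divr_ge0 ?addr_ge0 ?mulr_ge0 // ltW.
have /andP[KH HK] := truncn_itv H0; set K := Num.truncn H in KH HK.
have lines_le : (#|S| <= (2 * K).+1 * L.+1)%N.
  apply: (@strip_lines _ _ a b) => //.
    move=> k ka kb kt; apply: Lmax; rewrite /Q ka kb /=.
    by apply: lt_le_trans kt _; rewrite mulrA -natrM.
  move=> p; rewrite inE => /and3P[_ _]; set t := _ - _ => tJ.
  have detE : (a%:R * p.2%:R - b%:R * p.1%:R) * z1 = p.2%:R * tau - b%:R * t.
    by rewrite /tau /t; ring.
  have det_le : `|a%:R * p.2%:R - b%:R * p.1%:R| <= H.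
    rewrite ler_pdivlMr // -[X in _ * X](gtr0_norm z0) -normrM detE.
    apply: le_trans (ler_normB _ _) _; rewrite !normrM !normr_nat.
    apply: lerD; first by rewrite ler_wpM2r // ler_nat ltnW.
    by rewrite mulrC ler_wpM2r // ltW.
  have cmp x y : `|x%:R - y%:R| <= H -> (x <= y + K)%N.
    move=> xy; rewrite leqNgt; apply/negP; rewrite -addnS -(ler_nat R) natrD => h.
    have := ler_norm (x%:R - y%:R : R); lra.
  by apply/andP; split; apply: cmp; rewrite !natrM // distrC.
have : #|S|%:R <= (2 * K%:R + 1) * (L%:R + 1) :> R.
  by move: lines_le; rewrite -(ler_nat R) natrM -[(2 * K).+1%:R]natr1 -[L.+1%:R]natr1 natrM.
have HL : H * L%:R <= 48 * J%:R ^+ 3 / z1.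
  rewrite /H mulrAC ler_pM2r ?invr_gt0 // mulrDl.
  have : M%:R * `|tau| * L%:R <= 4 * J%:R ^+ 2 * (8 * J%:R).
    by rewrite -mulrA MR ler_wpM2l ?mulr_ge0 ?sqr_ge0 // mulrC ltW.
  have : 4 * J%:R * b%:R * L%:R <= 4 * J%:R * (4 * J%:R ^+ 2) :> R.
    rewrite -mulrA ler_wpM2l ?mulr_ge0 //.
    by rewrite -MR -natrM ler_nat mulnC ltnW.
  lra.
have HJ : H <= 32 * J%:R ^+ 3 / z1.
  rewrite /H ler_pM2r ?invr_gt0 //.
  have : M%:R * `|tau| <= 4 * J%:R ^+ 2 * (4 * J%:R).
    by rewrite MR ler_wpM2l ?mulr_ge0 ?sqr_ge0 // ltW.
  have : 4 * J%:R * b%:R <= 4 * J%:R * (4 * J%:R ^+ 2) :> R by rewrite ler_wpM2l ?mulr_ge0.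
  lra.
have KL : K%:R * L%:R <= H * L%:R by rewrite ler_wpM2r.
by move=> h; apply: le_trans h _; lra.
Qed.

(** * Near pairs in one dyadic block *)

Lemma strip_sum (R : realType) (M : nat) (w z1 z2 : R) :
  \sum_(1 <= m < M) \sum_(1 <= n < M) (`|m%:R * z1 - n%:R * z2| < w)%R%:R =
  #|strip M w z1 z2|%:R :> R.
Proof.
rewrite -sum1_card natr_sum [RHS]big_mkcond /=.
transitivity (\sum_(m < M) \sum_(n < M)
  (if (m, n) \in strip M w z1 z2 then 1 else 0 : R)); last first.
  by rewrite pair_bigA /=; apply: eq_bigr => -[m n].
rewrite big_geq_mkord /= big_mkcond /=; apply: eq_bigr => m _.
rewrite big_geq_mkord /= big_mkcond /=; case: ifP => m0; last first.
  by rewrite big1 // => n _; rewrite inE /= lt0n -lt0n m0.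
apply: eq_bigr => n _; rewrite inE /= m0 /=.
by case: (0 < n)%N => //=; case: ifP.
Qed.

Lemma strip_sym (R : realType) (M : nat) (w z1 z2 : R) :
  #|strip M w z1 z2|%:R = #|strip M w z2 z1|%:R :> R.
Proof.
rewrite -!strip_sum exchange_big /=; apply: eq_bigr => m _; apply: eq_bigr => n _.
by rewrite distrC.
Qed.

Lemma strip_count_min (R : realType) (J : nat) (z1 z2 : R) :
  (0 < J)%N -> 0 < z1 -> 0 < z2 ->
  #|strip (4 * J ^ 2) (4 * J%:R) z1 z2|%:R <=
  16 * J%:R * (#|strip (2 * J) 1 z1 z2|%:R + 1)
  + 160 * J%:R ^+ 3 * (Num.max z1 z2)^-1 :> R.
Proof.
move=> J0 z10 z20; case: (leP z1 z2) => _; last exact: strip_count.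
by rewrite strip_sym (strip_sym _ 1); exact: strip_count.
Qed.

(** A given m has at most as many representations j k as it has divisors. *)
Lemma sum_divisor_pairs (R : realType) (i D : nat) (phi : nat -> R) :
  (forall m, 0 <= phi m) ->
  (forall m, (0 < m < 4 * (2 ^ i) ^ 2)%N -> (size (divisors m) <= D)%N) ->
  \sum_(j <- dyadic i) \sum_(k <- dyadic i) phi (j * k)%N <=
  D%:R * \sum_(1 <= m < 4 * (2 ^ i) ^ 2) phi m.
Proof.
move=> phi0 HD; set M := (4 * _)%N in HD *.
have jkM j k : j \in dyadic i -> k \in dyadic i -> (0 < j * k < M)%N.
  rewrite !mem_index_iota => /andP[j1 j2] /andP[k1 k2].
  have e0 : (0 < 2 ^ i)%N by rewrite expn_gt0.
  move: j2 k2; rewrite expnS /M; nia.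
have -> : \sum_(j <- dyadic i) \sum_(k <- dyadic i) phi (j * k)%N =
    \sum_(1 <= m < M) phi m * (\sum_(j <- dyadic i) \sum_(k <- dyadic i) (j * k == m)%N)%:R.
  under [RHS]eq_bigr => m _ do rewrite natr_sum mulr_sumr.
  rewrite [RHS]exchange_big /=; apply: eq_big_seq => j ji.
  under [RHS]eq_bigr => m _ do rewrite natr_sum mulr_sumr.
  rewrite [RHS]exchange_big /=; apply: eq_big_seq => k ki.
  rewrite (bigD1_seq (j * k)%N) ?iota_uniq ?mem_index_iota ?jkM //=.
  rewrite eqxx mulr1 big1 ?addr0 // => m; rewrite eq_sym => /negbTE ->.
  by rewrite mulr0.
rewrite mulr_sumr big_seq [leRHS]big_seq; apply: ler_sum => m.
rewrite mem_index_iota => mM; rewrite mulrC ler_wpM2r // ler_nat.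
apply: leq_trans (HD _ mM).
have m0 : (0 < m)%N by case/andP: mM.
apply: (@leq_trans (size [seq j <- dyadic i | j %| m]%N)); last first.
  apply: uniq_leq_size; first by rewrite filter_uniq // iota_uniq.
  by move=> j; rewrite mem_filter -dvdn_divisors // => /andP[].
rewrite size_filter -sum1_count [leqRHS]big_mkcond /= big_seq [leqRHS]big_seq.
apply: leq_sum => j; rewrite mem_index_iota => /andP[j1 _].
have j0 : (0 < j)%N by apply: leq_trans j1; rewrite expn_gt0.
case: ifP => [jm|jm]; last first.
  rewrite big1 // => k _; case: eqP => // e.
  by rewrite -e dvdn_mulr in jm.
have -> : (\sum_(k <- dyadic i) (j * k == m) = count_mem (m %/ j)%N (dyadic i))%N.
  rewrite -sum1_count [RHS]big_mkcond /=; apply: eq_bigr => k _.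
  by rewrite eqn_div // mulnC; case: eqP.
by rewrite count_uniq_mem ?iota_uniq // leq_b1.
Qed.

(** The two products are j k' and j' k, as obtained by clearing denominators in
    a relation between z j / k and w j' / k'. *)
Lemma sum_divisor_quads (R : realType) (i D : nat) (phi : nat -> nat -> R) :
  (forall m n, 0 <= phi m n) ->
  (forall m, (0 < m < 4 * (2 ^ i) ^ 2)%N -> (size (divisors m) <= D)%N) ->
  \sum_(j <- dyadic i) \sum_(k <- dyadic i)
    \sum_(j' <- dyadic i) \sum_(k' <- dyadic i) phi (j * k')%N (j' * k)%N <=
  D%:R ^+ 2 * \sum_(1 <= m < 4 * (2 ^ i) ^ 2) \sum_(1 <= n < 4 * (2 ^ i) ^ 2) phi m n.
Proof.
move=> phi0 HD.
pose psi m := \sum_(j' <- dyadic i) \sum_(k <- dyadic i) phi m (j' * k)%N.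
have psi0 m : 0 <= psi m by do 2!apply: sumr_ge0 => ? _.
have -> : \sum_(j <- dyadic i) \sum_(k <- dyadic i)
    \sum_(j' <- dyadic i) \sum_(k' <- dyadic i) phi (j * k')%N (j' * k)%N =
    \sum_(j <- dyadic i) \sum_(k' <- dyadic i) psi (j * k')%N.
  apply: eq_bigr => j _; rewrite exchange_big /=.
  under eq_bigr => j' _ do rewrite exchange_big /=.
  by rewrite exchange_big.
apply: le_trans (sum_divisor_pairs psi0 HD) _.
rewrite expr2 -mulrA ler_wpM2l // mulr_sumr.
by apply: ler_sum => m _; exact: sum_divisor_pairs.
Qed.

(** With j, k in [J, 2 J), the relation |j z - k w| < 1 implies that the points
    J j z / k and J w are near.  Cauchy-Schwarz separates the second family,
    whose near pairs are near pairs of zs, from the first, whose near pairs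
    solve |(j k') z - (j' k) w| < 4 J after clearing denominators. *)
Lemma block_count (R : realType) (i D : nat) (zs : seq R) :
  (forall z, z \in zs -> 0 < z) ->
  (forall m, (0 < m < 4 * (2 ^ i) ^ 2)%N -> (size (divisors m) <= D)%N) ->
  near_count (dilates (dyadic i) zs) (dilates (dyadic i) zs) ^+ 2 <=
  9 * (near_count zs zs * (D%:R ^+ 2 * \sum_(z <- zs) \sum_(w <- zs)
       #|strip (4 * (2 ^ i) ^ 2) (4 * (2 ^ i)%:R) z w|%:R)).
Proof.
move=> z0 HD; set J := (2 ^ i)%N.
have J0 : (0 < J)%N by rewrite expn_gt0.
have JR : 1 <= J%:R :> R by rewrite ler1n.
have jJ j : j \in dyadic i -> J%:R <= j%:R :> R /\ j%:R < 2 * J%:R :> R.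
  rewrite mem_index_iota -natrM expnS ler_nat ltr_nat => /andP[] //.
pose A := [seq J%:R * w | w <- zs].
pose Bq := [seq J%:R / k%:R * p | p <- dilates (dyadic i) zs, k <- dyadic i].
have A0 p : p \in A -> 0 <= p.
  by move=> /mapP[w /z0 w0 ->]; rewrite mulr_ge0 // ltW.
have B0 p : p \in Bq -> 0 <= p.
  move=> /allpairsP[[q k] /= [/allpairsP[[j w] /= [_ /z0 w0 ->]] _ ->]].
  by rewrite !mulr_ge0 ?invr_ge0 // ltW.
have sumB (F : R -> R) : \sum_(b <- Bq) F b = \sum_(j <- dyadic i)
    \sum_(z <- zs) \sum_(k <- dyadic i) F (J%:R / k%:R * (j%:R * z)).
  rewrite /Bq big_allpairs_dep /= /dilates big_allpairs_dep /=.
  by [].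
have leX : near_count (dilates (dyadic i) zs) (dilates (dyadic i) zs) <= near_count Bq A.
  rewrite near_count_dilates /near_count sumB; apply: ler_sum => j _; apply: ler_sum => z _.
  rewrite big_seq [leRHS]big_seq; apply: ler_sum => k /jJ[k1 _].
  rewrite /A big_map; apply: ler_sum => w _.
  rewrite ler_nat; case: ltP => //= h; rewrite lt0b.
  have k0 : 0 < k%:R :> R by lra.
  rewrite (_ : _ - _ = J%:R / k%:R * (j%:R * z - k%:R * w)); last first.
    by field; rewrite gt_eqF.
  rewrite normrM ger0_norm ?divr_ge0 // ?ltW // mulrAC ltr_pdivrMr // mul1r.
  by apply: lt_le_trans k1; rewrite gtr_pMr // (lt_le_trans _ JR).
have leA : near_count A A <= near_count zs zs.
  rewrite /near_count /A big_map; apply: ler_sum => z _; rewrite big_map.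
  apply: ler_sum => w _; rewrite ler_nat -mulrBr normrM normr_nat.
  case: ltP => //= h; case: ltP => //= h'.
  by have := ler_peMl (normr_ge0 (z - w)) JR; lra.
have leB : near_count Bq Bq <= D%:R ^+ 2 * \sum_(z <- zs) \sum_(w <- zs)
     #|strip (4 * J ^ 2) (4 * J%:R) z w|%:R.
  apply: (@le_trans _ _ (\sum_(z <- zs) \sum_(w <- zs) \sum_(j <- dyadic i)
     \sum_(k <- dyadic i) \sum_(j' <- dyadic i) \sum_(k' <- dyadic i)
       (`|(j * k')%:R * z - (j' * k)%:R * w| < 4 * J%:R)%R%:R)); last first.
    rewrite mulr_sumr; apply: ler_sum => z _; rewrite mulr_sumr.
    apply: ler_sum => w _; rewrite -strip_sum.
    exact: (@sum_divisor_quads R i D (fun m n => (`|m%:R * z - n%:R * w| < 4 * J%:R)%R%:R)).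
  rewrite /near_count sumB exchange_big /=; apply: ler_sum => z _.
  rewrite [leRHS]exchange_big /=; apply: ler_sum => j _.
  rewrite [leRHS]exchange_big /=.
  rewrite big_seq [leRHS]big_seq; apply: ler_sum => k /jJ[k1 k2].
  rewrite [leRHS]exchange_big /= sumB; apply: ler_sum => j' _; apply: ler_sum => w _.
  rewrite big_seq [leRHS]big_seq; apply: ler_sum => k' /jJ[k1' k2'].
  rewrite ler_nat; case: ltP => //= h; rewrite lt0b.
  have k0 : 0 < k%:R :> R by lra.
  have k0' : 0 < k'%:R :> R by lra.
  rewrite !natrM (_ : _ - _ = k%:R * k'%:R / J%:R *
     (J%:R / k%:R * (j%:R * z) - J%:R / k'%:R * (j'%:R * w))); last first.
    by field; rewrite !gt_eqF //; lra.
  rewrite normrM ger0_norm ?divr_ge0 ?mulr_ge0 //.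
  set t := `|_| in h *.
  have kkJ : k%:R * k'%:R / J%:R <= 4 * J%:R :> R.
    rewrite ler_pdivrMr; last by lra.
    rewrite (_ : 4 * _ * _ = (2 * J%:R) * (2 * J%:R)); last by ring.
    by apply: ler_pM => //; exact: ltW.
  have kk0 : 0 < k%:R * k'%:R / J%:R :> R by rewrite divr_gt0 ?mulr_gt0 //; lra.
  have t0 : 0 <= t by exact: normr_ge0.
  apply: le_lt_trans (ler_wpM2r t0 kkJ) _.
  by rewrite gtr_pMr // mulr_gt0 // (lt_le_trans _ JR).
apply: (@le_trans _ _ (near_count Bq A ^+ 2)).
  by rewrite ler_pXn2r // ?nnegrE ?near_count_ge0.
apply: le_trans (near_count_cauchy B0 A0) _.
rewrite ler_wpM2l // mulrC; apply: ler_pM => //; exact: near_count_ge0.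
Qed.

(** * The self-improving inequality *)

Lemma sum_const_seq (R : realType) (T : Type) (s : seq T) (a : R) :
  \sum_(x <- s) a = (size s)%:R * a.
Proof.
by rewrite big_const_seq count_predT iter_addr addr0 mulr_natl.
Qed.

(** At most B + 1 unit bins meet [0, B], so Cauchy-Schwarz bounds the square of
    the number of points there by (B + 1) times the near pairs. *)
Lemma count_small (R : realType) (B : nat) (zs : seq R) :
  (forall z, z \in zs -> 0 < z) ->
  \sum_(z <- zs) \sum_(w <- zs) (Num.max z w <= B%:R)%R%:R <=
  (B%:R + 1) * near_count zs zs.
Proof.
move=> z0.
pose a (z : R) : R := (z <= B%:R)%R%:R.
have a0 z : 0 <= a z by rewrite ler0n.
have -> : \sum_(z <- zs) \sum_(w <- zs) (Num.max z w <= B%:R)%R%:R =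
    (\sum_(z <- zs) a z) ^+ 2.
  rewrite expr2 mulr_suml; apply: eq_bigr => z _; rewrite mulr_sumr.
  by apply: eq_bigr => w _; rewrite /a -natrM mulnb ge_max.
have -> : \sum_(z <- zs) a z = coincidence zs a (@Num.truncn R) (index_iota 0 B.+1) (fun=> 1) id.
  rewrite /coincidence; apply: eq_big_seq => z zin.
  have /andP[t1 _] := truncn_itv (ltW (z0 _ zin)).
  rewrite /a; case: leP => [zB|_]; last first.
    by rewrite big1 // => u _; rewrite !mul0r.
  have tB : (Num.truncn z < B.+1)%N by rewrite ltnS -(ler_nat R) (le_trans t1).
  rewrite (bigD1_seq (Num.truncn z)) ?iota_uniq ?mem_index_iota //=.
  rewrite eqxx !mul1r big1 ?addr0 // => u; rewrite eq_sym => /negbTE ->.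
  by rewrite mulr0.
apply: le_trans (coincidence_cauchy _ _ _ _ _ _) _.
rewrite mulrC; apply: ler_pM.
- by do 2!apply: sumr_ge0 => ? _; rewrite !mulr_ge0.
- by do 2!apply: sumr_ge0 => ? _; rewrite !mulr_ge0.
- rewrite natr1 -[X in _ <= X%:R](size_iota 0) -sum1_size natr_sum /coincidence.
  rewrite /index_iota subn0 big_seq [leRHS]big_seq; apply: ler_sum => u uB.
  rewrite (bigD1_seq u) ?iota_uniq //= eqxx !mul1r big1 ?addr0 //.
  by move=> v; rewrite eq_sym => /negbTE ->; rewrite mulr0.
apply: le_trans (coincidence_truncn_le _ _) _ => //; first by move=> z /z0/ltW.
apply: ler_sum => z _; apply: ler_sum => w _; rewrite ler_piMl //.
by rewrite /a -natrM mulnb lern1 leq_b1.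
Qed.

(** The term of the least dyadic scale above M alone suffices; the constant
    1 / c takes care of M below 1. *)
Lemma inv_le_dyadic_sum (R : realType) (c M : R) (r : nat) :
  0 < c -> c <= M -> M <= 2 ^+ r ->
  M^-1 <= (2 + c^-1) * \sum_(s < r.+1) (2 ^+ s)^-1 * (M <= 2 ^+ s)%R%:R.
Proof.
move=> c0 cM; have M0 : 0 < M by exact: lt_le_trans cM.
have c20 : 0 < c^-1 by rewrite invr_gt0.
elim: r => [|r IH] Mr.
  rewrite big_ord_recr big_ord0 /= add0r Mr expr0 invr1 !mulr1.
  apply: (@le_trans _ _ c^-1); last by lra.
  by rewrite lef_pV2 ?posrE.
rewrite big_ord_recr /= mulrDr.
have tail0 : 0 <= (2 + c^-1) * ((2 ^+ r.+1)^-1 * (M <= 2 ^+ r.+1)%R%:R).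
  by rewrite !mulr_ge0 ?addr_ge0 ?invr_ge0 ?exprn_ge0 // ltW.
case: (leP M (2 ^+ r)) => [/IH h|h]; first by lra.
apply: ler_wpDl.
  rewrite mulr_ge0 ?addr_ge0 ?(ltW c20) //; apply: sumr_ge0 => s _.
  by rewrite mulr_ge0 ?invr_ge0 ?exprn_ge0.
rewrite Mr mulr1 exprS.
have p0 : 0 < 2 ^+ r :> R by rewrite exprn_gt0.
apply: (@le_trans _ _ (2 ^+ r)^-1); first by rewrite lef_pV2 ?posrE // ltW.
rewrite invfM mulrA ler_peMl ?invr_ge0 ?ltW //.
by lra.
Qed.

(** Cutting 1 / max (z, w) dyadically reduces it to [count_small] at each of the
    r + 1 scales; the pairs beyond the last scale contribute the second term. *)
Lemma sum_inv_max (R : realType) (c : R) (r : nat) (zs : seq R) :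
  0 < c -> (forall z, z \in zs -> c <= z) ->
  \sum_(z <- zs) \sum_(w <- zs) (Num.max z w)^-1 <=
  (2 + c^-1) * (2 * r.+1%:R) * near_count zs zs + (size zs)%:R ^+ 2 / 2 ^+ r.
Proof.
move=> c0 zc.
have z0 z : z \in zs -> 0 < z by move/zc; exact: lt_le_trans.
have c20 : 0 < c^-1 by rewrite invr_gt0.
have e0 s : 0 < (2 ^+ s)^-1 :> R by rewrite invr_gt0 exprn_gt0.
have sum0 M : 0 <= \sum_(s < r.+1) (2 ^+ s)^-1 * (M <= 2 ^+ s)%R%:R :> R.
  by apply: sumr_ge0 => s _; rewrite mulr_ge0 // ltW.
apply: (@le_trans _ _ (\sum_(z <- zs) \sum_(w <- zs) ((2 + c^-1) *
   (\sum_(s < r.+1) (2 ^+ s)^-1 * (Num.max z w <= 2 ^+ s)%R%:R) + (2 ^+ r)^-1))).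
  rewrite big_seq [leRHS]big_seq; apply: ler_sum => z zin; apply: ler_sum => w _.
  have cM : c <= Num.max z w by rewrite le_max zc.
  case: (leP (Num.max z w) (2 ^+ r)) => h.
    by rewrite ler_wpDr ?(ltW (e0 _)) //; exact: inv_le_dyadic_sum.
  rewrite ler_wpDl //.
    by apply: mulr_ge0; [lra | exact: sum0].
  by rewrite lef_pV2 ?posrE ?exprn_gt0 ?ltW // (lt_le_trans c0).
have -> : \sum_(z <- zs) \sum_(w <- zs) ((2 + c^-1) *
   (\sum_(s < r.+1) (2 ^+ s)^-1 * (Num.max z w <= 2 ^+ s)%R%:R) + (2 ^+ r)^-1) =
   (2 + c^-1) * (\sum_(s < r.+1) (2 ^+ s)^-1 *
       \sum_(z <- zs) \sum_(w <- zs) (Num.max z w <= 2 ^+ s)%R%:R)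
   + (size zs)%:R ^+ 2 / 2 ^+ r.
  under eq_bigr => z _ do rewrite big_split /= -mulr_sumr exchange_big /=.
  rewrite big_split /= -mulr_sumr exchange_big /=; congr (_ * _ + _).
    apply: eq_bigr => s _; rewrite mulr_sumr; apply: eq_bigr => z _.
    by rewrite mulr_sumr.
  by rewrite !sum_const_seq mulrA expr2.
rewrite lerD2r -!mulrA ler_wpM2l ?addr_ge0 ?(ltW c20) //.
apply: (@le_trans _ _ (\sum_(s < r.+1) 2 * near_count zs zs)); last first.
  by rewrite sumr_const card_ord -mulr_natr; lra.
apply: ler_sum => s _.
have := count_small (2 ^ s) z0; rewrite natrX => h.
rewrite ler_pdivrMl ?exprn_gt0 //; apply: le_trans h _.
have : 1 <= 2 ^+ s :> R by rewrite exprn_ege1 // ler1n.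
have := near_count_ge0 zs zs; nra.
Qed.

Lemma near_count_strip (R : realType) (M : nat) (zs : seq R) :
  \sum_(z <- zs) \sum_(w <- zs) #|strip M 1 z w|%:R =
  near_count (dilates (index_iota 1 M) zs) (dilates (index_iota 1 M) zs).
Proof.
rewrite near_count_dilates [RHS]exchange_big /=; apply: eq_bigr => z _.
under [RHS]eq_bigr => j _ do rewrite exchange_big /=.
rewrite [RHS]exchange_big /=; apply: eq_bigr => w _.
by rewrite strip_sum.
Qed.

(** All dilation factors below twice 2^I are admitted, not just one dyadic block:
    the lattice point bound returns multiples of a primitive vector whose two
    coordinates need not lie in the same block. *)
Definition dilated_count (R : realType) (I : nat) (zs : seq R) : R :=
  near_count (dilates (index_iota 1 (2 ^ I.+1)) zs)
         (dilates (index_iota 1 (2 ^ I.+1)) zs).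

(** The quantity to be bounded reappears, to the first power only, on the right
    hand side: blocks are summed by [dyadic_blocks], each is bounded by
    [block_count], and [strip_count_min] is summed over all pairs (z, w). *)
Lemma dilated_energy (R : realType) (I D : nat) (zs : seq R) :
  (forall z, z \in zs -> 0 < z) ->
  (forall m, (0 < m < 4 * (2 ^ I) ^ 2)%N -> (size (divisors m) <= D)%N) ->
  dilated_count I zs ^+ 2 <=
  81 * I.+1%:R ^+ 4 * D%:R ^+ 2 * near_count zs zs *
    (16 * (2 ^ I)%N%:R * (dilated_count I zs + (size zs)%:R ^+ 2) +
     160 * (2 ^ I)%N%:R ^+ 3 * \sum_(z <- zs) \sum_(w <- zs) (Num.max z w)^-1).
Proof.
move=> z0 HD; pose J := (2 ^ I)%N%:R : R; set X := dilated_count I zs.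
rewrite -/J; set W := \sum_(z <- zs) _; set E := near_count zs zs.
set Y := _ + 160 * _ * _.
have J1 : 1 <= J by rewrite /J ler1n expn_gt0.
have W0 : 0 <= W.
  rewrite /W big_seq; apply: sumr_ge0 => z zin; apply: sumr_ge0 => w _.
  by rewrite invr_ge0 le_max ltW // z0.
have X0 : 0 <= X by exact: near_count_ge0.
have E0 : 0 <= E by exact: near_count_ge0.
have Y0 : 0 <= Y by rewrite addr_ge0 ?mulr_ge0 ?addr_ge0 ?exprn_ge0 //; lra.
pose s := Num.sqrt (9 * (E * (D%:R ^+ 2 * Y))).
have sE : s ^+ 2 = 9 * (E * (D%:R ^+ 2 * Y)).
  by rewrite sqr_sqrtr // !mulr_ge0 // exprn_ge0.
have blk i : (i < I.+1)%N -> near_count (dilates (dyadic i) zs) (dilates (dyadic i) zs) <= s.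
  move=> iI; rewrite -(@ler_pXn2r _ 2) ?nnegrE ?near_count_ge0 ?sqrtr_ge0 // sE.
  have iJ : (2 ^ i <= 2 ^ I)%N by rewrite leq_exp2l.
  have iJR : (2 ^ i)%N%:R <= J :> R by rewrite ler_nat.
  apply: le_trans (@block_count R i D zs z0 _) _.
    move=> m /andP[m0 mi]; apply: HD; rewrite m0 /=; apply: leq_trans mi _.
    by rewrite leq_mul2l /= leq_exp2r.
  rewrite !ler_wpM2l ?exprn_ge0 //.
  apply: (@le_trans _ _ (\sum_(z <- zs) \sum_(w <- zs)
     (16 * J * (#|strip (2 ^ I.+1) 1 z w|%:R + 1) + 160 * J ^+ 3 * (Num.max z w)^-1))).
    rewrite big_seq [leRHS]big_seq; apply: ler_sum => z zin.
    rewrite big_seq [leRHS]big_seq; apply: ler_sum => w win.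
    apply: le_trans (@strip_count_min R (2 ^ i) z w _ (z0 _ zin) (z0 _ win)) _.
      by rewrite expn_gt0.
    apply: lerD.
      apply: ler_pM; [by rewrite mulr_ge0|by rewrite addr_ge0|lra|].
      rewrite lerD2r -!strip_sum -expnS.
      have ii : (2 ^ i.+1 <= 2 ^ I.+1)%N by rewrite leq_exp2l.
      have i1 : (1 <= 2 ^ i.+1)%N by rewrite expn_gt0.
      rewrite [leRHS](big_cat_nat i1 ii) /= ler_wpDr //.
        by do 2!apply: sumr_ge0 => ? _.
      apply: ler_sum => m _; rewrite [leRHS](big_cat_nat i1 ii) /= ler_wpDr //.
      by apply: sumr_ge0.
    apply: ler_wpM2r; first by rewrite invr_ge0 le_max ltW // z0.
    by apply: ler_wpM2l => //; rewrite lerXn2r ?nnegrE //; lra.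
  under eq_bigr => z _ do rewrite big_split /= -!mulr_sumr big_split /=.
  rewrite big_split /= -!mulr_sumr big_split /= near_count_strip -/X -/W.
  by rewrite /Y !sum_const_seq mulr1 expr2.
have Xs : X <= 3 * I.+1%:R * (I.+1%:R * s).
  have h := @dyadic_blocks R I.+1 zs (fun=> 1) (fun=> 1)
    (fun z zin => ltW (z0 z zin)) (fun=> ler01) (fun=> ler01) (fun _ _ _ _ => lexx 1).
  have {}h : X <= 3 * I.+1%:R * \sum_(i < I.+1)
      near_count (dilates (dyadic i) zs) (dilates (dyadic i) zs).
    rewrite /X /dilated_count near_count_dilates; apply: le_trans (le_trans _ h) _.
      by do 4!(apply: ler_sum => ? _); rewrite !mul1r.
    apply: ler_wpM2l; first by rewrite mulr_ge0.
    by apply: ler_sum => i _; rewrite expr1n mul1r.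
  apply: le_trans h _; rewrite ler_wpM2l ?mulr_ge0 //.
  apply: (@le_trans _ _ (\sum_(i < I.+1) s)).
    by apply: ler_sum => i _; exact: blk.
  by rewrite sumr_const card_ord mulr_natl.
apply: (@le_trans _ _ ((3 * I.+1%:R * (I.+1%:R * s)) ^+ 2)).
  by rewrite ler_pXn2r ?nnegrE // !mulr_ge0 ?sqrtr_ge0.
by rewrite !exprMn sE; lra.
Qed.

(** * The divisor bound *)

(** Write e = q k + r: then e + 1 <= k (q + 1) <= k 2^q. *)
Lemma succ_expn_le (k e : nat) : (0 < k)%N -> (e.+1 ^ k <= k ^ k * 2 ^ e)%N.
Proof.
move=> k0; have : (e.+1 <= k * 2 ^ (e %/ k))%N.
  apply: (@leq_trans (k * (e %/ k).+1)).
    by rewrite mulnC ltn_ceil.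
  by rewrite leq_mul2l ltn_expl // orbT.
move=> h; apply: (@leq_trans ((k * 2 ^ (e %/ k)) ^ k)); first by rewrite leq_exp2r.
by rewrite expnMn -expnM leq_mul2l leq_exp2l // leq_trunc_div orbT.
Qed.

Lemma size_divisors (n : nat) :
  size (divisors n) = (\prod_(f <- prime_decomp n) f.2.+1)%N.
Proof.
have step p e ds : size (PrimeDecompAux.add_divisors (p, e) ds) = (e.+1 * size ds)%N.
  elim: e => [|e IHe]; first by rewrite mul1n.
  by rewrite /= size_merge size_cat size_map IHe [RHS]mulSn addnC.
rewrite /divisors; elim: (prime_decomp n) => [|[p e] s IH]; first by rewrite big_nil.
by rewrite big_cons -IH; exact: step.
Qed.

(** Compare the factors (e + 1)^k and p^e over the prime factorization: for
    p >= 2^k the former is at most the latter, and each of the fewer than 2^k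
    smaller primes costs at most a factor k^k. *)
Lemma divisor_bound (k n : nat) : (0 < k)%N -> (0 < n)%N ->
  (size (divisors n) ^ k <= (k ^ k) ^ (2 ^ k) * n)%N.
Proof.
move=> k0 n0; set K := (k ^ k)%N.
have K0 : (0 < K)%N by rewrite expn_gt0 k0.
pose small p := if (p < 2 ^ k)%N then K else 1%N.
have term p e : prime p -> (e.+1 ^ k <= small p * p ^ e)%N.
  move=> pp; rewrite /small; case: ltnP => h.
    apply: leq_trans (succ_expn_le e k0) _; rewrite leq_mul2l; apply/orP; right.
    by case: e => [//|e]; rewrite leq_exp2r // prime_gt1.
  rewrite mul1n; apply: (@leq_trans ((2 ^ k) ^ e)).
    by rewrite -expnM mulnC expnM leq_exp2r // ltn_expl.
  by case: e => [//|e]; rewrite leq_exp2r.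
have prod_small s : uniq s -> (\prod_(p <- s) small p <= K ^ (2 ^ k))%N.
  move=> us.
  have -> : (\prod_(p <- s) small p = K ^ \sum_(p <- s) (p < 2 ^ k))%N.
    by rewrite expn_sum; apply: eq_bigr => p _; rewrite /small; case: ltnP.
  rewrite leq_pexp2l // -[X in (_ <= X)%N](size_iota 0).
  apply: (@leq_trans (size [seq p <- s | (p < 2 ^ k)%N])).
    by rewrite size_filter -sum1_count [leqRHS]big_mkcond.
  apply: uniq_leq_size; first exact: filter_uniq.
  by move=> p; rewrite mem_filter mem_iota => /andP[].
rewrite size_divisors [X in (_ <= _ * X)%N](prod_prime_decomp n0).
apply: (@leq_trans (\prod_(f <- prime_decomp n) (small f.1 * f.1 ^ f.2))%N).
  rewrite (big_morph (fun x => x ^ k)%N (id1 := 1%N) (op1 := muln)); first last.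
  - by rewrite exp1n.
  - by move=> x y; rewrite expnMn.
  rewrite big_seq [leqRHS]big_seq; apply: leq_prod => -[p e] /mem_prime_decomp[pp _ _].
  exact: term.
rewrite big_split /= leq_mul2r; apply/orP; right.
have := prod_small (primes n) (primes_uniq n).
by rewrite prime_decompE !big_map.
Qed.

(** * Subpolynomial factors *)

(** Growth slower than every positive power of N, the usual N^o(1). *)
Definition subpoly (R : realType) (f : nat -> R) : Prop :=
  forall e : R, 0 < e -> exists C : R, 0 < C /\
    forall N : nat, (0 < N)%N -> f N <= C * N%:R `^ e.

(** All powers of f share one polynomial rate, so taking roots makes the
    exponent arbitrarily small. *)
Lemma subpoly_pow (R : realType) (f : nat -> R) (d : nat) :
  (forall N, 0 <= f N) ->
  (forall q : nat, (0 < q)%N -> exists C : R,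
     forall N, (0 < N)%N -> f N ^+ q <= C * N%:R ^+ d) ->
  subpoly f.
Proof.
move=> f0 fq e e0.
have [q qe] : exists q : nat, d%:R / e <= q%:R.
  exists (Num.truncn (d%:R / e)).+1; apply: ltW.
  have d0 : 0 <= d%:R / e by rewrite divr_ge0 // ltW.
  by have /andP[] := truncn_itv d0.
have [C HC] := fq q.+1 isT.
exists (Num.max 1 C); split; first by rewrite lt_max ltr01.
move=> N N0; have N1 : 1 <= N%:R :> R by rewrite ler1n.
have Ne0 : 0 <= N%:R `^ e by exact: powR_ge0.
have m1 : 1 <= Num.max 1 C by rewrite le_max lexx.
rewrite -(@ler_pXn2r _ q.+1) ?nnegrE ?mulr_ge0 //; last exact: le_trans m1.
apply: le_trans (HC N N0) _; rewrite exprMn.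
(* the maximum with 1 replaces the q-th root of the constant C *)
apply: (@le_trans _ _ (Num.max 1 C * N%:R ^+ d)).
  by rewrite ler_wpM2r ?exprn_ge0 // le_max lexx orbT.
apply: ler_pM; rewrite ?exprn_ge0 ?(le_trans _ m1) //.
  by rewrite -[leLHS]expr1 ler_weXn2l.
rewrite -!powR_mulrn // -powRrM ler_powR // mulrC.
rewrite ler_pdivrMr // in qe; apply: le_trans qe _.
by rewrite ler_pM2r // ler_nat.
Qed.

Lemma subpolyM (R : realType) (f g : nat -> R) :
  (forall N, 0 <= f N) -> (forall N, 0 <= g N) ->
  subpoly f -> subpoly g -> subpoly (fun N => f N * g N).
Proof.
move=> f0 g0 fs gs e e0.
have e20 : 0 < e / 2 by rewrite divr_gt0.
have [C [C0 HC]] := fs _ e20; have [D [D0 HD]] := gs _ e20.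
exists (C * D); split; first exact: mulr_gt0.
move=> N N0; have Nn0 : (N%:R != 0 :> R) by rewrite pnatr_eq0 -lt0n.
apply: le_trans (ler_pM (f0 N) (g0 N) (HC N N0) (HD N N0)) _.
by rewrite mulrACA -powRD ?Nn0 ?implybT // -splitr.
Qed.

Lemma subpolyX (R : realType) (f : nat -> R) (n : nat) :
  (forall N, 0 <= f N) -> subpoly f -> subpoly (fun N => f N ^+ n).
Proof.
move=> f0 fs; elim: n => [|n IH].
  move=> e e0; exists 1; split => // N N0; rewrite expr0 mul1r.
  by rewrite -{1}(powRr0 N%:R) ler_powR ?ler1n // ltW.
have -> : (fun N => f N ^+ n.+1) = (fun N => f N * f N ^+ n).
  by apply: funext => N; rewrite exprS.
by apply: subpolyM => // N; rewrite exprn_ge0.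
Qed.

Lemma subpoly_log (R : realType) (L : nat -> nat) (K : R) :
  (forall N, (0 < N)%N -> 2 ^+ L N <= K * N%:R ^+ 4) ->
  subpoly (fun N => (L N).+1%:R : R).
Proof.
move=> HL; apply: (@subpoly_pow _ _ 4) => // q q0.
exists (q%:R ^+ q * K) => N N0.
rewrite -natrX; apply: (@le_trans _ _ (q ^ q * 2 ^ L N)%N%:R).
  by rewrite ler_nat succ_expn_le.
by rewrite natrM !natrX -mulrA ler_wpM2l ?exprn_ge0 ?HL.
Qed.

Definition max_divisors (M : nat) : nat := (\max_(m < M) size (divisors m))%N.

Lemma card_ordS (M : nat) : (0 < #|'I_M.+1|)%N.
Proof. by rewrite card_ord. Qed.

Lemma leq_max_divisors (M m : nat) : (m < M)%N -> (size (divisors m) <= max_divisors M)%N.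
Proof. by move=> mM; exact: (bigop.leq_bigmax (Ordinal mM)). Qed.

Lemma subpoly_divisors (R : realType) (L : nat -> nat) (K : R) :
  (forall N, (0 < N)%N -> 2 ^+ L N <= K * N%:R ^+ 4) ->
  subpoly (fun N => (max_divisors (4 ^ L N))%:R : R).
Proof.
move=> HL; apply: (@subpoly_pow _ _ 8) => // q q0.
exists (((q ^ q) ^ (2 ^ q))%N%:R * K ^+ 2) => N N0.
have K0 : 0 <= K * N%:R ^+ 4 by apply: le_trans (HL N N0); rewrite exprn_ge0.
apply: (@le_trans _ _ (((q ^ q) ^ (2 ^ q)) * 4 ^ L N)%N%:R).
  rewrite -natrX ler_nat.
  have : (0 < 4 ^ L N)%N by rewrite expn_gt0.
  case: (4 ^ L N)%N => // M _; rewrite /max_divisors.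
  have [m ->] := bigop.eq_bigmax (fun m : 'I_M.+1 => size (divisors m)) (card_ordS M).
  have [->|m0] := posnP m; last first.
    apply: leq_trans (divisor_bound q0 m0) _; rewrite leq_mul2l.
    by rewrite (ltnW (ltn_ord m)) orbT.
  rewrite (_ : size (divisors 0) = 1%N) // exp1n muln_gt0 /= !expn_gt0 q0 //.
rewrite natrM -mulrA ler_wpM2l // natrX (_ : 4%:R = 2 ^+ 2); last by rewrite -natrX.
rewrite exprAC (_ : K ^+ 2 * N%:R ^+ 8 = (K * N%:R ^+ 4) ^+ 2); last first.
  by rewrite exprMn -exprM.
by rewrite ler_pXn2r ?nnegrE ?exprn_ge0 ?HL.
Qed.

(** If y exceeds q, then the right hand side is at most 2 G q y. *)
Lemma quadratic_bound (R : realType) (G q y : R) :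
  1 <= G -> 0 < q -> 0 <= y -> y ^+ 2 <= G * (q * y + q ^+ 2) -> y <= 2 * G * q.
Proof.
move=> G1 q0 y0 h; rewrite leNgt; apply/negP => yq.
have qy : q < y by apply: le_lt_trans yq; rewrite ler_peMl ?ltW //; lra.
have : y ^+ 2 < y ^+ 2; last by rewrite ltxx.
apply: le_lt_trans h _.
have : G * (q * y + q ^+ 2) <= G * (2 * (q * y)).
  rewrite ler_wpM2l; [nra|lra|].
  by rewrite expr2; have := ler_wpM2l (ltW q0) (ltW qy); lra.
move=> /le_lt_trans; apply.
rewrite expr2 (_ : G * _ = 2 * G * q * y); last by ring.
by rewrite ltr_pM2r // (lt_trans q0).
Qed.

(** * The weighted count of near pairs *)

Lemma near_count_dyadic_le (R : realType) (i : nat) (zs : seq R) :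
  near_count (dilates (dyadic i) zs) (dilates (dyadic i) zs) <= dilated_count i zs.
Proof.
rewrite /dilated_count !near_count_dilates /dyadic.
have i1 : (1 <= 2 ^ i)%N by rewrite expn_gt0.
have i2 : (2 ^ i <= 2 ^ i.+1)%N by rewrite leq_exp2l.
rewrite [leRHS](big_cat_nat i1 i2) /= ler_wpDl //.
  by do 4!apply: sumr_ge0 => ? _.
apply: ler_sum => j _; apply: ler_sum => z _.
rewrite [leRHS](big_cat_nat i1 i2) /= ler_wpDl //.
by do 2!apply: sumr_ge0 => ? _.
Qed.

(** Multiplying the quadratic inequality for X by b^4 turns it into one for
    y = b^2 X.  Every power of J is absorbed by b J <= A or b n <= A, so that the
    coefficients become powers of q, and [quadratic_bound] applies.  In use, q
    is n^(2 - delta) and e bounds the energy. *)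
Lemma weighted_block_algebra (R : realType) (A C Cc e n q l d b J X : R) :
  0 < n -> 0 <= A -> 0 <= C -> 0 <= Cc -> 0 <= e -> 1 <= q -> 1 <= l -> 1 <= d ->
  0 <= b -> 1 <= J -> 0 <= X -> b * n <= A -> b * J <= A ->
  e / n <= C * q -> e * n <= C * q ^+ 2 -> e ^+ 2 / n = C ^+ 2 * q ^+ 2 ->
  X ^+ 2 <= 81 * l ^+ 4 * d ^+ 2 * e *
    (16 * J * (X + n ^+ 4) + 160 * J ^+ 3 * (2 * Cc * l * e + 1)) ->
  b ^+ 2 * X <=
    2 * ((1 + 81 * (16 * A ^+ 2 * C + 176 * A ^+ 4 * C
              + 320 * A ^+ 4 * Cc * C ^+ 2)) * (l ^+ 5 * d ^+ 2)) * q.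
Proof.
move=> n0 A0 C0 Cc0 e0 q1 l1 d1 b0 J1 X0 bn bJ en en2 een hX.
have q0 : 0 < q by lra.
have q0w : 0 <= q by lra.
have dge0 : 0 <= d by lra.
have l0 : 0 <= l by lra.
set K1 := 16 * A ^+ 2 * C + _ + _.
have A2 : 0 <= A ^+ 2 by exact: exprn_ge0.
have A4 : 0 <= A ^+ 4 by exact: exprn_ge0.
have K10 : 0 <= K1.
  have a1 : 0 <= A ^+ 2 * C by rewrite mulr_ge0.
  have a2 : 0 <= A ^+ 4 * C by rewrite mulr_ge0.
  have a3 : 0 <= A ^+ 4 * Cc * C ^+ 2 by rewrite !mulr_ge0 // exprn_ge0.
  by rewrite /K1; lra.
have l5 : 1 <= l ^+ 5 by rewrite exprn_ege1.
have d2 : 1 <= d ^+ 2 by rewrite exprn_ege1.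
have ld : 1 <= l ^+ 5 * d ^+ 2 by rewrite mulr_ege1.
set y := b ^+ 2 * X.
have y0 : 0 <= y by rewrite mulr_ge0 // exprn_ge0.
have bJ0 : 0 <= b * J by rewrite mulr_ge0 //; lra.
have bn0 : 0 <= b * n by rewrite mulr_ge0 //; lra.
have h1 : b ^+ 2 * J <= A ^+ 2 / n.
  rewrite ler_pdivlMr // (_ : _ * n = (b * J) * (b * n)); last by ring.
  by rewrite expr2; apply: ler_pM.
have h2 : b ^+ 4 * J * n ^+ 4 <= A ^+ 4 * n.
  rewrite (_ : _ * n ^+ 4 = (b * J) * (b * n) ^+ 3 * n); last by ring.
  rewrite ler_wpM2r ?(ltW n0) // (exprS A 3); apply: ler_pM => //.
    by rewrite exprn_ge0.
  by rewrite lerXn2r ?nnegrE.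
have h3 : b ^+ 4 * J ^+ 3 <= A ^+ 4 / n.
  rewrite ler_pdivlMr // (_ : _ * n = (b * n) * (b * J) ^+ 3); last by ring.
  rewrite (exprS A 3); apply: ler_pM => //; first by rewrite exprn_ge0.
  by rewrite lerXn2r ?nnegrE.
have t1 : e * (b ^+ 4 * J * X) <= A ^+ 2 * C * (q * y).
  rewrite (_ : b ^+ 4 * J * X = b ^+ 2 * J * y); last by rewrite /y; ring.
  apply: (@le_trans _ _ (e * (A ^+ 2 / n * y))).
    by rewrite ler_wpM2l // ler_wpM2r.
  rewrite (_ : e * _ = A ^+ 2 * y * (e / n)); last by ring.
  rewrite (_ : A ^+ 2 * C * _ = A ^+ 2 * y * (C * q)); last by ring.
  by rewrite ler_wpM2l // mulr_ge0.
have t2 : e * (b ^+ 4 * J * n ^+ 4) <= A ^+ 4 * C * q ^+ 2.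
  apply: (@le_trans _ _ (e * (A ^+ 4 * n))); first by rewrite ler_wpM2l.
  by rewrite mulrCA -mulrA ler_wpM2l.
have t3 : e * (b ^+ 4 * J ^+ 3 * (2 * Cc * l * e)) <= l * (2 * Cc * A ^+ 4 * C ^+ 2 * q ^+ 2).
  apply: (@le_trans _ _ (e * (A ^+ 4 / n * (2 * Cc * l * e)))).
    by rewrite ler_wpM2l // ler_wpM2r // !mulr_ge0 //; lra.
  rewrite (_ : e * _ = l * (2 * Cc * A ^+ 4 * (e ^+ 2 / n))); last by ring.
  by rewrite een !mulrA.
have qq : q <= q ^+ 2 by rewrite expr2 ler_peMl // ltW.
have t4 : e * (b ^+ 4 * J ^+ 3) <= A ^+ 4 * C * q ^+ 2.
  apply: (@le_trans _ _ (e * (A ^+ 4 / n))); first by rewrite ler_wpM2l.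
  rewrite mulrCA -mulrA ler_wpM2l //; apply: le_trans en _.
  by rewrite ler_wpM2l.
have qy0 : 0 <= q * y by rewrite mulr_ge0 // ltW.
have q20 : 0 <= q ^+ 2 by rewrite exprn_ge0 // ltW.
apply: quadratic_bound => //.
  apply: (le_trans ld); apply: ler_peMl; first exact: le_trans ld.
  by rewrite lerDl mulr_ge0.
apply: (@le_trans _ _ (81 * l ^+ 4 * d ^+ 2 * (l * (K1 * (q * y + q ^+ 2))))).
  have -> : y ^+ 2 = b ^+ 4 * X ^+ 2 by rewrite /y; ring.
  have b4 : 0 <= b ^+ 4 by exact: exprn_ge0.
  apply: le_trans (ler_wpM2l b4 hX) _.
  have -> : b ^+ 4 * (81 * l ^+ 4 * d ^+ 2 * e *
      (16 * J * (X + n ^+ 4) + 160 * J ^+ 3 * (2 * Cc * l * e + 1))) =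
    81 * l ^+ 4 * d ^+ 2 * (16 * (e * (b ^+ 4 * J * X)) + 16 * (e * (b ^+ 4 * J * n ^+ 4))
     + 160 * (e * (b ^+ 4 * J ^+ 3 * (2 * Cc * l * e))) + 160 * (e * (b ^+ 4 * J ^+ 3))).
    by ring.
  rewrite ler_wpM2l ?mulr_ge0 ?exprn_ge0 //.
  have m1 : A ^+ 2 * C * (q * y) <= l * (A ^+ 2 * C * (q * y)).
    by rewrite ler_peMl // !mulr_ge0.
  have m2 : A ^+ 4 * C * q ^+ 2 <= l * (A ^+ 4 * C * q ^+ 2).
    by rewrite ler_peMl // !mulr_ge0.
  have m3 : 0 <= l * (A ^+ 2 * C * q ^+ 2) by rewrite !mulr_ge0.
  have m4 : 0 <= l * (A ^+ 4 * C * (q * y)) by rewrite !mulr_ge0.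
  have m5 : 0 <= l * (Cc * A ^+ 4 * C ^+ 2 * (q * y)) by rewrite !mulr_ge0 ?exprn_ge0.
  rewrite (_ : l * (K1 * _) = 16 * (l * (A ^+ 2 * C * (q * y))) + 16 * (l * (A ^+ 2 * C * q ^+ 2))
     + 176 * (l * (A ^+ 4 * C * (q * y))) + 176 * (l * (A ^+ 4 * C * q ^+ 2))
     + 320 * (l * (Cc * A ^+ 4 * C ^+ 2 * (q * y)))
     + 160 * (l * (2 * Cc * A ^+ 4 * C ^+ 2 * q ^+ 2))); last by rewrite /K1; ring.
  lra.
rewrite (_ : 81 * _ * _ * _ = (81 * K1) * (l ^+ 5 * d ^+ 2) * (q * y + q ^+ 2)); last by ring.
have ld0 : 0 <= l ^+ 5 * d ^+ 2 * (q * y + q ^+ 2).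
  by rewrite mulr_ge0 ?addr_ge0 // (le_trans _ ld).
lra.
Qed.

(** [dilated_energy] with the energy hypothesis inserted.  The condition
    delta <= 1/4 keeps the term e n, which stems from the size of zs, within the
    order of q^2. *)
Lemma weighted_block (R : realType) (zs : seq R) (n c C A b delta : R) (i L D : nat) :
  1 <= n -> 0 < c -> (forall z, z \in zs -> c <= z) ->
  (size zs)%:R <= n ^+ 2 -> 0 < delta <= 4^-1 ->
  0 <= C -> near_count zs zs <= C * n `^ (5 / 2 - delta) ->
  n ^+ 4 <= 2 ^+ L -> (i < L)%N ->
  (forall m, (m < 4 ^ L)%N -> (size (divisors m) <= D)%N) ->
  0 <= A -> 0 <= b -> b * n <= A -> b * (2 ^ i)%N%:R <= A ->
  b ^+ 2 * dilated_count i zs <=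
    2 * ((1 + 81 * (16 * A ^+ 2 * C + 176 * A ^+ 4 * C
              + 320 * A ^+ 4 * (2 + c^-1) * C ^+ 2)) * (L.+1%:R ^+ 5 * D%:R ^+ 2))
      * n `^ (2 - delta).
Proof.
move=> n1 c0 zc sn /andP[d0 d4] C0 En nL iL HD A0 b0 bn bJ.
have n0 : 0 < n by lra.
set q := n `^ (2 - delta); set l : R := L.+1%:R; set d : R := D%:R.
set J : R := (2 ^ i)%N%:R in bJ *.
have z0 z : z \in zs -> 0 < z by move/zc; exact: lt_le_trans.
have J1 : 1 <= J by rewrite ler1n expn_gt0.
have ci0 : 0 < c^-1 by rewrite invr_gt0.
have q0 : 0 < q by rewrite powR_gt0.
have l1 : 1 <= l by rewrite ler1n.
have d1 : 1 <= d.
  rewrite ler1n; apply: leq_trans (HD 0%N _); rewrite ?expn_gt0 //.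
have HDi m : (0 < m < 4 * (2 ^ i) ^ 2)%N -> (size (divisors m) <= D)%N.
  move=> /andP[_ mi]; apply: HD; apply: leq_trans mi _.
  have -> : ((2 ^ i) ^ 2 = 4 ^ i)%N by rewrite -expnM mulnC expnM.
  by rewrite -expnS leq_exp2l.
have := dilated_energy z0 HDi.
have := sum_inv_max L c0 zc.
have X0 : 0 <= dilated_count i zs by exact: near_count_ge0.
have E0 := near_count_ge0 zs zs.
set W := \sum_(z <- zs) _; set X := dilated_count i zs in X0 *.
set E := near_count zs zs in E0 En *; rewrite -/l -/d -/J => hW hX.
set e := C * _ in En.
have e0 : 0 <= e by rewrite mulr_ge0 // powR_ge0.
have nn0 : n != 0 by rewrite gt_eqF.
have PD x y : n `^ x * n `^ y = n `^ (x + y) by rewrite powRD // nn0 implybT.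
have q2 : q ^+ 2 = n `^ ((2 - delta) * 2).
  by rewrite -powR_mulrn ?powR_ge0 // -powRrM.
have en : e / n <= C * q.
  rewrite /e -mulrA ler_wpM2l // -(powR_inv1 (ltW n0)) PD ler_powR //; lra.
have en2 : e * n <= C * q ^+ 2.
  rewrite /e -mulrA ler_wpM2l // -{2}(powRr1 (ltW n0)) PD q2 ler_powR //; lra.
have een : e ^+ 2 / n = C ^+ 2 * q ^+ 2.
  rewrite /e exprMn -[_ `^ _ ^+ 2]powR_mulrn ?powR_ge0 // -powRrM -mulrA -(powR_inv1 (ltW n0)).
  rewrite PD q2; congr (_ * _ `^ _); lra.
have q1 : 1 <= q.
  by rewrite -(powRr0 n) ler_powR //; lra.
have W0 : 0 <= W.
  rewrite /W big_seq; apply: sumr_ge0 => z zin; apply: sumr_ge0 => w _.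
  by rewrite invr_ge0 le_max ltW // z0.
have s0 : 0 <= (size zs)%:R :> R by [].
set s : R := (size zs)%:R in sn s0 hW hX.
have {}hW : W <= 2 * (2 + c^-1) * l * e + 1.
  apply: le_trans hW _; apply: lerD.
    rewrite (_ : (2 + c^-1) * _ * _ = 2 * (2 + c^-1) * l * E); last by ring.
    by rewrite ler_wpM2l // !mulr_ge0 //; lra.
  rewrite ler_pdivrMr ?exprn_gt0 // mul1r; apply: le_trans nL.
  by rewrite (_ : 4 = 2 * 2)%N // exprM lerXn2r ?nnegrE // exprn_ge0 // ltW.
have l0 : 0 <= l by lra.
have {}hX : X ^+ 2 <= 81 * l ^+ 4 * d ^+ 2 * e *
    (16 * J * (X + n ^+ 4) + 160 * J ^+ 3 * (2 * (2 + c^-1) * l * e + 1)).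
  apply: le_trans hX _.
  have p0 : 0 <= 81 * i.+1%:R ^+ 4 * d ^+ 2 :> R by rewrite !mulr_ge0 ?exprn_ge0.
  have il : i.+1%:R <= l :> R by rewrite ler_nat ltnW.
  have J3 : 0 <= 160 * J ^+ 3 by rewrite mulr_ge0 ?exprn_ge0 //; lra.
  have J16 : 0 <= 16 * J by lra.
  apply: ler_pM.
  - by rewrite mulr_ge0.
  - by rewrite addr_ge0 ?mulr_ge0 // addr_ge0 // exprn_ge0.
  - apply: ler_pM => //; rewrite ler_wpM2r ?exprn_ge0 // ler_wpM2l //.
    by rewrite lerXn2r ?nnegrE.
  apply: lerD; last by rewrite ler_wpM2l.
  rewrite ler_wpM2l // lerD2l (_ : 4 = 2 * 2)%N // exprM lerXn2r ?nnegrE //.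
  by rewrite exprn_ge0 // ltW.
apply: (@weighted_block_algebra R A C (2 + c^-1) e n q l d b J X) => //.
lra.
Qed.

(** The normalisation of the variance by N^2 cancels the exponent 2 and leaves a
    power saving delta / 2; the other half of delta absorbs the logarithms and
    the divisor function. *)
Lemma variance_count (R : realType) (zs : nat -> seq R) (L : nat -> nat)
    (cf : nat -> nat -> R) (c C A K delta : R) :
  0 < c -> (forall N z, z \in zs N -> c <= z) ->
  (forall N, (size (zs N) <= N ^ 2)%N) ->
  0 < delta <= 4^-1 -> 0 <= C ->
  (forall N, (0 < N)%N -> near_count (zs N) (zs N) <= C * N%:R `^ (5 / 2 - delta)) ->
  (forall N, (0 < N)%N -> N%:R ^+ 4 <= 2 ^+ L N :> R) ->
  (forall N, (0 < N)%N -> 2 ^+ L N <= K * N%:R ^+ 4) ->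
  0 <= A -> (forall N j, 0 <= cf N j) ->
  (forall N j, (0 < N)%N -> cf N j * N%:R <= A) ->
  (forall N j, (0 < N)%N -> cf N j * j%:R <= A) ->
  exists B : R, forall N, (0 < N)%N ->
    \sum_(1 <= j < 2 ^ L N) \sum_(z <- zs N) \sum_(k <- index_iota 1 (2 ^ L N))
      \sum_(w <- zs N)
        cf N j * cf N k * (1 + (j%:R * z - k%:R * w) ^+ 2)^-1
    <= B * N%:R `^ (2 - delta / 2).
Proof.
move=> c0 zc szN dlt C0 EN HL1 HL2 A0 cf0 cfN cfj.
have d0 : 0 < delta by case/andP: dlt.
pose l N : R := (L N).+1%:R.
pose d N : R := (max_divisors (4 ^ L N))%:R.
have l0 N : 0 <= l N by [].
have dd0 N : 0 <= d N by [].
have sub : subpoly (fun N => l N ^+ 7 * d N ^+ 2).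
  apply: subpolyM; try by move=> N; rewrite exprn_ge0.
    by apply: subpolyX => //; exact: subpoly_log HL2.
  by apply: subpolyX => //; exact: subpoly_divisors HL2.
have [S [S0 HS]] := sub _ (divr_gt0 d0 (ltr0n _ 2)).
set K1 := 1 + 81 * (16 * A ^+ 2 * C + 176 * A ^+ 4 * C
              + 320 * A ^+ 4 * (2 + c^-1) * C ^+ 2).
have K10 : 0 <= K1.
  have a1 : 0 <= A ^+ 2 * C by rewrite mulr_ge0 // exprn_ge0.
  have a2 : 0 <= A ^+ 4 * C by rewrite mulr_ge0 // exprn_ge0.
  have a3 : 0 <= A ^+ 4 * (2 + c^-1) * C ^+ 2.
    by rewrite !mulr_ge0 // ?exprn_ge0 // addr_ge0 // invr_ge0 ltW.
  by rewrite /K1; lra.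
exists (144 * K1 * S) => N N0.
have N1 : 1 <= N%:R :> R by rewrite ler1n.
have Ngt0 : 0 < N%:R :> R by rewrite ltr0n.
have Nn0 : N%:R != 0 :> R by rewrite gt_eqF.
have z0 z : z \in zs N -> 0 <= z by move/zc => h; apply: le_trans h; exact: ltW.
pose r := [seq (j, z) | j <- index_iota 1 (2 ^ L N), z <- zs N].
have := @kernel_le_near_count R (nat * R)%type r (fun s => cf N s.1) (fun s => s.1%:R * s.2).
have sumr (F : nat * R -> R) : \sum_(s <- r) F s =
    \sum_(1 <= j < 2 ^ L N) \sum_(z <- zs N) F (j, z).
  by rewrite /r big_allpairs_dep.
rewrite !sumr /=.
under eq_bigr => j _ do under eq_bigr => z _ do rewrite sumr /=.
under [X in _ <= _ * X]eq_bigr => j _ do under eq_bigr => z _ do rewrite sumr /=.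
move=> h; apply: le_trans (h _ _) _ => {h}.
- by move=> s /allpairsP[[j z] /= [_ zin ->]]; rewrite mulr_ge0 // z0.
- by [].
(* the bounds A / N and A / j on the coefficients, made uniform on a block *)
pose beta i := A * Num.min (N%:R)^-1 ((2 ^ i)%N%:R)^-1 : R.
have m0 i : 0 <= Num.min (N%:R)^-1 ((2 ^ i)%N%:R)^-1 :> R.
  by rewrite le_min !invr_ge0 !ler0n.
have b0 i : 0 <= beta i by rewrite mulr_ge0.
have i0 i : 0 < (2 ^ i)%N%:R :> R by rewrite ltr0n expn_gt0.
have cb i j : (i < L N)%N -> j \in dyadic i -> cf N j <= beta i.
  move=> _; rewrite mem_index_iota => /andP[ij _].
  rewrite /beta; case: (leP (N%:R)^-1 _) => _.
    by rewrite ler_pdivlMr // cfN.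
  rewrite ler_pdivlMr //; apply: le_trans (cfj N j N0).
  by rewrite ler_wpM2l // ler_nat.
have h := @dyadic_blocks R (L N) (zs N) (cf N) beta z0 b0 (cf0 N) cb.
apply: le_trans (ler_wpM2l (ler0n _ 24) h) _.
have blk i : (i < L N)%N -> beta i ^+ 2 *
     near_count (dilates (dyadic i) (zs N)) (dilates (dyadic i) (zs N)) <=
   2 * (K1 * (l N ^+ 5 * d N ^+ 2)) * N%:R `^ (2 - delta).
  move=> iL; apply: (@le_trans _ _ (beta i ^+ 2 * dilated_count i (zs N))).
    by rewrite ler_wpM2l ?exprn_ge0 // near_count_dyadic_le.
  apply: (@weighted_block R (zs N) N%:R c C A (beta i) delta i (L N)) => //.
  - exact: zc.
  - by rewrite -natrX ler_nat.
  - exact: EN.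
  - exact: HL1.
  - by move=> m; exact: leq_max_divisors.
  - rewrite /beta -mulrA ler_piMr // -ler_pdivlMr // mul1r.
    by rewrite ge_min lexx.
  - rewrite /beta -mulrA ler_piMr // -ler_pdivlMr // mul1r.
    by rewrite ge_min lexx orbT.
set P := N%:R `^ (2 - delta) in blk.
have P0 : 0 <= P by exact: powR_ge0.
pose T := 2 * (K1 * (l N ^+ 5 * d N ^+ 2)) * P.
have T0 : 0 <= T by rewrite /T !mulr_ge0 // exprn_ge0.
have Ll : (L N)%:R <= l N by rewrite ler_nat.
apply: (@le_trans _ _ (24 * (3 * l N * (l N * T)))).
  rewrite ler_wpM2l //; apply: ler_pM; first by rewrite mulr_ge0.
  - by apply: sumr_ge0 => i _; rewrite mulr_ge0 ?exprn_ge0 ?near_count_ge0.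
  - by rewrite ler_wpM2l.
  apply: (@le_trans _ _ (\sum_(i < L N) T)).
    by apply: ler_sum => i _; exact: blk.
  by rewrite sumr_const card_ord -[leLHS]mulr_natl ler_wpM2r.
have -> : 2 - delta / 2 = (2 - delta) + delta / 2 by field.
rewrite powRD ?Nn0 ?implybT // -/P.
have := HS N N0; set Q := N%:R `^ _ => h1.
rewrite (_ : 24 * _ = 144 * K1 * P * (l N ^+ 7 * d N ^+ 2)); last by rewrite /T; ring.
rewrite (_ : 144 * K1 * S * _ = 144 * K1 * P * (S * Q)); last by ring.
by rewrite ler_wpM2l // !mulr_ge0.
Qed.

(** * Fejer kernels and the smoothed indicator *)

(** Multiplication by 2 sin (phi / 2) makes the sum telescope. *)
Lemma sin_mul_cos_sum (R : realType) (A phi : R) (n : nat) :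
  2 * sin (phi / 2) * \sum_(i < n) cos (A + i%:R * phi) =
  sin (A + n%:R * phi - phi / 2) - sin (A - phi / 2).
Proof.
elim: n => [|n IH]; first by rewrite big_ord0 mulr0 mul0r addr0 subrr.
rewrite big_ord_recr /= mulrDr IH.
have -> : A + n.+1%:R * phi - phi / 2 = (A + n%:R * phi) + phi / 2.
  by rewrite -natr1; field.
rewrite !sinB !sinD; lra.
Qed.

Lemma cos_sum_le (R : realType) (A phi : R) (n : nat) :
  `|\sum_(i < n) cos (A + i%:R * phi)| * `|sin (phi / 2)| <= 1.
Proof.
rewrite -normrM; have := sin_mul_cos_sum A phi n.
set S := \sum_(i < n) _ => e.
have h1 := sin_max (A + n%:R * phi - phi / 2).
have h2 := sin_max (A - phi / 2).
rewrite (_ : S * _ = 2^-1 * (2 * sin (phi / 2) * S)); last by field.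
rewrite e normrM ger0_norm; last by rewrite invr_ge0.
by have := ler_normB (sin (A + n%:R * phi - phi / 2)) (sin (A - phi / 2)); lra.
Qed.

(** The Dirichlet kernel, in the symmetric range from - a to a. *)
Definition dirichlet (R : realType) (a : nat) (phi : R) : R :=
  \sum_(i < (2 * a).+1) cos ((i%:R - a%:R) * phi).

(** The sine parts cancel by symmetry of the range of shifts. *)
Lemma cos_shift_sum (R : realType) (a : nat) (A phi : R) :
  \sum_(i < (2 * a).+1) cos (A - (i%:R - a%:R) * phi) = cos A * dirichlet a phi.
Proof.
have S0 : \sum_(i < (2 * a).+1) sin ((i%:R - a%:R) * phi) = 0.
  set S := \sum_(i < _) _.
  suff : S = - S by lra.
  rewrite {1}/S (reindex_inj rev_ord_inj) /= -sumrN.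
  apply: eq_bigr => i _; rewrite -sinN; congr sin.
  rewrite subSS natrB ?natrM; last by rewrite -ltnS.
  by ring.
under eq_bigr => i _ do rewrite cosB.
by rewrite big_split /= -!mulr_sumr S0 mulr0 addr0.
Qed.

Lemma norm_dirichlet_le (R : realType) (a : nat) (phi : R) :
  `|dirichlet a phi| <= (2 * a).+1%:R /\ `|dirichlet a phi| * `|sin (phi / 2)| <= 1.
Proof.
split.
  apply: le_trans (ler_norm_sum _ _ _) _.
  rewrite -[X in _ <= X%:R]card_ord -sum1_card natr_sum.
  by apply: ler_sum => i _; exact: cos_max.
have := cos_sum_le (- a%:R * phi) phi (2 * a).+1.
rewrite /dirichlet.
by under [X in _ -> `|X| * _ <= _]eq_bigr => i _ do rewrite mulrDl addrC.
Qed.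

(** Border the square by one row and one column, each contributing the sum of
    g over 1, ..., M. *)
Lemma sum_dist (R : realType) (g : nat -> R) (M : nat) :
  \sum_(p < M) \sum_(q < M) g (p - q + (q - p))%N =
  M%:R * g 0%N + 2 * \sum_(1 <= j < M) (M - j)%N%:R * g j.
Proof.
elim: M => [|M IH]; first by rewrite big_ord0 big_geq // mul0r mulr0 addr0.
have row : \sum_(q < M) g (M - q)%N = \sum_(1 <= j < M.+1) g j.
  rewrite big_add1 /= big_mkord (reindex_inj rev_ord_inj) /=.
  by apply: eq_bigr => i _; rewrite subKn.
have -> : \sum_(p < M.+1) \sum_(q < M.+1) g (p - q + (q - p))%N =
   \sum_(p < M) \sum_(q < M) g (p - q + (q - p))%N
    + 2 * (\sum_(q < M) g (M - q)%N) + g 0%N.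
  have e1 : \sum_(q < M) g (q - M + (M - q))%N = \sum_(q < M) g (M - q)%N.
    by apply: eq_bigr => q _; congr (g _); have := ltn_ord q; lia.
  have e2 : \sum_(q < M) g (M - q + (q - M))%N = \sum_(q < M) g (M - q)%N.
    by apply: eq_bigr => q _; congr (g _); have := ltn_ord q; lia.
  rewrite big_ord_recr /=.
  under eq_bigr => p _ do rewrite big_ord_recr /=.
  rewrite big_split /= e1 big_ord_recr /= e2 subnn addn0.
  by ring.
rewrite IH row.
have -> : \sum_(1 <= j < M.+1) (M.+1 - j)%N%:R * g j =
    \sum_(1 <= j < M) (M - j)%N%:R * g j + \sum_(1 <= j < M.+1) g j.
  rewrite [X in _ = X + _](_ : _ = \sum_(1 <= j < M.+1) (M - j)%N%:R * g j); last first.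
    case: M {IH row} => [|M]; first by rewrite !big_geq.
    by rewrite [RHS]big_nat_recr //= subnn mul0r addr0.
  rewrite -big_split /= big_nat_cond [RHS]big_nat_cond; apply: eq_bigr => j.
  move=> /andP[/andP[j1 jM] _].
  by rewrite subSn // -natr1; ring.
by rewrite -natr1; ring.
Qed.

(** The Fejer kernel with period 1 and mean 1, as a cosine series. *)
Definition fejer (R : realType) (M : nat) (t : R) : R :=
  1 + 2 / M%:R * \sum_(1 <= j < M) (M - j)%N%:R * cos (2 * pi * j%:R * t).

(** The Fejer kernel is a squared modulus, here the sum of the squares of the
    real and imaginary parts; sin is written as a shifted cos. *)
Lemma fejerE (R : realType) (M : nat) (t : R) : (0 < M)%N ->
  M%:R * fejer M t =
  (\sum_(p < M) cos (0 + p%:R * (2 * pi * t))) ^+ 2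
  + (\sum_(p < M) cos (- (pi / 2) + p%:R * (2 * pi * t))) ^+ 2.
Proof.
move=> M0; have Mn0 : M%:R != 0 :> R by rewrite pnatr_eq0 -lt0n.
have := sum_dist (fun j => cos (j%:R * (2 * pi * t))) M.
rewrite mul0r cos0 mulr1 => h.
have -> : M%:R * fejer M t = \sum_(p < M) \sum_(q < M)
    cos ((p - q + (q - p))%N%:R * (2 * pi * t)).
  rewrite h /fejer mulrDr mulr1; congr (_ + _).
  rewrite mulrA mulrCA divff // mulr1; congr (_ * _).
  by apply: eq_bigr => j _; congr (_ * cos _); ring.
rewrite !expr2 !mulr_suml -big_split /=; apply: eq_bigr => p _.
rewrite !mulr_sumr -big_split /=; apply: eq_bigr => q _.
rewrite !add0r !(addrC (- (pi / 2))) !cosBpihalf -cosB -mulrBl.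
have [pq|/ltnW pq] := leqP p q.
  rewrite (eqP pq) add0n natrB // -cosN; congr cos; ring.
by rewrite (eqP pq) addn0 natrB.
Qed.

Lemma fejer_ge0 (R : realType) (M : nat) (t : R) : 0 <= fejer M t.
Proof.
case: M => [|M]; first by rewrite /fejer big_geq // mulr0 addr0.
rewrite -(@pmulr_rge0 _ M.+1%:R) ?ltr0n // fejerE //.
by rewrite addr_ge0 // sqr_ge0.
Qed.

Lemma fejer_sin_le (R : realType) (M : nat) (t : R) : (0 < M)%N ->
  M%:R * fejer M t * sin (pi * t) ^+ 2 <= 2.
Proof.
move=> M0; rewrite fejerE //.
have piE : pi * t = 2 * pi * t / 2 by field.
have h0 := cos_sum_le 0 (2 * pi * t) M; have h1 := cos_sum_le (- (pi / 2)) (2 * pi * t) M.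
rewrite piE; move: h0 h1; set C := \sum_(i < M) _; set S := \sum_(i < M) _; set s := sin _.
move=> h0 h1; rewrite mulrDl -!exprMn.
have sq (x : R) : `|x| * `|s| <= 1 -> (x * s) ^+ 2 <= 1.
  by rewrite -normrM => h; rewrite -real_normK ?num_real // exprn_ile1.
by have := sq _ h0; have := sq _ h1; lra.
Qed.

(** The sum of the nontrivial Q-th roots of unity vanishes. *)
Lemma sum_cos_grid (R : realType) (Q j : nat) (t : R) : (0 < j < Q)%N ->
  \sum_(k < Q) cos (2 * pi * j%:R * (t - k%:R / Q%:R)) = 0.
Proof.
move=> /andP[j0 jQ].
have Qn0 : Q%:R != 0 :> R by rewrite pnatr_eq0 -lt0n (ltn_trans j0).
have Q0 : 0 < Q%:R :> R by rewrite ltr0n (ltn_trans j0).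
pose phi : R := - (2 * pi * j%:R / Q%:R).
have := sin_mul_cos_sum (2 * pi * j%:R * t) phi Q.
have -> : 2 * pi * j%:R * t + Q%:R * phi = 2 * pi * j%:R * t - pi *+ 2 *+ j.
  by rewrite -(mulr_natr (pi *+ 2) j) -(mulr_natr pi 2) /phi; field.
rewrite (_ : _ - _ - phi / 2 = (2 * pi * j%:R * t - phi / 2) - pi *+ 2 *+ j); last by ring.
have per (x : R) : sin (x - pi *+ 2 *+ j) = sin x.
  by rewrite -[in RHS](subrK (pi *+ 2 *+ j) x) (periodicn (@sinD2pi R)).
rewrite per subrr => /eqP; rewrite !mulf_eq0 (_ : 2 == 0 = false) ?pnatr_eq0 //=.
case/orP => /eqP h.
  exfalso; move: h; rewrite (_ : phi / 2 = - (pi * (j%:R / Q%:R))); last by rewrite /phi; field.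
  rewrite sinN => /eqP; rewrite oppr_eq0 gt_eqF // sin_gt0_pi //.
  apply/andP; split; first by rewrite mulr_gt0 ?pi_gt0 // divr_gt0 // ltr0n.
  by rewrite gtr_pMr ?pi_gt0 // ltr_pdivrMr // mul1r ltr_nat.
rewrite -[RHS]h; apply: eq_bigr => k _; congr cos; rewrite /phi; field.
by [].
Qed.

(** The translates of the Fejer kernel along a grid finer than its degree form a
    partition of unity, up to normalisation. *)
Lemma sum_fejer_grid (R : realType) (M : nat) (t : R) : (0 < M)%N ->
  \sum_(k < 2 * M) fejer M (t - k%:R / (2 * M)%:R) = (2 * M)%:R.
Proof.
move=> M0; rewrite /fejer big_split /= sumr_const card_ord -[X in X + _]mulr_natr mul1r.
rewrite -mulr_sumr exchange_big /= big_nat_cond big1 ?mulr0 ?addr0 // => j.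
move=> /andP[/andP[j0 jM] _]; rewrite -mulr_sumr sum_cos_grid ?mulr0 //.
by rewrite j0 /=; lia.
Qed.

(** With y = x / 2, the mean value theorem gives sin y >= y cos y, whence
    sin x >= 2 y cos^2 y = x (1 + cos x) / 2. *)
Lemma sin_ge_half (R : realType) (x : R) : 0 <= x <= pi / 2 -> x / 2 <= sin x.
Proof.
move=> /andP[x0 x1]; pose y := x / 2.
have y0 : 0 <= y by rewrite divr_ge0.
have ypi : y <= pi / 2 by rewrite /y; lra.
have pi0 := pi_gt0 R.
have xE : x = y *+ 2 by rewrite -(mulr_natr y 2) /y; field.
have siny : y * cos y <= sin y.
  have cs : ({within `[0, y], continuous (@sin R)})%classic.
    exact/continuous_subspaceT/continuous_sin.
  have [z] := MVT_segment y0 (fun z _ => is_derive_sin z) cs.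
  rewrite in_itv /= sin0 !subr0 => /andP[z0 zy] ->.
  rewrite mulrC ler_wpM2r //.
  have zI : z \in `[0, pi] by rewrite in_itv /=; apply/andP; split; lra.
  have yI : y \in `[0, pi] by rewrite in_itv /=; apply/andP; split; lra.
  by rewrite leNgt ltr_cos // -leNgt.
have cosy : 0 <= cos y by apply: cos_ge0_pihalf; rewrite ypi andbT; lra.
have cosx : 0 <= cos x by apply: cos_ge0_pihalf; rewrite x1 andbT; lra.
have := cos_mulr2n y; rewrite -xE => cx.
have : y * cos y ^+ 2 <= cos y * sin y.
  by rewrite expr2 mulrA [leRHS]mulrC ler_wpM2r.
have := sin_mulr2n y; rewrite -xE => -> h.
have : 0 <= y * cos x by rewrite mulr_ge0.
by rewrite -/y -(mulr_natr (_ * _) 2); move: cx; rewrite -(mulr_natr (_ ^+ 2) 2); nra.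
Qed.

Lemma norm_sin_pi_int (R : realType) (x : R) (m : int) :
  `|sin (pi * (x + m%:~R))| = `|sin (pi * x)|.
Proof.
have nat_shift (n : nat) (y : R) : `|sin (pi * (y + n%:R))| = `|sin (pi * y)|.
  elim: n => [|n IH]; first by rewrite addr0.
  by rewrite -natr1 addrA mulrDr mulr1 sinDpi normrN.
case: m => n; first exact: nat_shift.
by rewrite NegzE mulrNz -(nat_shift n.+1 (x - _)) subrK.
Qed.

Lemma sin_pi_ge (R : realType) (r v : R) :
  (forall m : int, r <= `|v - m%:~R|) -> r <= `|sin (pi * v)|.
Proof.
move=> hr; have pi0 := pi_gt0 R; have pi2 := pi_ge2 R.
pose m := Num.floor v.
have /andP[m1 m2] := floor_itv v.
rewrite -(subrK m%:~R v) norm_sin_pi_int; set y := v - _.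
have y0 : 0 <= y by rewrite subr_ge0.
have y1 : y < 1 by rewrite ltrBlDl; move: m2; rewrite intrD.
have half (u : R) : 0 <= u -> u <= 2^-1 -> u <= `|sin (pi * u)|.
  move=> u0 u1; apply: le_trans (ler_norm _); apply: le_trans (sin_ge_half _).
    by have := ler_wpM2r u0 pi2; lra.
  by rewrite mulr_ge0 ?(ltW pi0) //= ler_wpM2l // ltW.
have [yh|yh] := leP y 2^-1.
  by apply: le_trans (half _ y0 yh); apply: le_trans (hr m) _; rewrite ger0_norm.
rewrite (_ : sin (pi * y) = sin (pi * (1 - y))); last first.
  rewrite (_ : pi * (1 - y) = pi - pi * y); last by ring.
  by rewrite sinB sinpi cospi mul0r sub0r mulN1r opprK.
apply: le_trans (half _ _ _); [|lra|lra].
have := hr (m + 1); rewrite intrD.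
rewrite (_ : v - _ = - (1 - y)); last by rewrite /y /=; ring.
by rewrite normrN ger0_norm //; lra.
Qed.

Lemma fejer_le (R : realType) (M : nat) (r v : R) : (0 < M)%N -> 0 < r ->
  (forall m : int, r <= `|v - m%:~R|) -> fejer M v <= 2 / (M%:R * r ^+ 2).
Proof.
move=> M0 r0 hr; have MR : 0 < M%:R :> R by rewrite ltr0n.
rewrite ler_pdivlMr ?mulr_gt0 ?exprn_gt0 //.
apply: le_trans (fejer_sin_le v M0).
rewrite (_ : fejer M v * _ = M%:R * fejer M v * r ^+ 2); last by ring.
rewrite ler_wpM2l ?mulr_ge0 ?fejer_ge0 // -[leRHS]real_normK ?num_real //.
by rewrite lerXn2r ?nnegrE ?(ltW r0) // sin_pi_ge.
Qed.

(** The partition of unity by Fejer kernels, restricted to the grid points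
    within a / (2 M) of 0: a smoothed indicator of that interval modulo 1. *)
Definition smooth (R : realType) (M a : nat) (t : R) : R :=
  (2 * M)%:R^-1 * \sum_(i < (2 * a).+1) fejer M (t - (i%:R - a%:R) / (2 * M)%:R).

Lemma smooth_ge0 (R : realType) (M a : nat) (t : R) : 0 <= smooth M a t.
Proof.
rewrite mulr_ge0 ?invr_ge0 //; apply: sumr_ge0 => i _; exact: fejer_ge0.
Qed.

(** The remaining grid points, which are those away from 0 modulo 1, make up the
    complement to 1. *)
Lemma smooth_compl (R : realType) (M a : nat) (t : R) :
  (0 < M)%N -> ((2 * a).+1 <= 2 * M)%N ->
  1 - smooth M a t = (2 * M)%:R^-1 *
    \sum_((2 * a).+1 <= i < 2 * M) fejer M (t - (i%:R - a%:R) / (2 * M)%:R).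
Proof.
move=> M0 aM; have Mn0 : (2 * M)%:R != 0 :> R by rewrite pnatr_eq0 muln_eq0 -lt0n.
have := sum_fejer_grid (t + a%:R / (2 * M)%:R) M0.
rewrite (eq_bigr (fun i : 'I_(2 * M) => fejer M (t - (i%:R - a%:R) / (2 * M)%:R))); last first.
  by move=> i _; congr fejer; ring.
rewrite -(big_mkord xpredT (fun i => fejer M (t - (i%:R - a%:R) / (2 * M)%:R))).
rewrite (big_cat_nat _ aM) //= big_mkord => h.
apply: (mulfI Mn0); rewrite mulrBr mulr1 /smooth !mulrA divff // !mul1r -[X in X - _]h.
by rewrite addrAC subrr add0r.
Qed.

Lemma smooth_far (R : realType) (M a : nat) (r t : R) :
  (0 < M)%N -> ((2 * a).+1 <= 2 * M)%N -> 0 < r ->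
  (forall m : int, a%:R / (2 * M)%:R + r <= `|t - m%:~R|) ->
  smooth M a t <= 2 / (M%:R * r ^+ 2).
Proof.
move=> M0 aM r0 tr; have MR : 0 < (2 * M)%:R :> R by rewrite ltr0n muln_gt0.
have B0 : 0 <= 2 / (M%:R * r ^+ 2) :> R.
  by rewrite divr_ge0 // mulr_ge0 // exprn_ge0 // ltW.
rewrite ler_pdivrMl //.
apply: (@le_trans _ _ (\sum_(i < (2 * a).+1) 2 / (M%:R * r ^+ 2))); last first.
  rewrite sumr_const card_ord -[leLHS]mulr_natl ler_wpM2r // ler_nat //.
apply: ler_sum => i _; apply: fejer_le => // m.
have ia : `|(i%:R - a%:R) / (2 * M)%:R| <= a%:R / (2 * M)%:R :> R.
  rewrite normrM [X in _ * X]ger0_norm ?invr_ge0 ?(ltW MR) // ler_pM2r ?invr_gt0 //.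
  have : (i%:R : R) <= (2 * a)%N%:R by rewrite ler_nat -ltnS.
  by rewrite natrM ler_norml => h; have : 0 <= i%:R :> R by []; lra.
have := tr m; have := ler_distD ((i%:R - a%:R) / (2 * M)%:R) (t - m%:~R) 0.
rewrite !subr0 (addrAC t) => h1 h2; lra.
Qed.

Lemma smooth_near (R : realType) (M a : nat) (r t : R) (m0 : int) :
  (0 < M)%N -> ((2 * a).+1 <= 2 * M)%N -> 0 < r ->
  `|t - m0%:~R| <= a%:R / (2 * M)%:R - r ->
  1 - 2 / (M%:R * r ^+ 2) <= smooth M a t.
Proof.
move=> M0 aM r0 tr; have MR : 0 < (2 * M)%:R :> R by rewrite ltr0n muln_gt0.
have B0 : 0 <= 2 / (M%:R * r ^+ 2) :> R.
  by rewrite divr_ge0 // mulr_ge0 // exprn_ge0 // ltW.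
suff : 1 - smooth M a t <= 2 / (M%:R * r ^+ 2) by lra.
rewrite smooth_compl // ler_pdivrMl //.
apply: (@le_trans _ _ (\sum_((2 * a).+1 <= i < 2 * M) 2 / (M%:R * r ^+ 2))); last first.
  by rewrite sumr_const_nat -[leLHS]mulr_natl ler_wpM2r // ler_nat leq_subr.
rewrite big_nat_cond [leRHS]big_nat_cond; apply: ler_sum => i /andP[/andP[ia iM] _].
apply: fejer_le => // m.
set y := (i%:R - a%:R) / (2 * M)%:R.
have y1 : a%:R / (2 * M)%:R <= y.
  rewrite /y ler_pM2r ?invr_gt0 //.
  have : ((2 * a)%N%:R : R) <= i%:R by rewrite ler_nat ltnW.
  by rewrite natrM; lra.
have y2 : y <= 1 - a%:R / (2 * M)%:R.
  rewrite /y mulrBl lerD2r ler_pdivrMr // mul1r ler_nat ltnW //.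
have {}tr := tr; rewrite ler_norml in tr; case/andP: tr => t1 t2.
rewrite ler_normr.
have [h|h] := leP (m + 1) m0.
  have : (m + 1)%:~R <= m0%:~R :> R by rewrite ler_int.
  rewrite intrD => h'; apply/orP; left; rewrite /=; lra.
have : m0 <= m by lia.
rewrite -(ler_int R) => h'; apply/orP; right; lra.
Qed.

Definition smooth_coef (R : realType) (M a j : nat) : R :=
  (2 * M)%:R^-1 * (2 / M%:R) * (M - j)%N%:R *
  dirichlet a (2 * pi * j%:R / (2 * M)%:R).

Lemma smoothE (R : realType) (M a : nat) (t : R) : (0 < M)%N ->
  smooth M a t = (2 * a).+1%:R / (2 * M)%:R +
    \sum_(1 <= j < M) smooth_coef R M a j * cos (2 * pi * j%:R * t).
Proof.
move=> M0; rewrite /smooth /fejer big_split /= sumr_const card_ord mulrDr.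
rewrite mulrC; congr (_ + _).
rewrite -mulr_sumr exchange_big /= !mulr_sumr; apply: eq_bigr => j _.
rewrite -mulr_sumr /smooth_coef.
have -> : \sum_(i < (2 * a).+1) cos (2 * pi * j%:R * (t - (i%:R - a%:R) / (2 * M)%:R)) =
    cos (2 * pi * j%:R * t) * dirichlet a (2 * pi * j%:R / (2 * M)%:R).
  rewrite -cos_shift_sum; apply: eq_bigr => i _; congr cos; ring.
ring.
Qed.

(** The first bound is the trivial one for the Dirichlet kernel, the second its
    decay; they are what remains of the Fourier coefficients of an interval. *)
Lemma smooth_coef_le (R : realType) (M a j : nat) : (0 < M)%N -> (j <= M)%N ->
  `|smooth_coef R M a j| * M%:R <= (2 * a).+1%:R /\ `|smooth_coef R M a j| * j%:R <= 2.
Proof.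
move=> M0 jM; have MR : 0 < M%:R :> R by rewrite ltr0n.
have Mn0 : M%:R != 0 :> R by rewrite gt_eqF.
have [d1 d2] := norm_dirichlet_le a (2 * pi * j%:R / (2 * M)%:R : R).
rewrite /smooth_coef; set D := dirichlet _ _ in d1 d2 *.
have coef : `|(2 * M)%:R^-1 * (2 / M%:R) * (M - j)%N%:R * D| <= M%:R^-1 * `|D|.
  rewrite normrM ler_wpM2r // ger0_norm; last by rewrite !mulr_ge0 ?invr_ge0.
  rewrite natrM (_ : _ * _ * _ = M%:R^-1 * ((M - j)%N%:R / M%:R)); last by field.
  by rewrite ler_piMr ?invr_ge0 // ler_pdivrMr // mul1r ler_nat leq_subr.
have sinj : j%:R / (2 * M)%:R <= `|sin (2 * pi * j%:R / (2 * M)%:R / 2)| :> R.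
  rewrite (_ : _ / 2 = pi * (j%:R / (2 * M)%:R)); last first.
    by rewrite natrM; field.
  apply: sin_pi_ge => m; set v := _ / _.
  have v0 : 0 <= v by rewrite divr_ge0.
  have v1 : v <= 2^-1.
    rewrite /v ler_pdivrMr ?ltr0n ?muln_gt0 // natrM mulrA mulVf ?pnatr_eq0 // mul1r.
    by rewrite ler_nat.
  rewrite ler_normr; have [m0|m0] := leP m 0.
    have : m%:~R <= 0 :> R by rewrite -[0]/(0%:~R) ler_int.
    by move=> h; apply/orP; left; lra.
  have : 1 <= m%:~R :> R by rewrite -[1]/(1%:~R) ler_int.
  by move=> h; apply/orP; right; lra.
split.
  apply: le_trans (ler_wpM2r (ltW MR) coef) _.
  by rewrite mulrAC mulVf // mul1r.
apply: le_trans (ler_wpM2r (ler0n _ j) coef) _.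
have : `|D| * (j%:R / (2 * M)%:R) <= 1.
  by apply: le_trans d2; rewrite ler_wpM2l.
rewrite mulrA ler_pdivrMr ?ltr0n ?muln_gt0 // mul1r natrM => h.
by rewrite -mulrA ler_pdivrMl // (mulrC M%:R).
Qed.

(** * Mean squares of cosine sums *)

(** The case th = 0 keeps this a primitive of x |-> cos (th x) for every th. *)
Definition cos_primitive (R : realType) (th x : R) : R :=
  if th == 0 then x else th^-1 * sin (th * x).

Lemma is_derive_mull (R : realType) (k x : R) : is_derive x 1 (fun y : R => k * y) k.
Proof.
rewrite (_ : (fun y : R => k * y) = k *: id); last by apply/funext.
by apply: is_derive_eq; rewrite /GRing.scale /= mulr1.
Qed.

Lemma is_derive_cos_primitive (R : realType) (th x : R) :
  is_derive x 1 (cos_primitive th) (cos (th * x)).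
Proof.
rewrite /cos_primitive; have [->|th0] := eqVneq th 0.
  by rewrite mul0r cos0; exact: is_derive_id.
rewrite (_ : (fun y => th^-1 * sin (th * y)) = th^-1 *: (@sin R \o (fun y => th * y))); last first.
  by apply/funext.
have h := is_derive_mull th x.
apply: is_derive_eq; rewrite /GRing.scale /= mulrCA.
by rewrite mulVf // mulr1.
Qed.

Lemma is_derive_seq_sum (R : realType) (T : Type) (r : seq T) (f df : T -> R -> R) (x : R) :
  (forall s, is_derive x 1 (f s) (df s x)) ->
  is_derive x 1 (fun y => \sum_(s <- r) f s y) (\sum_(s <- r) df s x).
Proof.
move=> h; elim: r => [|s r IH].
  rewrite big_nil (_ : (fun y => _) = cst 0); first exact: is_derive_cst.
  by apply/funext => y; rewrite big_nil.
rewrite big_cons (_ : (fun y => _) = f s + (fun y => \sum_(s <- r) f s y)).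
  exact: is_deriveD.
by apply/funext => y; rewrite big_cons.
Qed.

Lemma is_derive_scale (R : realType) (k x df : R) (f : R -> R) :
  is_derive x 1 f df -> is_derive x 1 (fun y => k * f y) (k * df).
Proof. by move=> h; rewrite (_ : (fun y => _) = k *: f) //; exact: is_deriveZ. Qed.

Lemma is_derive_add (R : realType) (x df dg : R) (f g : R -> R) :
  is_derive x 1 f df -> is_derive x 1 g dg ->
  is_derive x 1 (fun y => f y + g y) (df + dg).
Proof. by move=> hf hg; rewrite (_ : (fun y => _) = f + g) //; exact: is_deriveD. Qed.

(** A primitive of x |-> cos (th x) (1 + cos (eta x)). *)
Definition window_primitive (R : realType) (eta th x : R) : R :=
  cos_primitive th x
  + 2^-1 * (cos_primitive (th + eta) x + cos_primitive (th - eta) x).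

Lemma is_derive_window_primitive (R : realType) (eta th x : R) :
  is_derive x 1 (window_primitive eta th) (cos (th * x) * (1 + cos (eta * x))).
Proof.
have -> : cos (th * x) * (1 + cos (eta * x)) =
   cos (th * x) + 2^-1 * (cos ((th + eta) * x) + cos ((th - eta) * x)).
  by rewrite mulrDl mulrBl cosD cosB; field.
apply: is_derive_add; first exact: is_derive_cos_primitive.
apply: is_derive_scale; apply: is_derive_add; exact: is_derive_cos_primitive.
Qed.

Lemma norm_sin_le (R : realType) (x : R) : `|sin x| <= `|x|.
Proof.
wlog x0 : x / 0 <= x.
  move=> h; have [/h //|/ltW x0] := leP 0 x.
  by rewrite -normrN -sinN -[leRHS]normrN; apply: h; rewrite oppr_ge0.
have cs : ({within `[0, x], continuous (@sin R)})%classic.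
  exact/continuous_subspaceT/continuous_sin.
have [z _] := MVT_segment x0 (fun z _ => is_derive_sin z) cs.
rewrite sin0 !subr0 => ->; rewrite normrM ler_piMl //; exact: cos_max.
Qed.

Lemma cos_primitive_odd (R : realType) (th x : R) :
  cos_primitive th (- x) = - cos_primitive th x.
Proof. by rewrite /cos_primitive; case: ifP => // _; rewrite mulrN sinN mulrN. Qed.

Lemma norm_cos_primitive_le (R : realType) (th x : R) : 0 <= x ->
  `|cos_primitive th x| <= x.
Proof.
move=> x0; rewrite /cos_primitive; have [_|th0] := eqVneq th 0.
  by rewrite ger0_norm.
rewrite normrM normfV ler_pdivrMl ?normr_gt0 //.
by apply: le_trans (norm_sin_le _) _; rewrite normrM (ger0_norm x0).
Qed.

(** At the end points pi lam of the window, the three frequencies th and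
    th +- 1 / lam give sines that agree up to sign, and the combination
    1 / th - 1 / (2 (th + eta)) - 1 / (2 (th - eta)) decays like the third power
    of th. *)
Lemma window_transform_le (R : realType) (lam th : R) : 1 <= lam ->
  `|window_primitive lam^-1 th (pi * lam) - window_primitive lam^-1 th (- (pi * lam))|
  <= 20 * (pi * lam) * (1 + th ^+ 2)^-1.
Proof.
move=> lam1; have lam0 : 0 < lam by lra.
have pi0 := pi_gt0 R; have pi2 := pi_ge2 R.
have L0 : 0 < pi * lam by rewrite mulr_gt0.
have L1 : 1 <= pi * lam by rewrite mulr_ege1 //; lra.
have D0 : 0 < 1 + th ^+ 2 by have := sqr_ge0 th; lra.
set eta := lam^-1.
have eta0 : 0 < eta by rewrite invr_gt0.
have eta1 : eta <= 1 by rewrite invf_le1.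
have -> : window_primitive eta th (pi * lam) - window_primitive eta th (- (pi * lam)) =
   2 * window_primitive eta th (pi * lam).
  by rewrite /window_primitive !cos_primitive_odd; field.
rewrite normrM (ger0_norm (ler0n _ 2)) /window_primitive.
have [small|big] := leP (th ^+ 2) 4.
  have := norm_cos_primitive_le th (ltW L0).
  have := norm_cos_primitive_le (th + eta) (ltW L0).
  have := norm_cos_primitive_le (th - eta) (ltW L0).
  set p1 := cos_primitive _ _; set p2 := cos_primitive _ _; set p3 := cos_primitive _ _.
  rewrite !ler_norml => /andP[a1 a2] /andP[b1 b2] /andP[c1 c2].
  apply: (@le_trans _ _ (4 * (pi * lam))).
    suff : `|p3 + 2^-1 * (p2 + p1)| <= 2 * (pi * lam) by lra.
    by rewrite ler_norml; apply/andP; split; lra.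
  rewrite ler_pdivlMr //; have := ler_wpM2l (ltW L0) small; lra.
have th0 : th != 0 by apply: contraTneq big => ->; rewrite expr0n /= -leNgt.
have e2 : eta ^+ 2 <= 1 by rewrite exprn_ile1 // ltW.
have thp : th + eta != 0.
  by apply: contraTneq big => h; rewrite (_ : th = - eta); [|lra]; rewrite sqrrN -leNgt; lra.
have thm : th - eta != 0.
  by apply: contraTneq big => h; rewrite (_ : th = eta); [|lra]; rewrite -leNgt; lra.
rewrite /cos_primitive (negbTE th0) (negbTE thp) (negbTE thm).
have etaL : eta * (pi * lam) = pi by rewrite /eta mulrCA mulVf ?mulr1 // gt_eqF.
have -> : sin ((th + eta) * (pi * lam)) = - sin (th * (pi * lam)).
  by rewrite mulrDl etaL sinDpi.
have -> : sin ((th - eta) * (pi * lam)) = - sin (th * (pi * lam)).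
  by rewrite mulrBl etaL -[in RHS](subrK pi (th * _)) sinDpi opprK.
set s := sin _.
have -> : th^-1 * s + 2^-1 * ((th + eta)^-1 * - s + (th - eta)^-1 * - s) =
   - s * eta ^+ 2 / (th * ((th + eta) * (th - eta))).
  by field; rewrite th0 thp thm.
have -> : (th + eta) * (th - eta) = th ^+ 2 - eta ^+ 2 by ring.
have pos : 3 <= th ^+ 2 - eta ^+ 2 by lra.
rewrite normrM normfV (normrM (- s)) (normrM th) normrN.
have th1 : 1 <= `|th|.
  rewrite -(@ler_pXn2r _ 2) ?nnegrE // expr1n real_normK ?num_real //; lra.
rewrite (ger0_norm (_ : 0 <= th ^+ 2 - eta ^+ 2)); last by lra.
have s1 : `|s| <= 1 by exact: sin_max.
have den : 2 * (1 + th ^+ 2) <= 5 * (`|th| * (th ^+ 2 - eta ^+ 2)).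
  have g : 0 <= th ^+ 2 - eta ^+ 2 by lra.
  by have := ler_wpM2r g th1; lra.
have den0 : 0 < `|th| * (th ^+ 2 - eta ^+ 2) by rewrite mulr_gt0 //; lra.
have num : `|s| * `|eta ^+ 2| <= 1.
  rewrite (ger0_norm (exprn_ge0 2 (ltW eta0))) -[leRHS]mulr1.
  by apply: ler_pM => //; rewrite exprn_ge0 // ltW.
rewrite mulrA ler_pdivrMr // mulrAC ler_pdivlMr //.
have a1 : 2 * (`|s| * `|eta ^+ 2|) * (1 + th ^+ 2) <= 2 * (1 + th ^+ 2).
  by rewrite ler_wpM2r ?(ltW D0) //; lra.
apply: (le_trans a1); apply: (le_trans den).
by apply: ler_wpM2r; [exact: ltW|lra].
Qed.

(** Expanding the square produces the frequencies p s - p u and p s + p u; as the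
    p s are nonnegative, the latter are at least as large as the former in absolute
    value. *)
Lemma cos_sum_L2 (R : realType) (S : eqType) (r : seq S) (a p : S -> R) (lam : R) :
  1 <= lam -> (forall s, s \in r -> 0 <= p s) ->
  (\int[lebesgue_measure]_(x in `[(- lam)%R, lam]%classic)
     ((\sum_(s <- r) a s * cos (2 * pi * p s * x)) ^+ 2)%R%:E <=
  (20 * (pi * lam) * \sum_(s <- r) \sum_(u <- r)
     `|a s| * `|a u| * (1 + (p s - p u) ^+ 2)^-1)%R%:E)%E.
Proof.
move=> lam1 p0; have pi0 := pi_gt0 R; have pi2 := pi_ge2 R.
have lam0 : 0 < lam by lra.
pose th s := 2 * pi * p s.
pose V x := \sum_(s <- r) a s * cos (th s * x).
pose w x : R := 1 + cos (lam^-1 * x).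
pose L := pi * lam.
have lamL : lam <= L / 2.
  by rewrite /L ler_pdivlMr // mulrC ler_wpM2r // ltW.
have L0 : 0 < L by rewrite mulr_gt0.
pose Phi x := \sum_(s <- r) \sum_(u <- r) a s * a u / 2 *
  (window_primitive lam^-1 (th s - th u) x + window_primitive lam^-1 (th s + th u) x).
have dPhi (x : R) : is_derive x 1 Phi (V x ^+ 2 * w x).
  have -> : V x ^+ 2 * w x = \sum_(s <- r) \sum_(u <- r) a s * a u / 2 *
     (cos ((th s - th u) * x) * (1 + cos (lam^-1 * x))
      + cos ((th s + th u) * x) * (1 + cos (lam^-1 * x))).
    rewrite expr2 {1}/V mulr_suml mulr_suml; apply: eq_bigr => s _.
    rewrite /V mulr_sumr mulr_suml; apply: eq_bigr => u _.
    by rewrite mulrBl mulrDl cosB cosD /w; field.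
  apply: (@is_derive_seq_sum _ _ _ (fun s y => \sum_(u <- r) a s * a u / 2 *
    (window_primitive lam^-1 (th s - th u) y + window_primitive lam^-1 (th s + th u) y))
    (fun s x => \sum_(u <- r) a s * a u / 2 *
     (cos ((th s - th u) * x) * (1 + cos (lam^-1 * x))
      + cos ((th s + th u) * x) * (1 + cos (lam^-1 * x))))) => s.
  apply: (@is_derive_seq_sum _ _ _ (fun u y => a s * a u / 2 *
    (window_primitive lam^-1 (th s - th u) y + window_primitive lam^-1 (th s + th u) y))
    (fun u x => a s * a u / 2 *
     (cos ((th s - th u) * x) * (1 + cos (lam^-1 * x))
      + cos ((th s + th u) * x) * (1 + cos (lam^-1 * x))))) => u.
  apply: is_derive_scale; apply: is_derive_add; exact: is_derive_window_primitive.
have ccos (k : R) : continuous (fun x : R => cos (k * x)).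
  move=> x; apply: (continuous_comp (f := fun x => k * x)); last exact: continuous_cos.
  exact: mulrl_continuous.
have cV : continuous V.
  move=> x; rewrite /V.
  elim: (r) => [|s r' IH].
    rewrite (_ : (fun y => _) = cst 0); first exact: cst_continuous.
    by apply/funext => y; rewrite big_nil.
  rewrite (_ : (fun y => _) = (fun y => a s * cos (th s * y))
      \+ (fun y => \sum_(s <- r') a s * cos (th s * y))); last first.
    by apply/funext => y; rewrite big_cons.
  apply: continuousD => //; apply: continuousM; first exact: cst_continuous.
  exact: ccos.
have cw : continuous w.
  move=> x; apply: continuousD; first exact: cst_continuous.
  exact: ccos.
have cV2 : continuous (fun x => V x ^+ 2).
  by move=> x; exact: (continuous_comp (cV x) (@exprn_continuous _ 2 (V x))).
have cVw : continuous (fun x => V x ^+ 2 * w x).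
  by move=> x; exact: (cvgM (cV2 x) (cw x)).
have w0 x : 0 <= w x by rewrite /w; have := cos_geN1 (lam^-1 * x); lra.
have V0 x : 0 <= V x ^+ 2 by exact: sqr_ge0.
have meas (f : R -> R) (D : set R) : continuous f ->
    measurable_fun D (EFin \o f).
  move=> cf; apply/measurable_EFinP; apply: measurable_funTS.
  exact: continuous_measurable_fun.
(* the window is at least 1 on [-lam, lam], so it may be inserted *)
apply: (@le_trans _ _ (\int[lebesgue_measure]_(x in `[(- L)%R, L]%classic) (V x ^+ 2 * w x)%R%:E)%E).
  apply: (@le_trans _ _ (\int[lebesgue_measure]_(x in `[(- lam)%R, lam]%classic) (V x ^+ 2 * w x)%R%:E)%E).
    apply: ge0_le_integral => //.
    - by move=> x _; rewrite lee_fin sqr_ge0.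
    - exact: meas.
    - exact: meas.
    move=> x; rewrite /= in_itv /= => /andP[x1 x2]; rewrite lee_fin ler_peMr ?sqr_ge0 //.
    rewrite /w lerDl; apply: cos_ge0_pihalf.
    have h1 : lam^-1 * x <= 1 by rewrite ler_pdivrMl // mulr1.
    have h2 : -1 <= lam^-1 * x by rewrite ler_pdivlMl // mulrN1.
    by apply/andP; split; lra.
  apply: ge0_subset_integral => //.
  - exact: meas.
  - by move=> x _; rewrite lee_fin mulr_ge0.
  move=> x; rewrite /= !in_itv /= => /andP[x1 x2]; apply/andP; split; lra.
have dPhi' (x : R) : derivable Phi x 1 by have [] := dPhi x.
have cPhi (x : R) : (Phi y @[y --> x] --> Phi x)%classic.
  by apply/differentiable_continuous/derivable1_diffP.
rewrite (@continuous_FTC2 _ _ Phi); first last.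
- by move=> x _; rewrite derive1E; have [_ ->] := dPhi x.
- split; first by move=> x _.
  + by apply: cvg_at_right_filter; exact: cPhi.
  + by apply: cvg_at_left_filter; exact: cPhi.
- exact/continuous_subspaceT.
- lra.
rewrite -EFinB lee_fin.
rewrite /Phi -sumrB mulr_sumr big_seq [leRHS]big_seq; apply: ler_sum => s sr.
rewrite -sumrB mulr_sumr big_seq [leRHS]big_seq; apply: ler_sum => u ur.
rewrite -mulrBr opprD addrACA.
have k0 : 0 <= (1 + (p s - p u) ^+ 2)^-1.
  by rewrite invr_ge0; have := sqr_ge0 (p s - p u); lra.
have kle (d : R) : (p s - p u) ^+ 2 <= d ^+ 2 ->
    `|window_primitive lam^-1 d L - window_primitive lam^-1 d (- L)| <=
    20 * L * (1 + (p s - p u) ^+ 2)^-1.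
  move=> hd; apply: le_trans (window_transform_le d lam1) _.
  have d0 := sqr_ge0 (p s - p u).
  apply: ler_wpM2l; first by rewrite -/L mulr_ge0 // ltW.
  by rewrite lef_pV2 ?posrE; lra.
have tau1 : 1 <= (2 * pi) ^+ 2 :> R by rewrite exprn_ege1 //; lra.
have b1 : `|window_primitive lam^-1 (th s - th u) L
     - window_primitive lam^-1 (th s - th u) (- L)| <= 20 * L * (1 + (p s - p u) ^+ 2)^-1.
  apply: kle; rewrite /th -mulrBr exprMn ler_peMl ?sqr_ge0 //.
have b2 : `|window_primitive lam^-1 (th s + th u) L
     - window_primitive lam^-1 (th s + th u) (- L)| <= 20 * L * (1 + (p s - p u) ^+ 2)^-1.
  apply: kle; rewrite /th -mulrDr exprMn.
  apply: (@le_trans _ _ ((p s + p u) ^+ 2)); last by rewrite ler_peMl ?sqr_ge0.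
  by have := mulr_ge0 (p0 _ sr) (p0 _ ur); lra.
move: b1 b2; set T1 := _ - _; set T2 := _ - _; set k := (_ + _)^-1 in k0 *.
move=> b1 b2; apply: le_trans (ler_norm _) _; rewrite normrM normrM normrM.
rewrite (ger0_norm (_ : 0 <= 2^-1)) //
  (_ : 20 * L * _ = `|a s| * `|a u| / 2 * (2 * (20 * L * k))); last by field.
rewrite ler_wpM2l ?mulr_ge0 //; apply: le_trans (ler_normD _ _) _; lra.
Qed.

(** * Summable mean squares and almost everywhere convergence *)

(** The sum of the squares has finite integral, hence is finite almost
    everywhere, and then its terms tend to 0. *)
Lemma ae_cvg0_of_sum_L2 (R : realType) (f : nat -> R -> R) (lam C : R) :
  (forall i, continuous (f i)) ->
  (forall i, (\int[lebesgue_measure]_(x in `[(- lam)%R, lam]%classic)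
     (f i x ^+ 2)%R%:E <= (C * (1 + i%:R ^+ 2)^-1)%R%:E)%E) ->
  {ae @lebesgue_measure R, forall x, - lam <= x <= lam ->
     ((fun i => f i x) @ \oo --> (0 : R))%classic}.
Proof.
move=> cf If.
pose D := (`[(- lam)%R, lam]%classic : set R).
have mD : measurable D by exact: measurable_itv.
have mf i : measurable_fun D (EFin \o (fun x => f i x ^+ 2)).
  apply/measurable_EFinP; apply: measurable_funTS; apply: continuous_measurable_fun.
  by move=> x; exact: (continuous_comp (cf i x) (@exprn_continuous _ 2 (f i x))).
pose g x := (\sum_(0 <= i <oo) (f i x ^+ 2)%R%:E)%E.
have f0 i x : (0 <= (f i x ^+ 2)%R%:E)%E by rewrite lee_fin sqr_ge0.
have g0 x : (0 <= g x)%E by apply: nneseries_ge0.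
have mg : measurable_fun D g.
  have := @ge0_emeasurable_sum _ _ R D (fun i x => (f i x ^+ 2)%R%:E) xpredT
    (fun _ _ _ _ => f0 _ _) (fun i _ => mf i).
  by [].
have C0 : 0 <= C.
  rewrite -lee_fin; have := If 0%N; rewrite expr0n addr0 invr1 mulr1.
  by apply: le_trans; apply: integral_ge0 => x _; exact: f0.
have Ig : (\int[lebesgue_measure]_(x in D) g x <= (C * 3)%:E)%E.
  rewrite integral_nneseries //.
  apply: lime_le.
    by apply: is_cvg_nneseries => n _ _; exact: integral_ge0.
  near=> n.
  apply: (@le_trans _ _ (\sum_(0 <= i < n) (C * (1 + i%:R ^+ 2)^-1)%R%:E)%E).
    by apply: lee_sum => i _; exact: If.
  rewrite sumEFin lee_fin -mulr_sumr ler_wpM2l //; exact: sum_inv_sqr_le.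
have ig : lebesgue_measure.-integrable D g.
  apply/integrableP; split => //.
  under eq_integral => x _ do rewrite gee0_abs //.
  by apply: le_lt_trans Ig _; rewrite ltry.
have := @integrable_ae _ (measurableTypeR R) _ _ D mD g ig; apply: filterS => x xfin xI.
have {}xfin : g x \is a fin_num by apply: xfin; rewrite /D /= in_itv.
have cvs : cvgn (series (fun i => f i x ^+ 2)).
  apply: nondecreasing_is_cvgn.
    by apply: nondecreasing_series => i _ _; exact: sqr_ge0.
  exists (fine (g x)) => _ [n _ <-].
  rewrite -lee_fin fineK // /series /= -sumEFin.
  by apply: nneseries_lim_ge.
have /cvgrPdist_lt h := cvg_series_cvg_0 cvs.
apply/cvgrPdist_lt => e e0.
have := h (e ^+ 2) (exprn_gt0 2 e0); apply: filterS => i.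
rewrite !sub0r !normrN normrX => hi.
by rewrite -(@ltr_pXn2r _ 2) // nnegrE // ltW.
Unshelve. all: by end_near. Qed.

(** * Pair counts in terms of differences *)

Lemma dist_int_le (R : realType) (t : R) (m : int) : dist_int t <= `|t - m%:~R|.
Proof.
apply: ge_inf; last by exists m.
by exists 0 => _ [k _ <-].
Qed.

Lemma dist_int_lt (R : realType) (t r : R) :
  dist_int t < r -> exists m : int, `|t - m%:~R| < r.
Proof.
move=> h; have [] := @inf_lt R _ r _ h; first by exists `|t - 0%:~R|, 0.
by move=> _ [m _ <-] hm; exists m.
Qed.

Lemma dist_intN (R : realType) (t : R) : dist_int (- t) = dist_int t.
Proof.
suff le (u : R) : dist_int u <= dist_int (- u).
  by apply/eqP; rewrite eq_le le andbT; have := le (- t); rewrite opprK.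
rewrite leNgt; apply/negP => /dist_int_lt[m].
rewrite -opprD normrN -[m%:~R]opprK -mulrNz => h.
by have := dist_int_le u (- m); rewrite leNgt h.
Qed.

Definition differences (R : realType) (x : nat -> R) (N : nat) : seq R :=
  [seq x m - x n | m <- iota 0 N, n <- iota 0 m].

Lemma sum_differences (R : realType) (x : nat -> R) (N : nat) (F : R -> R) :
  \sum_(z <- differences x N) F z =
  \sum_(0 <= m < N) \sum_(0 <= n < m) F (x m - x n).
Proof.
rewrite /differences big_allpairs_dep /= /index_iota subn0.
by apply: eq_bigr => m _; rewrite subn0.
Qed.

Lemma size_differences (R : realType) (x : nat -> R) (N : nat) :
  (size (differences x N) <= N ^ 2)%N.
Proof.
rewrite -sum1_size /differences big_allpairs_dep /=.
apply: (@leq_trans (\sum_(m <- iota 0 N) N)).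
  rewrite big_seq [leqRHS]big_seq; apply: leq_sum => m; rewrite mem_iota => /andP[_ mN].
  by rewrite sum1_size size_iota ltnW.
by rewrite big_const_seq count_predT size_iota iter_addn addn0.
Qed.

Lemma gap_differences (R : realType) (x : nat -> R) (c : R) :
  0 < c -> (forall n, c <= x n.+1 - x n) ->
  forall N z, z \in differences x N -> c <= z.
Proof.
move=> c0 gap N z /allpairsPdep[m [n [_ nm ->]]].
move: nm; rewrite mem_iota /= add0n; elim: m => // m IH.
rewrite ltnS leq_eqVlt => /orP[/eqP ->|/IH h]; first exact: gap.
have := gap m; lra.
Qed.

Lemma sum_offdiag (R : realType) (G : nat -> nat -> R) (N : nat) :
  (forall p q, G p q = G q p) -> (forall p, G p p = 0) ->
  \sum_(p < N) \sum_(q < N) G p q = 2 * \sum_(0 <= p < N) \sum_(0 <= q < p) G p q.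
Proof.
move=> Gs Gd; elim: N => [|N IH]; first by rewrite big_ord0 big_geq // mulr0.
rewrite big_nat_recr //= mulrDr -IH big_ord_recr /= big_ord_recr /= Gd addr0.
under eq_bigr => p _ do rewrite big_ord_recr /=.
rewrite big_split /= -addrA; congr (_ + _).
rewrite big_mkord (eq_bigr (fun q : 'I_N => G N q)) //; ring.
Qed.

(** The distance to the nearest integer is even, so each unordered pair of
    indices counts twice. *)
Lemma pair_count_differences (R : realType) (x : nat -> R) (al s : R) (N : nat) :
  (pair_count (fun n => al * x n) s N)%:R =
  2 * \sum_(z <- differences x N) (dist_int (al * z) <= s / N%:R)%R%:R :> R.
Proof.
rewrite sum_differences.
pose G p q : R := ((p != q) && (dist_int (al * (x p - x q)) <= s / N%:R))%R%:R.
transitivity (2 * \sum_(0 <= p < N) \sum_(0 <= q < p) G p q); last first.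
  congr (_ * _); apply: eq_bigr => p _; rewrite big_nat_cond [RHS]big_nat_cond.
  by apply: eq_bigr => q /andP[/andP[_ qp] _]; rewrite /G gtn_eqF.
rewrite -sum_offdiag; first last.
- by move=> p; rewrite /G eqxx.
- by move=> p q; rewrite /G eq_sym -(opprB (x q)) mulrN dist_intN.
rewrite /pair_count -sum1_card natr_sum big_mkcond /= pair_bigA /=.
apply: eq_bigr => -[p q] _; rewrite inE /= /G mulrBr.
by case: (_ && _).
Qed.

(** The condition |(x_m - x_n) - (x_m' - x_n')| < 1 is the one defining the
    additive energy, at the quadruple (m, n, n', m'). *)
Lemma near_count_differences (R : realType) (x : nat -> R) (N : nat) :
  near_count (differences x N) (differences x N) <= (Estar x N)%:R.
Proof.
pose G m n m' n' : R := (`|x m - x n - (x m' - x n')| < 1)%R%:R.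
have G0 m n m' n' : 0 <= G m n m' n' by [].
have widen (F : nat -> nat -> R) : (forall m n, 0 <= F m n) ->
    \sum_(0 <= m < N) \sum_(0 <= n < m) F m n <= \sum_(m < N) \sum_(n < N) F m n.
  move=> F0; rewrite big_mkord; apply: ler_sum => m _.
  rewrite -(big_mkord xpredT (F m)) [leRHS](big_cat_nat (leq0n m) (ltnW (ltn_ord m))) /=.
  by rewrite lerDl; apply: sumr_ge0.
apply: (@le_trans _ _ (\sum_(m < N) \sum_(n < N) \sum_(m' < N) \sum_(n' < N) G m n m' n')).
  rewrite /near_count sum_differences.
  apply: le_trans (widen (fun m n => \sum_(q <- differences x N) (`|x m - x n - q| < 1)%R%:R) _) _.
    by move=> m n; apply: sumr_ge0.
  apply: ler_sum => m _; apply: ler_sum => n _; rewrite sum_differences.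
  exact: (widen (G m n)).
rewrite /Estar -sum1_card natr_sum [leRHS]big_mkcond /=.
rewrite pair_bigA /=.
under eq_bigr => p _ do rewrite exchange_big /=.
rewrite pair_bigA /= pair_bigA /=.
rewrite le_eqVlt; apply/orP; left; apply/eqP.
apply: eq_bigr => -[[[m n] n'] m'] _; rewrite inE /= /G.
by rewrite opprB addrA; case: ifP.
Qed.

(** * The fluctuation *)

(** The sum over the differences of the nonconstant part of the smoothed indicator
    of half-width l / (k N), times 2 / N.  The degree k N^4 is a compromise:
    large enough for the error of the smoothing to be O(1 / N^2), and polynomial
    in N so that logarithms and divisors remain negligible. *)
Definition fluctuation (R : realType) (x : nat -> R) (k l N : nat) (al : R) : R :=
  \sum_(1 <= j < k * N ^ 4) \sum_(z <- differences x N)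
    2 / N%:R * smooth_coef R (k * N ^ 4) (2 * l * N ^ 3) j * cos (2 * pi * (j%:R * z) * al).

Lemma continuous_fluctuation (R : realType) (x : nat -> R) (k l N : nat) :
  continuous (fluctuation x k l N).
Proof.
have csum (T : Type) (r : seq T) (F : T -> R -> R) :
    (forall s, continuous (F s)) -> continuous (fun y => \sum_(s <- r) F s y).
  move=> cF y; elim: r => [|s r IH].
    rewrite (_ : (fun y => _) = cst 0); first exact: cst_continuous.
    by apply/funext => t; rewrite big_nil.
  rewrite (_ : (fun y => _) = F s \+ (fun y => \sum_(s <- r) F s y)).
    by apply: continuousD => //; exact: cF.
  by apply/funext => t; rewrite big_cons.
apply: (csum _ _ _) => j; apply: (csum _ _ _) => z y.
apply: cvgM; first exact: cvg_cst.
apply: (continuous_comp (f := fun y => 2 * pi * (j%:R * z) * y)).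
  exact: mulrl_continuous.
exact: continuous_cos.
Qed.

(** [cos_sum_L2] turns the mean square into the weighted count of
    [variance_count]. *)
Lemma fluctuation_L2 (R : realType) (x : nat -> R) (c C delta : R) (k l : nat) :
  0 < c -> (forall n, c <= x n.+1 - x n) -> 0 < delta <= 4^-1 -> 0 <= C ->
  (forall N, (0 < N)%N -> (Estar x N)%:R <= C * N%:R `^ (5 / 2 - delta)) ->
  (0 < k)%N ->
  exists B : R, forall (lam : R) (N : nat), 1 <= lam -> (0 < N)%N ->
    (\int[lebesgue_measure]_(t in `[(- lam)%R, lam]%classic)
       (fluctuation x k l N t ^+ 2)%R%:E <=
     (lam * B * N%:R `^ (- (delta / 2)))%R%:E)%E.
Proof.
move=> c0 gap dlt C0 EN k0.
pose M N := (k * N ^ 4)%N; pose a N := (2 * l * N ^ 3)%N.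
have M0 N : (0 < N)%N -> (0 < M N)%N by move=> N0; rewrite muln_gt0 k0 expn_gt0 N0.
pose L N := (trunc_log 2 (M N)).+1.
pose cf N j : R := if (j < M N)%N then `|smooth_coef R (M N) (a N) j| else 0.
pose A : R := 4 * l%:R + 2.
have l0 : 0 <= l%:R :> R by [].
have Lbound N : (0 < N)%N -> (M N < 2 ^ L N)%N /\ (2 ^ L N <= 2 * M N)%N.
  move=> N0; have /andP[h1 h2] := trunc_log_bounds (isT : (1 < 2)%N) (M0 N N0).
  by split => //; rewrite /L expnS leq_mul2l h1.
have N4 N : (0 < N)%N -> N%:R ^+ 4 <= 2 ^+ L N :> R.
  move=> N0; rewrite -!natrX ler_nat; have [h _] := Lbound N N0.
  by apply: leq_trans (ltnW h); rewrite leq_pmull.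
have L4 N : (0 < N)%N -> 2 ^+ L N <= 2 * k%:R * N%:R ^+ 4 :> R.
  move=> N0; rewrite -!natrX -!natrM ler_nat; have [_ h] := Lbound N N0.
  by apply: leq_trans h _; rewrite mulnA.
have A0 : 0 <= A by rewrite /A; lra.
have cf0 N j : 0 <= cf N j by rewrite /cf; case: ifP.
have cfN N j : (0 < N)%N -> cf N j * N%:R <= A.
  move=> N0; rewrite /cf; case: ifP => [jM|_]; last by rewrite mul0r.
  have [h _] := smooth_coef_le R (a N) (M0 N N0) (ltnW jM).
  move: h; set w := `|_|; have w0 : 0 <= w by exact: normr_ge0.
  have N1 : 1 <= N%:R :> R by rewrite ler1n.
  have k1 : 1 <= k%:R :> R by rewrite ler1n.
  have N3 : 1 <= N%:R ^+ 3 :> R by rewrite exprn_ege1.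
  rewrite -natr1 /M /a !(natrX, natrM) => h.
  rewrite -(@ler_pM2r _ (N%:R ^+ 3)) ?(lt_le_trans _ N3) //.
  apply: (@le_trans _ _ (w * (k%:R * N%:R ^+ 4))).
    rewrite (_ : w * N%:R * _ = w * N%:R ^+ 4); last by ring.
    by rewrite ler_wpM2l // ler_peMl // exprn_ge0.
  apply: (le_trans h).
  have -> : A * N%:R ^+ 3 = 2 * (2 * l%:R * N%:R ^+ 3) + 2 * N%:R ^+ 3 by rewrite /A; ring.
  lra.
have cfj N j : (0 < N)%N -> cf N j * j%:R <= A.
  move=> N0; rewrite /cf; case: ifP => [jM|_]; last by rewrite mul0r.
  have [_ h] := smooth_coef_le R (a N) (M0 N N0) (ltnW jM).
  by apply: (le_trans h); rewrite /A; lra.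
have [B HB] := @variance_count R (differences x) L cf c C A (2 * k%:R) delta
  c0 (gap_differences c0 gap) (size_differences x) dlt C0
  (fun N N0 => le_trans (near_count_differences x N) (EN N N0)) N4 L4 A0 cf0 cfN cfj.
exists (80 * pi * B) => lam N lam1 N0.
have Npos : 0 < N%:R :> R by rewrite ltr0n.
have Nn0 : N%:R != 0 :> R by rewrite gt_eqF.
have pi0 := pi_gt0 R.
pose r := [seq (j, z) | j <- index_iota 1 (M N), z <- differences x N].
have z0 z : z \in differences x N -> 0 <= z.
  by move/(gap_differences c0 gap) => h; apply: le_trans h; exact: ltW.
have sumr (F : nat * R -> R) : \sum_(s <- r) F s =
    \sum_(1 <= j < M N) \sum_(z <- differences x N) F (j, z).
  by rewrite /r big_allpairs_dep.
have p0 s : s \in r -> 0 <= s.1%:R * s.2.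
  by move=> /allpairsP[[j z] /= [_ zin ->]]; rewrite mulr_ge0 // z0.
have := @cos_sum_L2 R (nat * R)%type r
  (fun s => 2 / N%:R * smooth_coef R (M N) (a N) s.1) (fun s => s.1%:R * s.2) lam lam1 p0.
under eq_integral => t _ do rewrite sumr /=.
move=> h; apply: (le_trans h); rewrite lee_fin {h}.
have S_le : \sum_(s <- r) \sum_(u <- r)
     `|2 / N%:R * smooth_coef R (M N) (a N) s.1| * `|2 / N%:R * smooth_coef R (M N) (a N) u.1| *
     (1 + (s.1%:R * s.2 - u.1%:R * u.2) ^+ 2)^-1 <=
     4 / N%:R ^+ 2 * (B * N%:R `^ (2 - delta / 2)).
  have N20 : 0 <= 4 / N%:R ^+ 2 :> R by rewrite divr_ge0 // exprn_ge0.
  apply: le_trans (ler_wpM2l N20 (HB N N0)).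
  rewrite sumr; under eq_bigr => j _ do under eq_bigr => z _ do rewrite sumr /=.
  have cfE j : j \in index_iota 1 (M N) ->
      `|2 / N%:R * smooth_coef R (M N) (a N) j| = 2 / N%:R * cf N j.
    rewrite mem_index_iota => /andP[_ jM].
    by rewrite /cf jM normrM ger0_norm // divr_ge0.
  have ext (F : nat -> R) : (forall j, 0 <= F j) ->
      \sum_(1 <= j < M N) F j <= \sum_(1 <= j < 2 ^ L N) F j.
    move=> F0; have [h _] := Lbound N N0.
    rewrite [leRHS](big_cat_nat (M0 N N0) (ltnW h)) /= lerDl.
    by apply: sumr_ge0.
  have K0 (j j' : nat) (z w : R) : 0 <= (1 + (j%:R * z - j'%:R * w) ^+ 2)^-1.
    by rewrite invr_ge0 addr_ge0 // sqr_ge0.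
  apply: (@le_trans _ _ (4 / N%:R ^+ 2 * \sum_(1 <= j < M N) \sum_(z <- differences x N)
    \sum_(1 <= j' < M N) \sum_(w <- differences x N)
    cf N j * cf N j' * (1 + (j%:R * z - j'%:R * w) ^+ 2)^-1)).
    rewrite mulr_sumr big_seq [leRHS]big_seq; apply: ler_sum => j jM.
    rewrite mulr_sumr; apply: ler_sum => z _.
    rewrite mulr_sumr big_seq [leRHS]big_seq; apply: ler_sum => j' jM'.
    rewrite mulr_sumr; apply: ler_sum => w _.
    rewrite !cfE // le_eqVlt; apply/orP; left; apply/eqP.
    by move: ((1 + _)^-1) => K; field.
  rewrite ler_wpM2l //.
  apply: le_trans (ext _ _); last first.
    move=> j; apply: sumr_ge0 => z _; apply: sumr_ge0 => j' _; apply: sumr_ge0 => w _.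
    by rewrite !mulr_ge0.
  apply: ler_sum => j _; apply: ler_sum => z _; apply: ext => j'.
  by apply: sumr_ge0 => w _; rewrite !mulr_ge0.
apply: le_trans (ler_wpM2l _ S_le) _; first by rewrite !mulr_ge0 //; lra.
have -> : N%:R `^ (2 - delta / 2) = N%:R ^+ 2 * N%:R `^ (- (delta / 2)) :> R.
  by rewrite powRD ?Nn0 ?implybT // powR_mulrn // ler0n.
set P := _ `^ _.
rewrite le_eqVlt; apply/orP; left; apply/eqP; by field.
Qed.

(** The exponent K is so large that N^(- delta / 2) <= (i + 1)^-2 along
    N = (i + 1)^K; the windows [- n, n] exhaust the line. *)
Lemma ae_fluctuation_cvg0 (R : realType) (x : nat -> R) (c C delta : R) (K k l : nat) :
  0 < c -> (forall n, c <= x n.+1 - x n) -> 0 < delta <= 4^-1 -> 0 <= C ->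
  (forall N, (0 < N)%N -> (Estar x N)%:R <= C * N%:R `^ (5 / 2 - delta)) ->
  4 / delta <= K%:R -> (0 < k)%N ->
  {ae @lebesgue_measure R, forall t,
     ((fun i : nat => fluctuation x k l (i.+1 ^ K) t) @ \oo --> (0 : R))%classic}.
Proof.
move=> c0 gap dlt C0 EN Kd k0.
have d0 : 0 < delta by case/andP: dlt.
have [B HB] := fluctuation_L2 l c0 gap dlt C0 EN k0.
have ae_lam (n : nat) : {ae @lebesgue_measure R, forall t, - n.+1%:R <= t <= n.+1%:R ->
    ((fun i : nat => fluctuation x k l (i.+1 ^ K) t) @ \oo --> (0 : R))%classic}.
  apply: (@ae_cvg0_of_sum_L2 _ _ n.+1%:R (n.+1%:R * Num.max B 0)).
    by move=> i; exact: continuous_fluctuation.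
  move=> i; have N0 : (0 < i.+1 ^ K)%N by rewrite expn_gt0.
  apply: le_trans (HB n.+1%:R _ _ N0) _; first by rewrite ler1n.
  rewrite lee_fin -!mulrA ler_wpM2l //.
  have i1 : 1 <= i.+1%:R :> R by rewrite ler1n.
  have i0 : 0 < i.+1%:R :> R by rewrite ltr0n.
  have pw : (i.+1 ^ K)%:R `^ (- (delta / 2)) <= (1 + i%:R ^+ 2)^-1 :> R.
    rewrite powRN natrX -powR_mulrn ?(ltW i0) // -powRrM.
    have s0 : 0 <= i%:R ^+ 2 :> R by exact: sqr_ge0.
    have D0 : 0 < 1 + i%:R ^+ 2 :> R by lra.
    rewrite lef_pV2 ?posrE ?powR_gt0 //.
    apply: (@le_trans _ _ (i.+1%:R `^ 2%:R)).
      rewrite powR_mulrn ?(ltW i0) // -natr1.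
      have : 0 <= i%:R :> R by []; nra.
    apply: ler_powR => //.
    by move: Kd; rewrite ler_pdivrMr // => h; lra.
  apply: (@le_trans _ _ (Num.max B 0 * (i.+1 ^ K)%:R `^ (- (delta / 2)))).
    by rewrite ler_wpM2r ?powR_ge0 // le_max lexx.
  by rewrite ler_wpM2l // le_max lexx orbT.
have := ae_foralln ae_lam; apply: filterS => t h.
pose n := Num.truncn `|t|.
have /andP[_ tn] := truncn_itv (normr_ge0 t).
by apply: (h n); move: tn; rewrite ltr_norml => /andP[/ltW-> /ltW->].
Qed.

(** * From the fluctuation to the pair correlation *)

Lemma double_size_differences (R : realType) (x : nat -> R) (N : nat) :
  2 * (size (differences x N))%:R = N%:R * (N%:R - 1) :> R.
Proof.
have -> : (size (differences x N))%:R = \sum_(0 <= m < N) m%:R :> R.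
  have := sum_const_seq (differences x N) (1 : R); rewrite mulr1 => <-.
  rewrite (sum_differences x N (fun=> 1)); apply: eq_bigr => m _.
  by rewrite sumr_const_nat subn0.
elim: N => [|N IH]; first by rewrite big_geq // mulr0 mul0r.
by rewrite big_nat_recr //= mulrDr IH -natr1; ring.
Qed.

(** What the constant coefficient of the smoothed indicator contributes. *)
Definition mean_level (R : realType) (k l N : nat) : R :=
  (N%:R - 1) * ((2 * (2 * l * N ^ 3)).+1%:R / (2 * (k * N ^ 4))%:R).

Lemma sum_smooth (R : realType) (x : nat -> R) (al : R) (k l N : nat) :
  (0 < k)%N -> (0 < N)%N ->
  2 * \sum_(z <- differences x N) smooth (k * N ^ 4) (2 * l * N ^ 3) (al * z) =
  N%:R * (mean_level R k l N + fluctuation x k l N al).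
Proof.
move=> k0 N0; have Nn0 : N%:R != 0 :> R by rewrite pnatr_eq0 -lt0n.
have M0 : (0 < k * N ^ 4)%N by rewrite muln_gt0 k0 expn_gt0 N0.
under eq_bigr => z _ do rewrite smoothE //.
rewrite big_split /= sum_const_seq [LHS]mulrDr [RHS]mulrDr; congr (_ + _).
  by rewrite [LHS]mulrA double_size_differences /mean_level [RHS]mulrA.
rewrite exchange_big /= /fluctuation !mulr_sumr; apply: eq_bigr => j _.
rewrite !mulr_sumr; apply: eq_bigr => z _.
rewrite (_ : 2 * pi * j%:R * (al * z) = 2 * pi * (j%:R * z) * al); last by ring.
by set w := cos _; field.
Qed.

Lemma window_fits (k l N : nat) : (0 < k)%N -> (2 * l < N)%N ->
  ((2 * (2 * l * N ^ 3)).+1 <= 2 * (k * N ^ 4))%N.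
Proof.
move=> k0 lN; have N3 : (0 < N ^ 3)%N by rewrite expn_gt0; lia.
apply: (@leq_trans (2 * N ^ 4)); last by rewrite leq_mul2l leq_pmull.
have : (2 * (2 * l).+1 * N ^ 3 <= 2 * N ^ 4)%N.
  by rewrite (expnS N 3) -mulnA !leq_mul2l /= leq_mul2r lN orbT.
lia.
Qed.

(** The margin 1 / (k N) between the radius and the half-width of [smooth] is the
    distance over which the Fejer tails are estimated. *)
Lemma count_le_smooth (R : realType) (k l N : nat) (rho t : R) :
  (0 < k)%N -> (2 * l < N)%N -> rho * (k * N)%:R < l%:R - 1 ->
  (dist_int t <= rho)%R%:R <=
  smooth (k * N ^ 4) (2 * l * N ^ 3) t + 2 * k%:R / N%:R ^+ 2.
Proof.
move=> k0 lN hr; have N0 : (0 < N)%N by lia.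
have kR : 0 < k%:R :> R by rewrite ltr0n.
have NR : 0 < N%:R :> R by rewrite ltr0n.
have kNR : 0 < (k * N)%:R :> R by rewrite ltr0n muln_gt0 k0.
have tail0 : 0 <= 2 * k%:R / N%:R ^+ 2 :> R.
  by rewrite divr_ge0 ?mulr_ge0 ?exprn_ge0 // ltW.
case: (leP (dist_int t) rho) => [tr|_]; last by rewrite addr_ge0 // smooth_ge0.
have : dist_int t < (l%:R - 1) / (k * N)%:R.
  by apply: (le_lt_trans tr); rewrite ltr_pdivlMr.
case/dist_int_lt => m hm.
have := @smooth_near R (k * N ^ 4) (2 * l * N ^ 3) (k * N)%:R^-1 t m.
have kn0 : k%:R != 0 :> R by rewrite gt_eqF.
have nn0 : N%:R != 0 :> R by rewrite gt_eqF.
have -> : 2 / ((k * N ^ 4)%:R * (k * N)%:R^-1 ^+ 2) = 2 * k%:R / N%:R ^+ 2 :> R.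
  by rewrite !(natrX, natrM); field; rewrite ?kn0 ?nn0.
move=> h; rewrite -lerBlDr; apply: h.
- by rewrite muln_gt0 k0 expn_gt0 N0.
- exact: window_fits.
- by rewrite invr_gt0.
rewrite [leRHS](_ : _ = (l%:R - 1) / (k * N)%:R); first exact: ltW.
by rewrite !(natrX, natrM); field; rewrite ?kn0 ?nn0.
Qed.

Lemma smooth_le_count (R : realType) (k l N : nat) (rho t : R) :
  (0 < k)%N -> (2 * l < N)%N -> l%:R + 1 <= rho * (k * N)%:R ->
  smooth (k * N ^ 4) (2 * l * N ^ 3) t <=
  (dist_int t <= rho)%R%:R + 2 * k%:R / N%:R ^+ 2.
Proof.
move=> k0 lN hr; have N0 : (0 < N)%N by lia.
have kR : 0 < k%:R :> R by rewrite ltr0n.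
have NR : 0 < N%:R :> R by rewrite ltr0n.
have kNR : 0 < (k * N)%:R :> R by rewrite ltr0n muln_gt0 k0.
have kn0 : k%:R != 0 :> R by rewrite gt_eqF.
have nn0 : N%:R != 0 :> R by rewrite gt_eqF.
have tail0 : 0 <= 2 * k%:R / N%:R ^+ 2 :> R.
  by rewrite divr_ge0 ?mulr_ge0 ?exprn_ge0 // ltW.
have M0 : (0 < k * N ^ 4)%N by rewrite muln_gt0 k0 expn_gt0 N0.
have aM := window_fits k0 lN.
case: (leP (dist_int t) rho) => tr.
  apply: ler_wpDr => //; rewrite -subr_ge0 smooth_compl // mulr_ge0 ?invr_ge0 //.
  by apply: sumr_ge0 => i _; exact: fejer_ge0.
rewrite add0r.
have -> : 2 * k%:R / N%:R ^+ 2 = 2 / ((k * N ^ 4)%:R * (k * N)%:R^-1 ^+ 2) :> R.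
  by rewrite !(natrX, natrM); field; rewrite ?kn0 ?nn0.
apply: smooth_far => //; first by rewrite invr_gt0.
move=> m; apply: le_trans (le_trans (ltW tr) (dist_int_le t m)).
rewrite [leLHS](_ : _ = (l%:R + 1) / (k * N)%:R); first by rewrite ler_pdivrMr.
by rewrite !(natrX, natrM); field; rewrite ?kn0 ?nn0.
Qed.

Lemma cvg_inv_pow (R : realType) (K : nat) : (0 < K)%N ->
  ((fun i : nat => ((i.+1 ^ K)%N%:R)^-1) @ \oo --> (0 : R))%classic.
Proof.
move=> K0; rewrite (_ : (fun i : nat => _) = (fun i => (harmonic i) ^+ K)); last first.
  by apply/funext => i; rewrite /harmonic /= natrX exprVn.
have e : 0 ^+ K = 0 :> R by rewrite expr0n gtn_eqF.
rewrite -[X in (_ --> X)%classic]e.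
exact: (cvg_comp _ _ (@cvg_harmonic R) (@exprn_continuous R K 0)).
Qed.

Lemma cvg_ratio_pow (R : realType) (K : nat) :
  ((fun i : nat => (i.+2 ^ K)%N%:R / (i.+1 ^ K)%N%:R) @ \oo --> (1 : R))%classic.
Proof.
rewrite (_ : (fun i : nat => _) = (fun i => (1 + harmonic i) ^+ K)); last first.
  apply/funext => i; rewrite /harmonic /= !natrX -expr_div_n; congr (_ ^+ _).
  have i0 : i.+1%:R != 0 :> R by rewrite pnatr_eq0.
  by rewrite -(natr1 i.+1) mulrDl divff // mul1r.
have e : (1 + 0) ^+ K = 1 :> R by rewrite addr0 expr1n.
rewrite -[X in (_ --> X)%classic]e.
have h : ((fun i : nat => 1 + harmonic i) @ \oo --> (1 + 0 : R))%classic.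
  by apply: cvgD; [exact: cvg_cst|exact: cvg_harmonic].
exact: (cvg_comp _ _ h (@exprn_continuous R K (1 + 0))).
Qed.

Lemma cvg_mean_level (R : realType) (K k l : nat) : (0 < K)%N -> (0 < k)%N ->
  ((fun i : nat => mean_level R k l (i.+1 ^ K)) @ \oo --> (2 * l%:R / k%:R : R))%classic.
Proof.
move=> K0 k0; have cu := @cvg_inv_pow R K K0.
have kn0 : k%:R != 0 :> R by rewrite pnatr_eq0 -lt0n.
rewrite (_ : (fun i : nat => _) = (fun i : nat =>
   (1 - ((i.+1 ^ K)%N%:R)^-1) * ((4 * l%:R + ((i.+1 ^ K)%N%:R)^-1 ^+ 3) * (2 * k%:R)^-1))); last first.
  apply/funext => i; rewrite /mean_level -natr1 !(natrX, natrM) -natrX.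
  have n0 : (i.+1 ^ K)%N%:R != 0 :> R by rewrite pnatr_eq0 expn_eq0.
  by field; rewrite ?kn0 ?n0.
have e : (1 - 0) * ((4 * l%:R + 0 ^+ 3) * (2 * k%:R)^-1) = 2 * l%:R / k%:R :> R.
  by field.
rewrite -[X in (_ --> X)%classic]e.
apply: cvgM; first by apply: cvgB; [exact: cvg_cst|exact: cu].
apply: cvgM; last exact: cvg_cst.
apply: cvgD; first exact: cvg_cst.
exact: (cvg_comp _ _ cu (@exprn_continuous R 3 0)).
Qed.

Lemma pow_bracket (K i0 N : nat) : (0 < K)%N -> (i0.+1 ^ K <= N)%N ->
  exists i, [/\ (i0 <= i)%N, (i.+1 ^ K <= N)%N & (N <= i.+2 ^ K)%N].
Proof.
move=> K0 h; have ex : exists i, (i.+1 ^ K <= N)%N by exists i0.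
have bd i : (i.+1 ^ K <= N)%N -> (i <= N)%N.
  by move=> hi; apply: leq_trans hi; apply: leq_trans (leqnSn i) _; by rewrite -[leqLHS]expn1 leq_pexp2l.
case: (ex_maxnP ex bd) => i hi imax; exists i; split => //; first exact: imax.
rewrite leqNgt; apply/negP => /ltnW /imax; lia.
Qed.

Lemma sandwich_cvg (R : realType) (x : nat -> R) (al : R) (K k l : nat) :
  (0 < K)%N -> (0 < k)%N ->
  ((fun i : nat => fluctuation x k l (i.+1 ^ K) al) @ \oo --> (0 : R))%classic ->
  let S i := mean_level R k l (i.+1 ^ K) + fluctuation x k l (i.+1 ^ K) al in
  let u i := ((i.+1 ^ K)%N%:R)^-1 : R in
  ((fun i : nat => S i + 2 * k%:R * u i) @ \oo --> (2 * l%:R / k%:R : R))%classic /\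
  ((fun i : nat => S i - 2 * k%:R * u i) @ \oo --> (2 * l%:R / k%:R : R))%classic.
Proof.
move=> K0 k0 cf S u.
have cS : (S @ \oo --> (2 * l%:R / k%:R : R))%classic.
  rewrite -[X in (_ --> X)%classic]addr0.
  by apply: cvgD => //; exact: cvg_mean_level.
have cu : ((fun i => 2 * k%:R * u i) @ \oo --> (0 : R))%classic.
  rewrite -[X in (_ --> X)%classic](mulr0 (2 * k%:R : R)).
  by apply: cvgM; [exact: cvg_cst|exact: cvg_inv_pow].
split.
  by rewrite -[X in (_ --> X)%classic]addr0; apply: cvgD.
by rewrite -[X in (_ --> X)%classic]subr0; apply: cvgB.
Qed.

Lemma count_mono (R : realType) (x : nat -> R) (al rho : R) (N N' : nat) :
  (N <= N')%N ->
  \sum_(z <- differences x N) (dist_int (al * z) <= rho)%R%:R <=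
  \sum_(z <- differences x N') (dist_int (al * z) <= rho)%R%:R :> R.
Proof.
move=> NN; rewrite !sum_differences [leRHS](big_cat_nat (leq0n N) NN) /= lerDl.
by do 2!apply: sumr_ge0 => ? _.
Qed.

Lemma count_upper (R : realType) (x : nat -> R) (al rho : R) (k l N : nat) :
  (0 < k)%N -> (2 * l < N)%N -> rho * (k * N)%:R < l%:R - 1 ->
  2 * \sum_(z <- differences x N) (dist_int (al * z) <= rho)%R%:R <=
  N%:R * (mean_level R k l N + fluctuation x k l N al + 2 * k%:R / N%:R).
Proof.
move=> k0 lN hr; have N0 : (0 < N)%N by lia.
have NR : 0 < N%:R :> R by rewrite ltr0n.
have nn0 : N%:R != 0 :> R by rewrite gt_eqF.
have t0 : 0 <= 2 * k%:R / N%:R ^+ 2 :> R.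
  by rewrite divr_ge0 ?mulr_ge0 ?exprn_ge0 // ltW.
apply: (@le_trans _ _ (2 * \sum_(z <- differences x N)
   (smooth (k * N ^ 4) (2 * l * N ^ 3) (al * z) + 2 * k%:R / N%:R ^+ 2))).
  by rewrite ler_wpM2l //; apply: ler_sum => z _; exact: count_le_smooth.
rewrite big_split /= mulrDr sum_smooth // sum_const_seq [leRHS]mulrDr lerD2l.
rewrite mulrA double_size_differences (_ : N%:R * (2 * k%:R / N%:R) =
  N%:R * N%:R * (2 * k%:R / N%:R ^+ 2)); last by field.
by rewrite ler_wpM2r // ler_wpM2l ?(ltW NR) //; lra.
Qed.

Lemma count_lower (R : realType) (x : nat -> R) (al rho : R) (k l N : nat) :
  (0 < k)%N -> (2 * l < N)%N -> l%:R + 1 <= rho * (k * N)%:R ->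
  N%:R * (mean_level R k l N + fluctuation x k l N al - 2 * k%:R / N%:R) <=
  2 * \sum_(z <- differences x N) (dist_int (al * z) <= rho)%R%:R.
Proof.
move=> k0 lN hr; have N0 : (0 < N)%N by lia.
have NR : 0 < N%:R :> R by rewrite ltr0n.
have nn0 : N%:R != 0 :> R by rewrite gt_eqF.
have t0 : 0 <= 2 * k%:R / N%:R ^+ 2 :> R.
  by rewrite divr_ge0 ?mulr_ge0 ?exprn_ge0 // ltW.
have h : 2 * \sum_(z <- differences x N) smooth (k * N ^ 4) (2 * l * N ^ 3) (al * z) <=
   2 * \sum_(z <- differences x N) ((dist_int (al * z) <= rho)%R%:R + 2 * k%:R / N%:R ^+ 2).
  by rewrite ler_wpM2l //; apply: ler_sum => z _; exact: smooth_le_count.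
move: h; rewrite sum_smooth // big_split /= sum_const_seq (mulrDr 2).
rewrite (mulrA 2 (size _)%:R) double_size_differences.
have : N%:R * (N%:R - 1) * (2 * k%:R / N%:R ^+ 2) <= N%:R * (2 * k%:R / N%:R) :> R.
  rewrite (_ : N%:R * (2 * k%:R / N%:R) =
    N%:R * N%:R * (2 * k%:R / N%:R ^+ 2)); last by field.
  by rewrite ler_wpM2r // ler_wpM2l ?(ltW NR) //; lra.
rewrite mulrBr; lra.
Qed.

(** Choose the half-width l / k slightly above s.  For N between consecutive terms
    M <= N <= M' of the subsequence, count the pairs up to M' at radius s / M and
    divide by M. *)
Lemma poissonian_upper (R : realType) (x : nat -> R) (al s e : R) (K : nat) :
  (0 < K)%N -> 0 < s -> 0 < e ->
  (forall k l : nat, (0 < k)%N ->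
     ((fun i : nat => fluctuation x k l (i.+1 ^ K) al) @ \oo --> (0 : R))%classic) ->
  exists N0 : nat, forall N, (N0 <= N)%N ->
    (N%:R)^-1 * (pair_count (fun n => al * x n) s N)%:R <= 2 * s + e.
Proof.
move=> K0 s0 e0 H.
(* 4 / k < e leaves room for l to exceed s k by up to 2 *)
pose k := (Num.truncn (4 / e)).+1.
have k0 : (0 < k)%N by [].
have kR : 0 < k%:R :> R by rewrite ltr0n.
have ke : 4 < k%:R * e.
  by rewrite -ltr_pdivrMr //; have /andP[] := truncn_itv (ltW (divr_gt0 (ltr0n R 4) e0)).
have sk0 : 0 <= s * k%:R by rewrite mulr_ge0 ?ltW.
have /andP[sk1 sk2] := truncn_itv sk0.
pose l := (Num.truncn (s * k%:R) + 2)%N.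
have l1 : s * k%:R < l%:R - 1 by rewrite /l natrD; move: sk2; rewrite -natr1; lra.
have l2 : l%:R <= s * k%:R + 2 by rewrite /l natrD; lra.
have lim_lt : 2 * l%:R / k%:R < 2 * s + e.
  by rewrite ltr_pdivrMr //; lra.
have [cS _] := sandwich_cvg K0 k0 (H k l k0).
have crho := @cvg_ratio_pow R K.
rewrite -cvg_shiftS in cS.
have cR : ((fun i : nat => (i.+2 ^ K)%N%:R / (i.+1 ^ K)%N%:R *
    (mean_level R k l (i.+2 ^ K) + fluctuation x k l (i.+2 ^ K) al
     + 2 * k%:R / (i.+2 ^ K)%N%:R)) @ \oo --> (1 * (2 * l%:R / k%:R) : R))%classic.
  exact: cvgM.
rewrite mul1r in cR.
have crs : ((fun i : nat => (i.+2 ^ K)%N%:R / (i.+1 ^ K)%N%:R * (s * k%:R)) @ \oo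
   --> (1 * (s * k%:R) : R))%classic by apply: cvgM => //; exact: cvg_cst.
rewrite mul1r in crs.
have [i1 _ hi1] := cvgr_lt _ cR _ lim_lt.
have [i2 _ hi2] := cvgr_lt _ crs _ l1.
pose i0 := maxn (maxn i1 i2) (2 * l).
exists (i0.+1 ^ K)%N => N N0.
have [i [i0i MN NM]] := pow_bracket K0 N0.
have [ii1 ii2 li] : [/\ (i1 <= i)%N, (i2 <= i)%N & (2 * l <= i)%N].
  by move: i0i; rewrite !geq_max => /andP[/andP[? ?] ?].
have h1 := hi1 i ii1; have h2 := hi2 i ii2; rewrite /= in h1 h2.
have M1 : 0 < (i.+1 ^ K)%N%:R :> R by rewrite ltr0n expn_gt0.
have NR : 0 < N%:R :> R by apply: lt_le_trans M1 _; rewrite ler_nat.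
apply: le_trans (ltW h1).
set M' := (i.+2 ^ K)%N in NM h1 h2 *; set M := (i.+1 ^ K)%N in MN M1 h1 h2 *.
have lM : (2 * l < M')%N.
  apply: (@leq_trans i.+2); first by rewrite ltnS leqW.
  by rewrite /M' -[X in (X <= _)%N]expn1 leq_pexp2l.
apply: (@le_trans _ _ (M%:R^-1 * (pair_count (fun n => al * x n) s N)%:R)).
  by rewrite ler_wpM2r // lef_pV2 ?posrE // ler_nat.
rewrite pair_count_differences -[leRHS]mulrA [leRHS]mulrCA ler_wpM2l ?invr_ge0 ?(ltW M1) //.
apply: (@le_trans _ _ (2 * \sum_(z <- differences x M') (dist_int (al * z) <= s / N%:R)%R%:R)).
  by rewrite ler_wpM2l // count_mono.
apply: count_upper => //.
apply: le_lt_trans h2.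
rewrite (_ : M'%:R / M%:R * (s * k%:R) = s / M%:R * (k%:R * M'%:R)); last by ring.
rewrite natrM ler_wpM2r ?mulr_ge0 // ler_wpM2l ?(ltW s0) // lef_pV2 ?posrE //.
by rewrite ler_nat.
Qed.

(** The mirror image of [poissonian_upper]: the half-width is slightly below s,
    pairs are counted up to M at radius s / M', and one divides by M'. *)
Lemma poissonian_lower (R : realType) (x : nat -> R) (al s e : R) (K : nat) :
  (0 < K)%N -> 0 < s -> 0 < e ->
  (forall k l : nat, (0 < k)%N ->
     ((fun i : nat => fluctuation x k l (i.+1 ^ K) al) @ \oo --> (0 : R))%classic) ->
  exists N0 : nat, forall N, (N0 <= N)%N ->
    2 * s - e <= (N%:R)^-1 * (pair_count (fun n => al * x n) s N)%:R.
Proof.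
move=> K0 s0 e0 H.
(* 6 / k < e leaves room for l to fall short of s k by up to 3, and 3 < s k
   keeps the truncated subtraction defining l honest *)
pose k := (Num.truncn (6 / e) + Num.truncn (3 / s)).+1.
have k0 : (0 < k)%N by [].
have kR : 0 < k%:R :> R by rewrite ltr0n.
have ke : 6 < k%:R * e.
  rewrite -ltr_pdivrMr //; have /andP[_] := truncn_itv (ltW (divr_gt0 (ltr0n R 6) e0)).
  by move=> h; apply: (lt_le_trans h); rewrite ler_nat /k ltnS leq_addr.
have ks : 3 < s * k%:R.
  rewrite mulrC -ltr_pdivrMr //; have /andP[_] := truncn_itv (ltW (divr_gt0 (ltr0n R 3) s0)).
  by move=> h; apply: (lt_le_trans h); rewrite ler_nat /k ltnS leq_addl.
have sk0 : 0 <= s * k%:R by rewrite mulr_ge0 ?ltW.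
have /andP[sk1 sk2] := truncn_itv sk0.
have t3 : (3 <= Num.truncn (s * k%:R))%N.
  by rewrite -ltnS -(ltr_nat R); apply: lt_trans sk2.
pose l := (Num.truncn (s * k%:R) - 2)%N.
have l1 : l%:R + 1 < s * k%:R by rewrite /l natrB; [lra|lia].
have l2 : s * k%:R - 3 <= l%:R.
  by rewrite /l natrB; [move: sk2; rewrite -natr1; lra|lia].
have lim_gt : 2 * s - e < 2 * l%:R / k%:R.
  by rewrite ltr_pdivlMr //; lra.
have [_ cS] := sandwich_cvg K0 k0 (H k l k0).
have crho := @cvg_ratio_pow R K.
have cR : ((fun i : nat => ((i.+2 ^ K)%N%:R / (i.+1 ^ K)%N%:R)^-1 *
    (mean_level R k l (i.+1 ^ K) + fluctuation x k l (i.+1 ^ K) al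
     - 2 * k%:R / (i.+1 ^ K)%N%:R)) @ \oo --> (1^-1 * (2 * l%:R / k%:R) : R))%classic.
  by apply: cvgM => //; apply: cvgV => //; exact: oner_neq0.
rewrite invr1 mul1r in cR.
have crl : ((fun i : nat => (i.+2 ^ K)%N%:R / (i.+1 ^ K)%N%:R * (l%:R + 1)) @ \oo
   --> (1 * (l%:R + 1) : R))%classic by apply: cvgM => //; exact: cvg_cst.
rewrite mul1r in crl.
have [i1 _ hi1] := cvgr_gt _ cR _ lim_gt.
have [i2 _ hi2] := cvgr_lt _ crl _ l1.
pose i0 := maxn (maxn i1 i2) (2 * l).
exists (i0.+1 ^ K)%N => N N0.
have [i [i0i MN NM]] := pow_bracket K0 N0.
have [ii1 ii2 li] : [/\ (i1 <= i)%N, (i2 <= i)%N & (2 * l <= i)%N].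
  by move: i0i; rewrite !geq_max => /andP[/andP[? ?] ?].
have h1 := hi1 i ii1; have h2 := hi2 i ii2; rewrite /= in h1 h2.
have M1 : 0 < (i.+1 ^ K)%N%:R :> R by rewrite ltr0n expn_gt0.
have NR : 0 < N%:R :> R by apply: lt_le_trans M1 _; rewrite ler_nat.
apply: (le_trans (ltW h1)).
have M2 : 0 < (i.+2 ^ K)%N%:R :> R by rewrite ltr0n expn_gt0.
have lM : (2 * l < i.+1 ^ K)%N.
  apply: (@leq_trans i.+1); first by rewrite ltnS.
  by rewrite -[X in (X <= _)%N]expn1 leq_pexp2l.
set M' := (i.+2 ^ K)%N in M2 NM h1 h2 *; set M := (i.+1 ^ K)%N in lM MN M1 h1 h2 *.
apply: (@le_trans _ _ (M'%:R^-1 * (pair_count (fun n => al * x n) s N)%:R)); last first.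
  by rewrite ler_wpM2r // lef_pV2 ?posrE // ler_nat.
rewrite pair_count_differences invf_div -[leLHS]mulrA [leLHS]mulrCA.
rewrite ler_wpM2l ?invr_ge0 ?(ltW M2) //.
apply: (@le_trans _ _ (2 * \sum_(z <- differences x M) (dist_int (al * z) <= s / N%:R)%R%:R)); last first.
  by rewrite ler_wpM2l // count_mono.
apply: count_lower => //.
rewrite -(@ler_pM2l _ (M'%:R / M%:R)) ?divr_gt0 //; apply: (le_trans (ltW h2)).
rewrite natrM.
have Mn0 : M%:R != 0 :> R by rewrite gt_eqF.
rewrite (_ : M'%:R / M%:R * _ = s * k%:R * (M'%:R / N%:R)); last first.
  by field; rewrite Mn0 gt_eqF.
by rewrite ler_peMr // ler_pdivlMr // mul1r ler_nat.
Qed.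

(** * The criterion *)

Theorem corollary2p2 (R : realType) (x : nat -> R)
  (x_gt0 : forall n : nat, 0 < x n)
  (x_gap : exists c : R, 0 < c /\ forall n : nat, c <= x n.+1 - x n)
  (x_energy : exists delta : R, 0 < delta /\
     vinogradov_ll (fun N : nat => (Estar x N)%:R)
                   (fun N : nat => N%:R `^ (5 / 2 - delta))) :
  metric_poissonian x.
Proof.
have [c [c0 gap]] := x_gap.
have [delta [d0 [C EC]]] := x_energy.
(* a larger delta is a stronger hypothesis, so delta may be taken at most 1/4 *)
pose d := Num.min delta 4^-1.
have dpos : 0 < d by rewrite lt_min d0 invr_gt0 ltr0n.
have dlt : 0 < d <= 4^-1 by rewrite dpos ge_min lexx orbT.
have C0 : 0 <= Num.max C 0 by rewrite le_max lexx orbT.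
have EN N : (0 < N)%N -> (Estar x N)%:R <= Num.max C 0 * N%:R `^ (5 / 2 - d).
  move=> N0; apply: (le_trans (ler_norm _)); apply: (le_trans (EC N N0)).
  apply: (@le_trans _ _ (Num.max C 0 * N%:R `^ (5 / 2 - delta))).
    by rewrite ler_wpM2r ?powR_ge0 // le_max lexx.
  rewrite ler_wpM2l // ler_powR ?ler1n // lerD2l lerN2.
  by rewrite ge_min lexx.
pose K := (Num.truncn (4 / d)).+1.
have Kd : 4 / d <= K%:R.
  by apply: ltW; have /andP[] := truncn_itv (ltW (divr_gt0 (ltr0n R 4) dpos)).
have ae_k k := ae_foralln (fun l : nat =>
  ae_fluctuation_cvg0 l c0 gap dlt C0 EN Kd (ltn0Sn k)).
have := ae_foralln ae_k; apply: filterS => t cf s s0.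
have H k l : (0 < k)%N ->
    ((fun i : nat => fluctuation x k l (i.+1 ^ K) t) @ \oo --> (0 : R))%classic.
  by case: k => // k _; exact: cf.
apply/cvgrPdist_le => e e0.
have [N1 h1] := poissonian_upper (ltn0Sn _) s0 e0 H.
have [N2 h2] := poissonian_lower (ltn0Sn _) s0 e0 H.
exists (maxn N1 N2) => // N /= hN.
have u := h1 N (leq_trans (leq_maxl _ _) hN).
have v := h2 N (leq_trans (leq_maxr _ _) hN).
by rewrite ler_norml; apply/andP; split; lra.
Qed.
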